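(* For each $d$ let $A,V\in\mathbb{R}^{d\times d}$ be symmetric positive definite and $b\in\mathbb{R}^d$; let $\theta\in[0,1]$. Suppose there are constants $c,C>0$ and $\kappa\ge0$, independent of $d$, such that the eigenvalues $\lambda_i^2$ ($\lambda_i>0$) of $VA$ (equivalently, of $V^{1/2}AV^{1/2}$) satisfy $$c\,i^\kappa\le\lambda_i\le C\,i^\kappa\qquad\text{for } i=1,\dots,d .$$ If $h=l^2d^{-r}$ for $r=\tfrac13+2\kappa$ and $l>0$, and $\tau=\lim_{d\to\infty}\frac1{d^{6\kappa+1}}\sum_{i=1}^d\lambda_i^6$ (assumed to exist), then the Metropolis–Hastings algorithm with target $N(A^{-1}b,A^{-1})$ and proposal $$y=(I+\tfrac{\theta h}{2}VA)^{-1}\Big[(I-\tfrac{(1-\theta)h}{2}VA)x+\tfrac h2Vb+(hV)^{1/2}\xi\Big],\qquad \xi\sim N(0,I),$$ in equilibrium, satisfies $$\mathrm{E}[\alpha(x,y)]\to2\Phi\Big(-\frac{l^3|\theta-\frac12|\sqrt\tau}{4}\Big)$$ and, for each fixed $i$ and normalised eigenvector $q_i$ of $V^{1/2}AV^{1/2}$ corresponding to $\lambda_i^2$, $$\mathrm{E}[|q_i^TV^{-1/2}(x'-x)|^2]=2l^2d^{-r}\,\Phi\Big(-\frac{l^3|\theta-\frac12|\sqrt\tau}{4}\Big)+o(d^{-r})$$ as $d\to\infty$.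
   Context: $N(m,C)$ is the normal distribution with mean $m$ and covariance $C$; $\Phi$ is the standard normal cumulative distribution function; $V^{1/2}$ is the symmetric positive definite square root. With $\pi$ the target density and $q(x,\cdot)$ the density of the proposal $y$ given $x$, the Metropolis–Hastings acceptance probability is $\alpha(x,y)=1\wedge\frac{\pi(y)q(y,x)}{\pi(x)q(x,y)}$; the next state is $x'=y$ with probability $\alpha(x,y)$ and $x'=x$ otherwise. Equilibrium means $x\sim N(A^{-1}b,A^{-1})$. *)

(* Defs.v *)
From HB Require Import structures.
From mathcomp Require Import all_boot all_order all_algebra.
From mathcomp Require Import all_classical all_reals all_analysis.
From mathcomp Require Import measurable_realfun.

Set Implicit Arguments.
Unset Strict Implicit.
Unset Printing Implicit Defensive.

Import Order.TTheory GRing.Theory Num.Theory.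
Import numFieldNormedType.Exports.

Local Open Scope classical_set_scope.
Local Open Scope ring_scope.

Definition measure_mx_display : measure_display -> measure_display.
Proof. exact. Qed.

(* Sigma-algebra on matrices generated by the entries; on 'cV[R]_n it is the
   Borel sigma-algebra of R^n. *)
Section measurable_matrix.
Context {d} {T : measurableType d}.
Variables m n : nat.

Definition mx_sigma_algebra : set (set 'M[T]_(m, n)) :=
  <<s \bigcup_(ij : 'I_m * 'I_n)
        preimage_set_system setT (fun M : 'M[T]_(m, n) => M ij.1 ij.2)
          measurable >>.

Let mx_sigma_algebra0 : mx_sigma_algebra set0.
Proof. exact: sigma_algebra0. Qed.

Let mx_sigma_algebraC B : mx_sigma_algebra B -> mx_sigma_algebra (~` B).
Proof. exact: sigma_algebraC. Qed.

Let mx_sigma_algebra_bigcup (F : (set 'M[T]_(m, n))^nat) :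
  (forall k, mx_sigma_algebra (F k)) -> mx_sigma_algebra (\bigcup_k F k).
Proof. exact: sigma_algebra_bigcup. Qed.

HB.instance Definition _ := @isMeasurable.Build (measure_mx_display d)
  'M[T]_(m, n) mx_sigma_algebra
  mx_sigma_algebra0 mx_sigma_algebraC mx_sigma_algebra_bigcup.

End measurable_matrix.

Lemma measurable_mx_entry d (T : measurableType d) m n (i : 'I_m) (j : 'I_n) :
  measurable_fun setT (fun M : 'M[T]_(m, n) => M i j).
Proof.
move=> _ Y mY; apply: sub_sigma_algebra; exists (i, j) => //.
by exists Y.
Qed.

Lemma measurable_fun_mx d d' (S : measurableType d) (T : measurableType d')
    m n (f : S -> 'M[T]_(m, n)) :
  (forall i j, measurable_fun setT (fun s => f s i j)) -> measurable_fun setT f.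
Proof.
move=> mf; apply: (@measurability _ _ _ _ _ f
  (\bigcup_(ij : 'I_m * 'I_n)
     preimage_set_system setT (fun M : 'M[T]_(m, n) => M ij.1 ij.2) measurable)).
- by [].
- move=> _ [_ [[i j] _ [Y mY <-]] <-].
  by rewrite !setTI; have := mf i j measurableT Y mY; rewrite setTI.
Qed.

Section multivariate_normal.
Context {R : realType}.

Definition cons_cV n (p : measurableTypeR R * 'cV[R]_n) : 'cV[R]_n.+1 :=
  col_mx ((p.1 : R)%:M : 'cV[R]_1) p.2.

Lemma measurable_cons_cV n : measurable_fun setT (@cons_cV n).
Proof.
apply: measurable_fun_mx => i j.
rewrite (_ : (fun s => _) = fun p : measurableTypeR R * 'cV[R]_n =>
  match @fintype.split 1 n i with inl _ => p.1 : R | inr k => p.2 k j end);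
  last first.
  apply/funext => p; rewrite /cons_cV mxE.
  by case: fintype.split => k //; rewrite !ord1 mxE eqxx mulr1n.
case: (@fintype.split 1 n i) => k; first exact: measurable_fst.
by apply: (measurableT_comp (measurable_mx_entry k j)); exact: measurable_snd.
Qed.

HB.instance Definition _ n := isMeasurableFun.Build _ _ _ _
  (@cons_cV n) (@measurable_cons_cV n).

(* n-fold product of N(0, 1) on R^n, one coordinate at a time *)
Fixpoint std_normal_prob n : probability 'cV[R]_n R :=
  match n with
  | 0 => @dirac _ _ (0 : 'cV[R]_0) R
  | n'.+1 => distribution
      (normal_prob 0 1 \x std_normal_prob n')%E
      (@cons_cV n')
  end.

Definition affine_cV n (m : 'cV[R]_n) (L : 'M[R]_n) (z : 'cV[R]_n) : 'cV[R]_n :=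
  m + L *m z.

Lemma measurable_affine_cV n (m : 'cV[R]_n) (L : 'M[R]_n) :
  measurable_fun setT (affine_cV m L).
Proof.
apply: measurable_fun_mx => i j.
rewrite (_ : (fun s => _) =
  fun z : 'cV[R]_n => m i j + \sum_k L i k * z k j); last first.
  by apply/funext => z; rewrite /affine_cV !mxE.
apply: measurable_funD => //; apply: measurable_sum => k.
by apply: measurable_funM => //; exact: measurable_mx_entry.
Qed.

HB.instance Definition _ n (m : 'cV[R]_n) (L : 'M[R]_n) :=
  isMeasurableFun.Build _ _ _ _ (affine_cV m L) (measurable_affine_cV m L).

Definition posdefmx n (M : 'M[R]_n) : Prop :=
  M^T = M /\ forall x : 'cV[R]_n, x != 0 -> 0 < (x^T *m M *m x) 0 0.

(* the symmetric positive definite square root; a junk value when C is not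
   symmetric positive definite *)
Definition sqrtmx n (C : 'M[R]_n) : 'M[R]_n :=
  get [set S : 'M[R]_n | posdefmx S /\ S *m S = C].

(* N(m, C), for C symmetric positive definite, as the law of m + C^{1/2} z
   with z a vector of independent standard normal coordinates *)
Definition mvnormal_prob n (m : 'cV[R]_n) (C : 'M[R]_n) :
    probability 'cV[R]_n R :=
  distribution (std_normal_prob n) (affine_cV m (sqrtmx C)).

Definition mvnormal_pdf n (m : 'cV[R]_n) (C : 'M[R]_n) (x : 'cV[R]_n) : R :=
  (Num.sqrt ((2 * pi) ^+ n * \det C))^-1 *
  expR (- (((x - m)^T *m invmx C *m (x - m)) 0 0 / 2)).

Definition std_normal_cdf (x : R) : R := fine (normal_prob 0 1 `]-oo, x]).

End multivariate_normal.

Section metropolis_hastings.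
Context {R : realType} {T : Type}.
Variables (p : T -> R) (q : T -> T -> R).

Definition mh_accept (x y : T) : R :=
  Num.min 1 ((p y * q y x) / (p x * q x y)).

(* u is a uniform variate on [0, 1], so that the proposal y is accepted with
   conditional probability mh_accept x y *)
Definition mh_next (x y : T) (u : R) : T :=
  if u <= mh_accept x y then y else x.

End metropolis_hastings.

Section langevin_proposal.
Context {R : realType} {n : nat}.
Variables (A V : 'M[R]_n) (b : 'cV[R]_n) (theta h : R).

Definition proposal_mean (x : 'cV[R]_n) : 'cV[R]_n :=
  invmx (1%:M + (theta * h / 2) *: (V *m A)) *m
    ((1%:M - ((1 - theta) * h / 2) *: (V *m A)) *m x + (h / 2) *: (V *m b)).

Definition proposal_noise : 'M[R]_n :=
  invmx (1%:M + (theta * h / 2) *: (V *m A)) *m sqrtmx (h *: V).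

Definition proposal (x xi : 'cV[R]_n) : 'cV[R]_n :=
  invmx (1%:M + (theta * h / 2) *: (V *m A)) *m
    ((1%:M - ((1 - theta) * h / 2) *: (V *m A)) *m x + (h / 2) *: (V *m b)
     + sqrtmx (h *: V) *m xi).

Lemma proposalE (x xi : 'cV[R]_n) :
  proposal x xi = affine_cV (proposal_mean x) proposal_noise xi.
Proof. by rewrite /proposal /affine_cV mulmxDr mulmxA. Qed.

(* By proposalE, given x the proposal is
   N(proposal_mean x, proposal_noise *m proposal_noise^T). *)
Definition proposal_pdf (x y : 'cV[R]_n) : R :=
  mvnormal_pdf (proposal_mean x) (proposal_noise *m proposal_noise^T) y.

Definition target_prob : probability 'cV[R]_n R :=
  mvnormal_prob (invmx A *m b) (invmx A).

Definition target_pdf : 'cV[R]_n -> R :=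
  mvnormal_pdf (invmx A *m b) (invmx A).

Definition accept_prob : 'cV[R]_n -> 'cV[R]_n -> R :=
  mh_accept target_pdf proposal_pdf.

Definition next_state : 'cV[R]_n -> 'cV[R]_n -> R -> 'cV[R]_n :=
  mh_next target_pdf proposal_pdf.

(* joint law of the independent triple (x, xi, u): current state, noise of the
   proposal, and uniform variate of the accept-reject step *)
Definition equilibrium_prob :
    probability ('cV[R]_n * 'cV[R]_n * measurableTypeR R)%type R :=
  (target_prob \x mvnormal_prob 0 1%:M \x uniform_prob (@ltr01 R))%E.

Definition expected_accept : \bar R :=
  ('E_equilibrium_prob[(fun w =>
     let: (x, xi, _) := w in accept_prob x (proposal x xi))%R])%E.

Definition expected_sqjump (v : 'cV[R]_n) : \bar R :=
  ('E_equilibrium_prob[(fun w =>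
     let: (x, xi, u) := w in
     let x' := next_state x (proposal x xi) u in
     `|(v^T *m invmx (sqrtmx V) *m (x' - x)) 0 0| ^+ 2)%R])%E.

End langevin_proposal.

(* Main.v *)
Require Import Defs.
From HB Require Import structures.
From mathcomp Require Import all_boot all_order all_algebra.
From mathcomp Require Import all_classical all_reals all_analysis.
From mathcomp Require Import measurable_realfun ring lra.
From mathcomp.real_closed Require Import complex.

(** The problem is diagonal.  Put m = A^-1 b, S = V^(1/2) and M = S A S, and write
    x = m + S u.  In these whitened coordinates the proposal along an eigenvector
    of M is v = (f u + sqrt h xi) / e, with e = 1 + theta h lambda^2 / 2 and
    f = 1 - (1 - theta) h lambda^2 / 2 (proposal_coord).  It is reversible for a
    Gaussian law whose precision differs from that of the target by a multiple
    of h A V A, so the log acceptance ratio is the quadratic form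
    ((2 theta - 1) h / 8) (v^T M^2 v - u^T M^2 u) (accept_coord).  In equilibrium
    u = B z, with z and xi independent standard Gaussian vectors, and this form
    reads z^T P z + (T z)^T xi + xi^T K xi (log_ratio_forms).

    Two facts give its limit law without any central limit theorem.  First, a
    Gaussian quadratic form concentrates at its trace, with variance at most a
    constant times the trace of the square of its matrix (std_normal_quad).
    Second, given z, the cross term is exactly Gaussian, with variance
    z^T (T^T T) z, which concentrates in turn.  Hence the log ratio is close to
    a N(- s^2 / 2, s^2) variable, whose mean of min(1, exp) is 2 Phi(- s / 2)
    (gauss_accept); quadratic_accept makes this quantitative, using only that
    min(1, exp) is 1-Lipschitz.

    With x_i = h lambda_i^2, all the traces are sums of rational functions of the
    x_i.  The terms of order x_i^2 in the mean cancel (coef_mean_bound); the mean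
    and the variance are - ((2 theta - 1)^2 / 32) sum x_i^3 and
    ((2 theta - 1)^2 / 16) sum x_i^3, up to errors of order
    (max x_i) (sum x_i^3).
    The scaling of h is such that sum x_i^3 tends to l^6 tau (scale_Y_cvg) while
    max x_i is of order d^(- 1 / 3) (scaled_eigenvalue_le), which gives
    s = l^3 |theta - 1 / 2| sqrt tau / 2.

    For the jump along a unit eigenvector q, the drift is negligible against the
    noise sqrt h (q . xi) (sqjump_close), so the quantity to estimate is
    h times the mean of (q . xi)^2 times the acceptance probability.  A single
    noise coordinate has a vanishing influence on the acceptance, so the weight
    (q . xi)^2, of mean 1, factors out in the limit.  Both statements are
    therefore cases of the same weighted estimate (weighted_accept_close), with
    the weights 1 and (q . xi)^2. *)

Set Implicit Arguments.
Unset Strict Implicit.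
Unset Printing Implicit Defensive.

Import Order.TTheory GRing.Theory Num.Theory.
Import numFieldNormedType.Exports.

Local Open Scope classical_set_scope.
Local Open Scope ring_scope.

(** * The spectral theorem for real symmetric matrices *)

Section dot_product.
Context {R : realType}.

Definition dotv n (a b : 'cV[R]_n) : R := (a^T *m b) 0 0.

Lemma dotvE n (a b : 'cV[R]_n) : dotv a b = \sum_i a i 0 * b i 0.
Proof. by rewrite /dotv mxE; apply: eq_bigr => i _; rewrite mxE. Qed.

Lemma dotvC n (a b : 'cV[R]_n) : dotv a b = dotv b a.
Proof. by rewrite !dotvE; apply: eq_bigr => i _; rewrite mulrC. Qed.

Lemma dotvDl n (a b c : 'cV[R]_n) : dotv (a + b) c = dotv a c + dotv b c.
Proof. by rewrite /dotv linearD mulmxDl mxE. Qed.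

Lemma dotvDr n (a b c : 'cV[R]_n) : dotv a (b + c) = dotv a b + dotv a c.
Proof. by rewrite /dotv mulmxDr mxE. Qed.

Lemma dotvZl n k (a b : 'cV[R]_n) : dotv (k *: a) b = k * dotv a b.
Proof. by rewrite /dotv linearZ -scalemxAl mxE. Qed.

Lemma dotvZr n k (a b : 'cV[R]_n) : dotv a (k *: b) = k * dotv a b.
Proof. by rewrite /dotv -scalemxAr mxE. Qed.

Lemma dotvNl n (a b : 'cV[R]_n) : dotv (- a) b = - dotv a b.
Proof. by rewrite -scaleN1r dotvZl mulN1r. Qed.

Lemma dotvNr n (a b : 'cV[R]_n) : dotv a (- b) = - dotv a b.
Proof. by rewrite -scaleN1r dotvZr mulN1r. Qed.

Lemma dot0v n (a : 'cV[R]_n) : dotv 0 a = 0.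
Proof. by rewrite /dotv trmx0 mul0mx mxE. Qed.

Lemma dotv_mulmx m n (A : 'M[R]_(m, n)) a b :
  dotv a (A *m b) = dotv (A^T *m a) b.
Proof. by rewrite /dotv trmx_mul trmxK mulmxA. Qed.

Lemma dotvv_ge0 n (a : 'cV[R]_n) : 0 <= dotv a a.
Proof. by rewrite dotvE sumr_ge0 // => i _; rewrite -expr2 sqr_ge0. Qed.

Lemma dotvv_eq0 n (a : 'cV[R]_n) : (dotv a a == 0) = (a == 0).
Proof.
apply/idP/eqP => [|->]; last by rewrite dot0v.
rewrite dotvE psumr_eq0 => [/allP a0|i _]; last by rewrite -expr2 sqr_ge0.
apply/colP => i; rewrite mxE.
by have := a0 i (mem_index_enum i); rewrite -expr2 sqrf_eq0 => /eqP.
Qed.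

Lemma dotvv_gt0 n (a : 'cV[R]_n) : a != 0 -> 0 < dotv a a.
Proof. by move=> a0; rewrite lt_neqAle dotvv_ge0 andbT eq_sym dotvv_eq0. Qed.

Lemma mulmx_dotv n (a b c : 'cV[R]_n) : a *m (b^T *m c) = dotv b c *: a.
Proof. by rewrite [b^T *m c]mx11_scalar mul_mx_scalar. Qed.

End dot_product.

Section real_spectral.
Context {R : realType}.

(** The characteristic polynomial has a complex root; symmetry forces it to be
    real, and then the real and the imaginary part of a complex eigenvector are
    real eigenvectors unless they vanish. *)
Lemma symmetric_eigenvector n (M : 'M[R]_n.+1) : M^T = M ->
  exists a (v : 'cV[R]_n.+1), v != 0 /\ M *m v = a *: v.
Proof.
move=> MT; pose MC := map_mx (real_complex R) M.
have [z] : exists z : R[i], root (char_poly MC) z.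
  have : size (char_poly MC) != 1 by rewrite size_char_poly.
  by move=> /closed_rootP[z rz]; exists z.
rewrite -eigenvalue_root_char => /eigenvalueP[v Mv v0].
pose x : 'cV[R]_n.+1 := \col_i complex.Re (v 0 i).
pose y : 'cV[R]_n.+1 := \col_i complex.Im (v 0 i).
have [Mx My] : M *m x = complex.Re z *: x - complex.Im z *: y /\
    M *m y = complex.Im z *: x + complex.Re z *: y.
  have E i : \sum_j v 0 j * real_complex R (M i j) = z * v 0 i.
    have := congr1 (fun u : 'rV_n.+1 => u 0 i) Mv; rewrite !mxE => <-.
    by apply: eq_bigr => j _; rewrite !mxE -[in RHS]MT mxE.
  split; apply/colP => i; rewrite !mxE.
    have /= := congr1 (@complex.Re R) (E i).
    rewrite raddf_sum /=; case: (z) (v 0 i) => [a b] [c d] /= <-.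
    apply: eq_bigr => j _; rewrite !mxE; case: (v 0 j) => e f /=.
    by rewrite mulr0 subr0 mulrC.
  have /= := congr1 (@complex.Im R) (E i).
  rewrite raddf_sum /=; case: (z) (v 0 i) => [a b] [c d] /=.
  rewrite [b * c + _]addrC => <-.
  apply: eq_bigr => j _; rewrite !mxE; case: (v 0 j) => e f /=.
  by rewrite mulr0 add0r mulrC.
have b0 : complex.Im z = 0.
  have : dotv x (M *m y) = dotv y (M *m x).
    by rewrite dotv_mulmx MT dotvC.
  rewrite Mx My !dotvDr dotvNr !dotvZr (dotvC y x) => /eqP.
  rewrite -subr_eq0 => /eqP H.
  have {}H : complex.Im z * (dotv x x + dotv y y) = 0 by rewrite -H; ring.
  move/eqP: H; rewrite mulf_eq0 => /orP[/eqP//|].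
  rewrite paddr_eq0 ?dotvv_ge0// !dotvv_eq0 => /andP[/eqP x0 /eqP y0].
  case/eqP: v0; apply/rowP => i; rewrite mxE.
  have := congr1 (fun u : 'cV_n.+1 => u i 0) x0.
  have := congr1 (fun u : 'cV_n.+1 => u i 0) y0.
  by rewrite !mxE; case: (v 0 i) => p q /= -> ->.
rewrite b0 scale0r subr0 in Mx; rewrite b0 scale0r add0r in My.
have [x0|x0] := eqVneq x 0; last by exists (complex.Re z), x.
exists (complex.Re z), y; split=> //; apply: contra v0 => /eqP y0.
apply/eqP/rowP => i; rewrite mxE.
have := congr1 (fun u : 'cV_n.+1 => u i 0) x0.
have := congr1 (fun u : 'cV_n.+1 => u i 0) y0.
by rewrite !mxE; case: (v 0 i) => p q /= -> ->.
Qed.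

(** The reflection in the hyperplane orthogonal to a - b. *)
Lemma householder n (a b : 'cV[R]_n) : dotv a a = dotv b b ->
  exists H : 'M[R]_n, [/\ H^T = H, H *m H = 1%:M & H *m a = b].
Proof.
move=> ab; have [->|w0] := eqVneq a b.
  by exists 1%:M; rewrite trmx1 mulmx1 mul1mx.
pose w := a - b; have {}w0 : dotv w w != 0 by rewrite dotvv_eq0 subr_eq0.
pose k := 2 / dotv w w.
exists (1%:M - k *: (w *m w^T)).
have wwa : (w *m w^T) *m a = dotv w a *: w by rewrite -mulmxA mulmx_dotv.
split.
- by rewrite linearB linearZ /= trmx_mul trmxK trmx1.
- have WW : (w *m w^T) *m (w *m w^T) = dotv w w *: (w *m w^T).
    by rewrite mulmxA -(mulmxA w) mulmx_dotv -scalemxAl.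
  rewrite mulmxBl mul1mx mulmxBr mulmx1 -!scalemxAl -!scalemxAr WW !scalerA.
  have -> : k * k * dotv w w = k + k by rewrite /k; field.
  by rewrite scalerDl opprB addrK subrK.
- rewrite mulmxBl mul1mx -scalemxAl wwa scalerA.
  suff -> : k * dotv w a = 1 by rewrite scale1r /w opprB addrC subrK.
  rewrite /k; apply: (mulfI w0); rewrite mulr1 mulrAC mulrC divfK //.
  rewrite /w !(dotvDl, dotvDr, dotvNl, dotvNr) -ab (dotvC b a); ring.
Qed.

(** Induction on the dimension: the reflection that takes the first basis vector
    to a unit eigenvector makes the matrix block diagonal. *)
Lemma real_spectral n (M : 'M[R]_n) : M^T = M ->
  exists (O : 'M[R]_n) (D : 'rV[R]_n),
    O *m O^T = 1%:M /\ M = O^T *m diag_mx D *m O.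
Proof.
elim: n M => [|n IH] M MT.
  exists 1%:M, 0; split; first by rewrite trmx1 mulmx1.
  by apply/matrixP => -[].
have [a [v0 [v00 Mv0]]] := symmetric_eigenvector MT.
pose nv := Num.sqrt (dotv v0 v0).
have nv0 : nv != 0 by rewrite gt_eqF // sqrtr_gt0 dotvv_gt0.
pose v := nv^-1 *: v0.
have vv : dotv v v = 1.
  rewrite dotvZl dotvZr mulrA -invfM -expr2 sqr_sqrtr ?dotvv_ge0//.
  by rewrite mulVf // dotvv_eq0.
have Mv : M *m v = a *: v by rewrite -scalemxAr Mv0 !scalerA mulrC.
pose e : 'cV[R]_(1 + n) := delta_mx 0 0.
have ee : dotv e e = dotv v v.
  rewrite vv dotvE big_ord_recl big1 => [|i _]; rewrite !mxE eqxx ?mulr1 ?addr0//.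
  by rewrite mul0r.
have [H [HT HH He]] := householder ee.
have Hv : H *m v = e by rewrite -He mulmxA HH mul1mx.
have [N NE] : exists N : 'M[R]_(1 + n), N = H *m M *m H by eexists.
have NT : N^T = N by rewrite NE !trmx_mul HT MT mulmxA.
have Ne : N *m e = a *: e by rewrite NE -mulmxA He -mulmxA Mv -scalemxAr Hv.
have N0 i : N i 0 = a * (i == 0)%:R.
  have := congr1 (fun u : 'cV_(1 + n) => u i 0) Ne.
  rewrite -/(col_mx _ _) !mxE (bigD1 0) //= big1 => [|j j0].
    by rewrite !mxE eqxx mulr1 addr0 andbT.
  by rewrite !mxE (negPf j0) mulr0.
have N1 i j : val j = 0%N -> N i j = a * (val i == 0%N)%:R.
  by move=> j0; have -> : j = 0 by apply: val_inj.
have N2 i j : val i = 0%N -> N i j = a * (val j == 0%N)%:R.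
  by move=> i0; rewrite -NT mxE N1.
have [U [D' [OO ND]]] : exists (O : 'M[R]_n) (D : 'rV[R]_n),
    O *m O^T = 1%:M /\ drsubmx N = O^T *m diag_mx D *m O.
  by apply: IH; rewrite trmx_drsub NT.
have Nblock : N = block_mx (a%:M : 'M[R]_1) 0 0 (drsubmx N).
  rewrite -[LHS]submxK; congr block_mx.
  - by apply/matrixP => i j; rewrite !ord1 !mxE N1 //= mulr1.
  - by apply/matrixP => i j; rewrite !ord1 !mxE N2 //= mulr0.
  - by apply/matrixP => i j; rewrite !ord1 !mxE N1 //= mulr0.
pose Q : 'M[R]_(1 + n) := block_mx (1%:M : 'M[R]_1) 0 0 U.
have QQ : Q *m Q^T = 1%:M.
  by rewrite /Q tr_block_mx !trmx0 trmx1 mulmx_block !mulmx0 !mul0mx mulmx1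
    !addr0 add0r OO -scalar_mx_block.
exists (Q *m H), (row_mx (a%:M : 'rV[R]_1) D'); split.
  by rewrite trmx_mul HT mulmxA -(mulmxA Q) HH mulmx1 QQ.
have DE : diag_mx (row_mx (a%:M : 'rV[R]_1) D') = block_mx (a%:M : 'M[R]_1) 0 0 (diag_mx D').
  rewrite diag_mx_row; congr block_mx.
  by apply/matrixP => i j; rewrite !ord1 !mxE !eqxx.
rewrite trmx_mul HT DE.
rewrite [LHS](_ : M = H *m N *m H); last first.
  by rewrite NE !mulmxA HH mul1mx -mulmxA HH mulmx1.
have -> : N = Q^T *m block_mx (a%:M : 'M[R]_1) 0 0 (diag_mx D') *m Q.
  rewrite Nblock ND /Q tr_block_mx !trmx0 trmx1 !mulmx_block.
  by rewrite !(mulmx0, mul0mx, addr0, add0r, mul1mx, mulmx1).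
by rewrite !mulmxA.
Qed.

End real_spectral.

(** * Functional calculus and the positive definite square root *)

Section functional_calculus.
Context {R : realType} {n : nat}.
Variables (U : 'M[R]_n) (D : 'rV[R]_n).
Hypothesis UU : U *m U^T = 1%:M.

(** The matrix f(M), where M is the symmetric matrix with eigenvalues D and
    orthonormal eigenvectors the rows of U, that is, M = fcalc id. *)
Definition fcalc (f : R -> R) : 'M[R]_n := U^T *m diag_mx (map_mx f D) *m U.

Lemma eq_fcalc f g : (forall i, f (D 0 i) = g (D 0 i)) -> fcalc f = fcalc g.
Proof.
move=> fg; rewrite /fcalc; congr (_ *m diag_mx _ *m _).
by apply/rowP => i; rewrite !mxE.
Qed.

Lemma fcalc_cst a : fcalc (fun=> a) = a%:M.
Proof.
rewrite /fcalc (_ : map_mx _ _ = const_mx a); last by apply/rowP => i; rewrite !mxE.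
rewrite diag_const_mx -mulmxA mul_scalar_mx -scalemxAr (mulmx1C UU).
by rewrite scalemx1.
Qed.

Lemma fcalcD f g : fcalc f + fcalc g = fcalc (fun x => f x + g x).
Proof.
rewrite /fcalc -mulmxDl -mulmxDr -linearD; congr (_ *m diag_mx _ *m _).
by apply/rowP => i; rewrite !mxE.
Qed.

Lemma fcalcZ a f : a *: fcalc f = fcalc (fun x => a * f x).
Proof.
rewrite /fcalc scalemxAl scalemxAr -linearZ; congr (_ *m diag_mx _ *m _).
by apply/rowP => i; rewrite !mxE.
Qed.

Lemma fcalcM f g : fcalc f *m fcalc g = fcalc (fun x => f x * g x).
Proof.
rewrite /fcalc !mulmxA -[_ *m U *m U^T]mulmxA UU mulmx1 -[_ *m _ *m diag_mx _]mulmxA.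
rewrite mulmx_diag; congr (_ *m diag_mx _ *m _).
by apply/rowP => i; rewrite !mxE.
Qed.

Lemma tr_fcalc f : (fcalc f)^T = fcalc f.
Proof. by rewrite /fcalc !trmx_mul trmxK tr_diag_mx mulmxA. Qed.

Lemma dotv_fcalcZ a f (x y : 'cV[R]_n) :
  a * dotv x (fcalc f *m y) = dotv x (fcalc (fun t => a * f t) *m y).
Proof. by rewrite -fcalcZ -scalemxAl dotvZr. Qed.

Lemma dotv_fcalcD f g (x y : 'cV[R]_n) :
  dotv x (fcalc f *m y) + dotv x (fcalc g *m y) =
  dotv x (fcalc (fun t => f t + g t) *m y).
Proof. by rewrite -fcalcD mulmxDl dotvDr. Qed.

Lemma dotv_fcalcC f (x y : 'cV[R]_n) :
  dotv x (fcalc f *m y) = dotv y (fcalc f *m x).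
Proof. by rewrite dotv_mulmx tr_fcalc dotvC. Qed.

Lemma dotv_fcalcM f g (x y : 'cV[R]_n) :
  dotv (fcalc f *m x) (fcalc g *m y) = dotv x (fcalc (fun t => f t * g t) *m y).
Proof. by rewrite -fcalcM -mulmxA [RHS]dotv_mulmx tr_fcalc. Qed.

Lemma eq_dotv_fcalc f g (x y : 'cV[R]_n) : (forall i, f (D 0 i) = g (D 0 i)) ->
  dotv x (fcalc f *m y) = dotv x (fcalc g *m y).
Proof. by move=> /eq_fcalc ->. Qed.

Lemma mxtrace_fcalc f : \tr (fcalc f) = \sum_i f (D 0 i).
Proof.
rewrite /fcalc mxtrace_mulC mulmxA UU mul1mx mxtrace_diag.
by apply: eq_bigr => i _; rewrite mxE.
Qed.

Lemma fcalc_eigenvector a (q : 'cV[R]_n) f :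
  fcalc id *m q = a *: q -> fcalc f *m q = f a *: q.
Proof.
move=> Mq; pose p := U *m q.
have Dp i : D 0 i * p i 0 = a * p i 0.
  have : U *m (fcalc id *m q) = a *: p by rewrite Mq -scalemxAr.
  rewrite /fcalc !mulmxA UU mul1mx -mulmxA mul_diag_mx.
  by move=> /colP/(_ i); rewrite !mxE.
have fp : diag_mx (map_mx f D) *m p = f a *: p.
  apply/colP => i; rewrite mul_diag_mx [LHS]mxE [RHS]mxE [map_mx f D 0 i]mxE.
  have [->|p0] := eqVneq (p i 0) 0; first by rewrite !mulr0.
  by rewrite (mulIf p0 (Dp i)).
by rewrite /fcalc -!mulmxA fp -scalemxAr /p mulmxA (mulmx1C UU) mul1mx.
Qed.

Lemma fcalc_unit f : (forall i, f (D 0 i) != 0) -> fcalc f \in unitmx.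
Proof.
move=> f0; suff : fcalc f *m fcalc (fun x => (f x)^-1) = 1%:M.
  by move=> /mulmx1_unit[].
by rewrite fcalcM -(fcalc_cst 1); apply: eq_fcalc => i; rewrite mulfV.
Qed.

Lemma invmx_fcalc f : (forall i, f (D 0 i) != 0) ->
  invmx (fcalc f) = fcalc (fun x => (f x)^-1).
Proof.
move=> f0; have fu := fcalc_unit f0.
rewrite -[RHS](mulKmx fu) fcalcM.
rewrite (@eq_fcalc (fun x => f x * (f x)^-1) (fun=> 1)) => [|i].
  by rewrite fcalc_cst mulmx1.
by rewrite mulfV.
Qed.

Lemma fcalc_form f (x : 'cV[R]_n) :
  (x^T *m fcalc f *m x) 0 0 = \sum_i f (D 0 i) * (U *m x) i 0 ^+ 2.
Proof.
rewrite /fcalc !mulmxA -trmx_mul -!mulmxA mulmxA -(mulmxA _ _ (U *m x)).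
rewrite mul_diag_mx -/(dotv _ _) dotvE; apply: eq_bigr => i _.
by rewrite !mxE; ring.
Qed.

Lemma fcalc_posdef f : (forall i, 0 < f (D 0 i)) -> posdefmx (fcalc f).
Proof.
move=> f0; split=> [|x x0]; first exact: tr_fcalc.
rewrite fcalc_form lt_neqAle sumr_ge0 => [|i _]; last first.
  by rewrite mulr_ge0 ?sqr_ge0// ltW.
rewrite andbT eq_sym; apply: contra x0 => /eqP S0.
have : U *m x = 0.
  apply/colP => i; rewrite [RHS]mxE.
  have /psumr_eq0P/(_ S0 i isT)/eqP : forall i, true ->
      0 <= f (D 0 i) * (U *m x) i 0 ^+ 2.
    by move=> j _; rewrite mulr_ge0 ?sqr_ge0// ltW.
  by rewrite mulf_eq0 gt_eqF //= sqrf_eq0 => /eqP.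
by move=> /(congr1 (mulmx U^T)); rewrite mulmxA (mulmx1C UU) mul1mx mulmx0 => ->.
Qed.

Lemma posdef_fcalc f : posdefmx (fcalc f) -> forall i, 0 < f (D 0 i).
Proof.
move=> [_ fpd] i; pose x : 'cV[R]_n := U^T *m delta_mx i 0.
have Ux : U *m x = delta_mx i 0 by rewrite mulmxA UU mul1mx.
have x0 : x != 0.
  apply/eqP => x0; move: Ux; rewrite x0 mulmx0 => /colP/(_ i)/eqP.
  by rewrite !mxE !eqxx eq_sym oner_eq0.
have := fpd x x0; rewrite fcalc_form Ux (bigD1 i) //= big1 => [|j ji].
  by rewrite !mxE !eqxx expr1n mulr1 addr0.
by rewrite !mxE (negPf ji) expr0n mulr0.
Qed.

End functional_calculus.

Section positive_definite.
Context {R : realType}.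
Implicit Types n : nat.

Lemma posdef_spectral n (C : 'M[R]_n) : posdefmx C ->
  exists U D, [/\ U *m U^T = 1%:M, C = fcalc U D id & forall i, 0 < D 0 i].
Proof.
move=> Cpd; have [U [D [UU CE]]] := real_spectral Cpd.1.
have {}CE : C = fcalc U D id by rewrite /fcalc map_mx_id.
exists U, D; split=> //; rewrite CE in Cpd.
exact: (posdef_fcalc UU Cpd).
Qed.

Lemma posdef_unit n (C : 'M[R]_n) : posdefmx C -> C \in unitmx.
Proof.
move=> /posdef_spectral[U [D [UU -> D0]]].
by apply: fcalc_unit => // i; rewrite gt_eqF.
Qed.

Lemma posdef_inv n (C : 'M[R]_n) : posdefmx C -> posdefmx (invmx C).
Proof.
move=> /posdef_spectral[U [D [UU -> D0]]].
rewrite invmx_fcalc // => [|i]; last by rewrite gt_eqF.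
by apply: fcalc_posdef => // i; rewrite invr_gt0.
Qed.

Lemma posdef_scale n (C : 'M[R]_n) a : 0 < a -> posdefmx C -> posdefmx (a *: C).
Proof.
move=> a0 /posdef_spectral[U [D [UU -> D0]]].
by rewrite fcalcZ; apply: fcalc_posdef => // i; rewrite mulr_gt0.
Qed.

Lemma posdef1 n : posdefmx (1%:M : 'M[R]_n).
Proof.
split=> [|x x0]; first exact: trmx1.
by rewrite mulmx1; exact: dotvv_gt0.
Qed.

Lemma posdef_congr n (C S : 'M[R]_n) : S \in unitmx -> posdefmx C ->
  posdefmx (S^T *m C *m S).
Proof.
move=> Su [CT Cpd]; split=> [|x x0]; first by rewrite !trmx_mul trmxK CT mulmxA.
rewrite !mulmxA -trmx_mul -!mulmxA mulmxA; apply: Cpd.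
apply: contra x0 => /eqP Sx; apply/eqP.
by rewrite -[x](mulKmx Su) Sx mulmx0.
Qed.

(** Two square roots S and T satisfy S (S - T) + (S - T) T = 0, and a Sylvester
   equation with positive coefficients has only the zero solution. *)
Lemma posdef_sqrt_inj n (S T : 'M[R]_n) : posdefmx S -> posdefmx T ->
  S *m S = T *m T -> S = T.
Proof.
move=> Spd Tpd ST.
have [U [s [UU SE s0]]] := posdef_spectral Spd.
have [W [t [WW TE t0]]] := posdef_spectral Tpd.
pose Y := U *m (S - T) *m W^T.
have sY : diag_mx s *m Y = - (Y *m diag_mx t).
  have US : diag_mx s *m U = U *m S.
    by rewrite SE /fcalc map_mx_id // !mulmxA UU mul1mx.
  have TW : W^T *m diag_mx t = T *m W^T.
    by rewrite TE /fcalc map_mx_id // -!mulmxA WW mulmx1.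
  rewrite /Y !mulmxA US -!mulmxA TW !mulmxA -mulNmx; congr (_ *m _).
  rewrite -!mulmxA -mulmxN; congr (_ *m _).
  by rewrite mulmxBr mulmxBl opprB ST.
have Y0 : Y = 0.
  move: sY; move: Y => Y sY; apply/matrixP => i j; rewrite mxE.
  have /matrixP/(_ i j) := sY.
  rewrite mul_diag_mx mul_mx_diag !mxE => /eqP; rewrite -subr_eq0 opprK.
  rewrite [Y i j * _]mulrC -mulrDl mulf_eq0 gt_eqF ?addr_gt0 //=.
  by move=> /eqP.
apply/eqP; rewrite -subr_eq0; apply/eqP.
have := congr1 (fun Z => U^T *m Z *m W) Y0.
rewrite /Y mulmx0 mul0mx !mulmxA (mulmx1C UU) mul1mx -mulmxA (mulmx1C WW).
by rewrite mulmx1.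
Qed.

Lemma sqrtmxP n (C : 'M[R]_n) : posdefmx C ->
  posdefmx (sqrtmx C) /\ sqrtmx C *m sqrtmx C = C.
Proof.
move=> Cpd; rewrite /sqrtmx.
case: (@getPex _ [set S : 'M[R]_n | posdefmx S /\ S *m S = C]) => //.
have [U [D [UU CE D0]]] := posdef_spectral Cpd.
exists (fcalc U D Num.sqrt); split.
  by apply: fcalc_posdef => // i; rewrite sqrtr_gt0.
rewrite fcalcM // CE; apply: eq_fcalc => i.
by rewrite -expr2 sqr_sqrtr // ltW.
Qed.

Lemma sqrtmx_eq n (C S : 'M[R]_n) : posdefmx S -> S *m S = C -> sqrtmx C = S.
Proof.
move=> Spd SC.
have Cpd : posdefmx C.
  have := posdef_congr (posdef_unit Spd) (posdef1 n).
  by rewrite mulmx1 Spd.1 SC.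
have [Qpd QC] := sqrtmxP Cpd.
by apply: posdef_sqrt_inj => //; rewrite QC SC.
Qed.

Lemma sqrtmx1 n : sqrtmx (1%:M : 'M[R]_n) = 1%:M.
Proof. by apply: sqrtmx_eq (posdef1 n) _; rewrite mulmx1. Qed.

Lemma sqrtmxZ n a (C : 'M[R]_n) : 0 < a -> posdefmx C ->
  sqrtmx (a *: C) = Num.sqrt a *: sqrtmx C.
Proof.
move=> a0 Cpd; have [Spd SC] := sqrtmxP Cpd.
apply: sqrtmx_eq; first by apply: posdef_scale; rewrite ?sqrtr_gt0.
by rewrite -scalemxAl -scalemxAr scalerA -expr2 sqr_sqrtr ?ltW// SC.
Qed.

End positive_definite.

Section eigenvalues.
Context {F : fieldType}.

Lemma prod_XsubC_perm (s t : seq F) :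
  \prod_(a <- s) ('X - a%:P) = \prod_(a <- t) ('X - a%:P) -> perm_eq s t.
Proof.
elim: s t => [|a s IH] t.
  move=> /(congr1 (size \o @polyseq F)) /=; rewrite !size_prod_XsubC /=.
  by move=> [] /esym/size0nil ->.
move=> E; have ta : a \in t.
  by rewrite -root_prod_XsubC -E root_prod_XsubC mem_head.
have pt := perm_to_rem ta.
rewrite perm_sym (permPl pt) perm_cons perm_sym; apply: IH.
have Xa : 'X - a%:P != 0 by rewrite polyXsubC_eq0.
by apply: (mulfI Xa); move: E; rewrite big_cons (perm_big _ pt) big_cons.
Qed.

Lemma char_poly_similar n (P A B : 'M[F]_n) : P \in unitmx ->
  P *m A = B *m P -> char_poly A = char_poly B.
Proof.
move=> Pu PA; rewrite /char_poly.
have E : map_mx (@polyC F) P *m char_poly_mx A =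
    char_poly_mx B *m map_mx (@polyC F) P.
  rewrite /char_poly_mx mulmxBr mulmxBl -!map_mxM PA; congr (_ - _).
  by rewrite scalar_mxC.
have := congr1 determinant E; rewrite !det_mulmx mulrC; apply: mulIf.
by rewrite det_map_mx polyC_eq0 -unitfE.
Qed.

End eigenvalues.

(** * Integrals against the one-dimensional normal law *)

Section lebesgue_affine.
Context {R : realType}.
Local Notation mu := (@lebesgue_measure R).
Local Open Scope ereal_scope.

Let affine (s t : R) : measurableTypeR R -> measurableTypeR R :=
  fun x => (s * x + t)%R.

Let measurable_affine s t : measurable_fun setT (affine s t).
Proof.
by apply: measurable_funD => //; exact: measurable_funM.
Qed.

Lemma lebesgue_measure_affine (s t : R) A : s != 0%R -> measurable A ->
  mu A = `|s|%:E * pushforward mu (affine s t) A.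
Proof.
move=> s0 mA.
have s0' : (0 < `|s|)%R by rewrite normr_gt0.
pose k : {nonneg R} := NngNum (ltW s0').
suff : forall X, ocitv X -> mu X = mscale k (pushforward mu (affine s t)) X.
  by move=> H; rewrite [LHS](lebesgue_measure_unique (H (measurable_affine s t))).
move=> mst _ [[a b]] _ <-; rewrite /mscale /pushforward /=.
have [sp|sn] := ltP 0%R s.
  rewrite [X in _ * mu X](_ : _ = [set` `]((a - t) / s)%R, ((b - t) / s)%R]]); last first.
    apply/seteqP; split => x /=; rewrite /affine !in_itv /= ltr_pdivrMr//
      ler_pdivlMr// ltrBlDr lerBrDr mulrC //.
  rewrite !lebesgue_measure_itv /= !lte_fin ltr_pM2r ?invr_gt0// ltrD2r.
  case: ifPn => _; last by rewrite mule0.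
  by rewrite gtr0_norm// -!EFinB -EFinM; congr EFin; field; rewrite gt_eqF.
have {sn}sn : (s < 0)%R by rewrite lt_neqAle s0.
rewrite [X in _ * mu X](_ : _ = [set` `[((b - t) / s)%R, ((a - t) / s)%R[]); last first.
  apply/seteqP; split => x /=; rewrite /affine !in_itv /= ltr_ndivlMr//
    ler_ndivrMr// ltrBlDr lerBrDr mulrC andbC //.
rewrite !lebesgue_measure_itv /= !lte_fin ltr_nM2r ?invr_lt0// ltrD2r.
case: ifPn => _; last by rewrite mule0.
by rewrite ltr0_norm// -!EFinB -EFinM; congr EFin; field; rewrite lt_eqF.
Qed.

Lemma ge0_integral_affine (s t : R) (f : R -> \bar R) : s != 0%R ->
  measurable_fun setT f -> (forall x, 0 <= f x) ->
  \int[mu]_x f x = `|s|%:E * \int[mu]_x f (s * x + t)%R.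
Proof.
move=> s0 mf f0.
have s0' : (0 < `|s|)%R by rewrite normr_gt0.
pose k : {nonneg R} := NngNum (ltW s0').
pose nu := measure_function_pushforward__canonical__measure_function_Measure
  mu (measurable_affine s t).
transitivity (\int[mscale k nu]_x f x).
  apply: eq_measure_integral => A mA _ /=.
  by rewrite [LHS](lebesgue_measure_affine t s0 mA).
rewrite ge0_integral_mscale //=; congr (_ * _).
rewrite ge0_integral_pushforward //.
Qed.

End lebesgue_affine.

Section normal_density_integral.
Context {R : realType}.
Local Notation mu := (@lebesgue_measure R).
Local Open Scope ereal_scope.
Import HBNNSimple.

(** Monotone convergence reduces to indicator functions, for which the claim is
    the definition of the normal law. *)
Lemma ge0_integral_normal (m s : R) (f : measurableTypeR R -> \bar R) :
  measurable_fun setT f -> (forall x, 0 <= f x) ->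
  \int[normal_prob m s]_x f x = \int[mu]_x (f x * (normal_pdf m s x)%:E).
Proof.
move=> mf f0; pose p := normal_pdf m s.
have p0 x : (0 <= p x)%R by exact: normal_pdf_ge0.
have mp : measurable_fun setT (EFin \o p).
  by apply/measurable_EFinP; exact: measurable_normal_pdf.
pose f_ := nnsfun_approx measurableT mf.
transitivity (limn (fun n => \int[normal_prob m s]_x (f_ n x)%:E)).
  rewrite -monotone_convergence//.
  - apply: eq_integral => y _; apply/esym/cvg_lim => //.
    by apply: cvg_nnsfun_approx.
  - by move=> n; exact/measurable_EFinP/measurable_funP.
  - by move=> n y _; rewrite lee_fin.
  - by move=> y _ a b ab; rewrite lee_fin; exact/lefP/nd_nnsfun_approx.
transitivity (limn (fun n => \int[mu]_x ((f_ n x)%:E * (p x)%:E))); last first.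
  rewrite -monotone_convergence//.
  - apply: eq_integral => y _; apply/cvg_lim => //.
    apply: cvgeZr => //.
    by apply: cvg_nnsfun_approx.
  - move=> n; apply: emeasurable_funM => //.
    exact/measurable_EFinP/measurable_funP.
  - by move=> n y _; rewrite mule_ge0 ?lee_fin.
  - move=> y _ a b ab; rewrite lee_wpmul2r ?lee_fin//.
    exact/lefP/nd_nnsfun_approx.
congr (limn _); apply/funext => n.
have mA r : measurable (f_ n @^-1` [set r]) by [].
transitivity (\sum_(r \in range (f_ n)) (r%:E * normal_prob m s (f_ n @^-1` [set r]))).
  under eq_integral do rewrite fimfunE -fsumEFin//.
  rewrite ge0_integral_fsum//; last 2 first.
  - by move=> r; exact/measurable_EFinP/measurable_funM.
  - by move=> r x _; rewrite nnfun_muleindic_ge0.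
  apply: eq_fsbigr => r _.
  by rewrite integralZl_indic_nnsfun// integral_indic// setIT.
under [RHS]eq_integral.
  move=> x _; rewrite fimfunE -fsumEFin// ge0_mule_fsuml; last first.
    by move=> r; rewrite EFinM nnfun_muleindic_ge0.
  over.
rewrite [RHS]ge0_integral_fsum//; last 2 first.
- move=> r; apply: emeasurable_funM => //.
  exact/measurable_EFinP/measurable_funM.
- move=> r x _; apply: mule_ge0; last by rewrite lee_fin.
  by rewrite EFinM nnfun_muleindic_ge0.
apply: eq_fsbigr => r /[!inE] -[x _ <-].
under [RHS]eq_integral do rewrite EFinM -muleA.
rewrite ge0_integralZl//; last 3 first.
- by apply: emeasurable_funM => //; exact/measurable_EFinP.
- by move=> y _; rewrite mule_ge0 ?lee_fin.
- by rewrite lee_fin.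
congr (_ * _); rewrite /normal_prob [LHS]integral_mkcond.
congr (integral _ _ _); apply/funext => y; rewrite patchE indicE.
by case: ifPn => _; rewrite ?mul1e ?mul0e.
Qed.

End normal_density_integral.

Notation gauss := (normal_prob 0 1).

Section rotation.
Context {R : realType}.
Local Notation mu := (@lebesgue_measure R).
Local Notation RT := (measurableTypeR R).
Local Notation phi := (normal_pdf (0 : R) 1).

Lemma std_normal_pdfE (x : R) : phi x = normal_peak 1 * expR (- (x ^+ 2 / 2)).
Proof.
by rewrite normal_pdfE ?oner_neq0// /normal_fun subr0 expr1n mulNr.
Qed.

Local Open Scope ereal_scope.

Lemma measurable_fun_std_normal_pdf : measurable_fun setT (phi : RT -> R).
Proof. exact: measurable_normal_pdf. Qed.

Let gauss2E (G : RT * RT -> \bar R) : measurable_fun setT G ->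
  (forall z, 0 <= G z) ->
  \int[gauss]_x \int[gauss]_y G (x, y) =
  \int[mu]_x \int[mu]_y (G (x, y) * (phi x * phi y)%:E).
Proof.
move=> mG G0.
rewrite ge0_integral_normal; last 2 first.
- exact: (measurable_fun_fubini_tonelli_F (m2 := gauss) G mG G0).
- by move=> x; exact: integral_ge0.
congr (integral _ _ _); apply/funext => x.
have mGx : measurable_fun setT (fun y : RT => G (x, y)).
  exact: measurableT_comp.
rewrite ge0_integral_normal //.
rewrite -ge0_integralZr //; last 3 first.
- apply: emeasurable_funM => //; apply/measurable_EFinP.
  exact: measurable_fun_std_normal_pdf.
- by move=> y _; rewrite mule_ge0 // lee_fin normal_pdf_ge0.
- by rewrite lee_fin normal_pdf_ge0.
by congr (integral _ _ _); apply/funext => y; rewrite -muleA -EFinM mulrC.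
Qed.

Let rotation_neq0 (G : RT * RT -> \bar R) (c s : R) :
  measurable_fun setT G -> (forall z, 0 <= G z) ->
  (c ^+ 2 + s ^+ 2 = 1)%R -> s != 0%R ->
  \int[gauss]_x \int[gauss]_y G ((c * x + s * y)%R, (- s * x + c * y)%R) =
  \int[gauss]_x \int[gauss]_y G (x, y).
Proof.
move=> mG G0 cs s0; have s2 : (s ^+ 2 = 1 - c ^+ 2)%R by rewrite -cs; ring.
have mp2 (f g : RT * RT -> RT) : measurable_fun setT f -> measurable_fun setT g ->
    measurable_fun setT (fun z => (phi (f z) * phi (g z))%:E).
  move=> mf mg; apply/measurable_EFinP; apply: measurable_funM.
    exact: (measurableT_comp measurable_fun_std_normal_pdf).
  exact: (measurableT_comp measurable_fun_std_normal_pdf).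
have mlin (a b : R) : measurable_fun setT (fun z : RT * RT => (a * z.1 + b * z.2)%R).
  apply: measurable_funD; apply: measurable_funM => //.
have mlin' (a b e : R) :
    measurable_fun setT (fun z : RT * RT => ((a * z.1 + b * z.2) / e)%R).
  by apply: measurable_funM => //; exact: mlin.
have phi0 (x : R) : (0 <= phi x)%R by exact: normal_pdf_ge0.
pose G1 (z : RT * RT) := G ((c * z.1 + s * z.2)%R, (- s * z.1 + c * z.2)%R).
have mG1 : measurable_fun setT G1.
  by apply: measurableT_comp => //; apply: measurable_fun_pair; exact: mlin.
rewrite [RHS](gauss2E mG G0) [LHS](gauss2E mG1 (fun z => G0 _)).
pose H (z : RT * RT) := G (z.2, ((c * z.2 - z.1) / s)%R) *
  (phi z.1 * phi ((z.2 - c * z.1) / s))%:E.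
have mH : measurable_fun setT H.
  apply: emeasurable_funM.
    apply: measurableT_comp => //; apply: measurable_fun_pair => //.
    rewrite (_ : (fun z => _) = fun z : RT * RT => ((-1 * z.1 + c * z.2) / s)%R).
      exact: mlin'.
    by apply/funext => z; congr (_ / _)%R; ring.
  apply: mp2 => //.
  rewrite (_ : (fun z => _) = fun z : RT * RT => ((- c * z.1 + 1 * z.2) / s)%R).
    exact: mlin'.
  by apply/funext => z; congr (_ / _)%R; ring.
have H0 z : 0 <= H z by rewrite mule_ge0 // lee_fin mulr_ge0.
have sV0 : (s^-1 != 0)%R by rewrite invr_eq0.
transitivity (`|s^-1|%:E * \int[mu]_x \int[mu]_u H (x, u)).
  rewrite -ge0_integralZl //; last 2 first.
  - exact: (measurable_fun_fubini_tonelli_F (m2 := mu) H mH H0).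
  - by move=> x _; exact: integral_ge0.
  congr (integral _ _ _); apply/funext => x.
  rewrite [LHS](ge0_integral_affine (- (c * x) / s) sV0).
  - congr (_ * integral _ _ _); apply/funext => u; rewrite /G1 /H /=.
    have -> : (s^-1 * u + - (c * x) / s = (u - c * x) / s)%R by ring.
    have -> : (c * x + s * ((u - c * x) / s) = u)%R by field.
    have -> // : (- s * x + c * ((u - c * x) / s) = (c * u - x) / s)%R.
    apply: (mulIf s0); rewrite mulrDl divfK // -[in RHS](mulr1 x) -cs.
    have -> : (c * ((u - c * x) / s) * s = c * (u - c * x))%R by field.
    ring.
  - apply: emeasurable_funM; first exact: (measurableT_comp mG1).
    apply/measurable_EFinP; apply: measurable_funM => //.
    exact: measurable_fun_std_normal_pdf.
  - by move=> y; apply: mule_ge0; [exact: G0|rewrite lee_fin mulr_ge0].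
rewrite (fubini_tonelli H) //.
rewrite -ge0_integralZl //; last 2 first.
- exact: (measurable_fun_fubini_tonelli_G (m1 := mu) H mH H0).
- by move=> x _; exact: integral_ge0.
congr (integral _ _ _); apply/funext => u.
have sN0 : (- s != 0)%R by rewrite oppr_eq0.
rewrite (ge0_integral_affine (f := fun x => H (x, u)) (c * u) sN0) //; last first.
  exact: (measurableT_comp mH (pair2_measurable u)).
rewrite muleA -EFinM normrN -normrM mulVf // normr1 mul1e.
congr (integral _ _ _); apply/funext => v; rewrite /H /=.
have -> : ((c * u - (- s * v + c * u)) / s = v)%R by field.
have -> : ((u - c * (- s * v + c * u)) / s = s * u + c * v)%R.
  apply: (mulIf s0); rewrite divfK //.
  have -> : ((s * u + c * v) * s = s ^+ 2 * u + c * v * s)%R by ring.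
  by rewrite s2; ring.
congr (_ * _%:E); rewrite !std_normal_pdfE mulrACA -expRD [RHS]mulrACA -expRD.
congr (_ * expR _)%R.
have -> : ((- s * v + c * u) ^+ 2 =
  s ^+ 2 * v ^+ 2 - 2 * s * v * c * u + c ^+ 2 * u ^+ 2)%R by ring.
have -> : ((s * u + c * v) ^+ 2 =
  s ^+ 2 * u ^+ 2 + 2 * s * v * c * u + c ^+ 2 * v ^+ 2)%R by ring.
by rewrite s2; field.
Qed.

(** The standard Gaussian density on the plane is a function of x^2 + y^2;
    the two substitutions y = (u - c x) / s and x = c u - s v perform the
    rotation one coordinate at a time. *)
Lemma gauss_rotation (G : RT * RT -> \bar R) (c s : R) :
  measurable_fun setT G -> (forall z, 0 <= G z) ->
  (c ^+ 2 + s ^+ 2 = 1)%R ->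
  \int[gauss]_x \int[gauss]_y G ((c * x + s * y)%R, (- s * x + c * y)%R) =
  \int[gauss]_x \int[gauss]_y G (x, y).
Proof.
move=> mG G0 cs; have [s0|s0] := eqVneq s 0%R; last exact: rotation_neq0.
move: cs; rewrite s0 expr0n addr0 => /eqP; rewrite sqrf_eq1 => /orP[] /eqP ->.
  congr (integral _ _ _); apply/funext => x; congr (integral _ _ _).
  by apply/funext => y; congr (G (_, _)); ring.
(* the half-turn is the square of the quarter-turn *)
have q1 : (0 ^+ 2 + 1 ^+ 2 = 1 :> R)%R by ring.
pose G1 (z : RT * RT) := G ((0 * z.1 + 1 * z.2)%R, (- 1 * z.1 + 0 * z.2)%R).
have mG1 : measurable_fun setT G1.
  apply: measurableT_comp => //; apply: measurable_fun_pair;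
  by apply: measurable_funD; apply: measurable_funM.
rewrite -(rotation_neq0 mG G0 q1 (oner_neq0 _)).
rewrite -(rotation_neq0 (G := G1) mG1 (fun z => G0 _) q1 (oner_neq0 _)).
congr (integral _ _ _); apply/funext => x; congr (integral _ _ _).
by apply/funext => y; rewrite /G1 /=; congr (G (_, _)); ring.
Qed.

(** A rotation of the plane takes the combination a x + b y to a multiple of the
    first coordinate. *)
Lemma gauss_comb (f : RT -> \bar R) (a b : R) :
  measurable_fun setT f -> (forall z, 0 <= f z) ->
  \int[gauss]_x \int[gauss]_y f (a * x + b * y)%R =
  \int[gauss]_x f (Num.sqrt (a ^+ 2 + b ^+ 2) * x)%R.
Proof.
move=> mf f0; set r := Num.sqrt _.
have r2 : (r ^+ 2 = a ^+ 2 + b ^+ 2)%R by rewrite sqr_sqrtr ?addr_ge0 ?sqr_ge0.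
have [r0|r0] := eqVneq r 0%R.
  have : (a ^+ 2 + b ^+ 2 == 0)%R by rewrite -r2 r0 expr0n.
  rewrite paddr_eq0 ?sqr_ge0 // !sqrf_eq0 => /andP[/eqP -> /eqP ->].
  rewrite r0; congr (integral _ _ _); apply/funext => x.
  under eq_integral do rewrite !mul0r add0r.
  by rewrite integral_cst //= probability_setT mule1 mul0r.
have cs : ((a / r) ^+ 2 + (b / r) ^+ 2 = 1)%R.
  by rewrite !expr_div_n -mulrDl -r2 divff // sqrf_eq0.
pose G (z : RT * RT) := f (r * z.1)%R.
have mG : measurable_fun setT G.
  by apply: measurableT_comp => //; exact: measurable_funM.
transitivity (\int[gauss]_x \int[gauss]_y G (x, y)).
  rewrite -(gauss_rotation mG (fun z => f0 _) cs).
  congr (integral _ _ _); apply/funext => x; congr (integral _ _ _).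
  by apply/funext => y; rewrite /G /=; congr f; field.
congr (integral _ _ _); apply/funext => x.
by rewrite /G /= integral_cst //= probability_setT mule1.
Qed.

End rotation.

(** * Moments of the standard normal law *)

Section gauss_moments.
Context {R : realType}.
Local Notation mu := (@lebesgue_measure R).
Local Notation RT := (measurableTypeR R).
Local Notation phi := (normal_pdf (0 : R) 1).

Lemma derive_std_normal_pdf (x : R) :
  is_derive x 1 (fun x : R => - (x * phi x) : R) ((x ^+ 2 - 1) * phi x).
Proof.
have -> : (fun x : R => - (x * phi x)) =
    (fun x : R => - (x * (normal_peak 1 * expR (- (x ^+ 2 / 2))))).
  by apply/funext => y; rewrite std_normal_pdfE.
rewrite std_normal_pdfE.
by apply: is_derive_eq; rewrite /GRing.scale /=; field.
Qed.

Local Open Scope ereal_scope.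

Lemma gauss_opp (f : RT -> \bar R) :
  measurable_fun setT f -> (forall z, 0 <= f z) ->
  \int[gauss]_x f (- x)%R = \int[gauss]_x f x.
Proof.
move=> mf f0; have := gauss_comb (-1) 0 mf f0.
rewrite expr0n addr0 sqrrN expr1n sqrtr1 => E.
transitivity (\int[gauss]_x f (1 * x)%R).
  rewrite -E; congr (integral _ _ _); apply/funext => x.
  under [RHS]eq_integral do rewrite mul0r addr0 mulN1r.
  by rewrite integral_cst //= probability_setT mule1.
by under eq_integral do rewrite mul1r.
Qed.

Let measurable_expRM (b : R) :
  measurable_fun setT (fun x : RT => (expR (b * x))%:E).
Proof.
have mM : measurable_fun setT (fun x : RT => (b * x)%R) by exact: measurable_funM.
by apply/measurable_EFinP; apply: measurableT_comp mM.
Qed.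

Lemma gauss_expR (a : R) :
  \int[gauss]_x (expR (a * x))%:E = (expR (a ^+ 2 / 2))%:E.
Proof.
rewrite ge0_integral_normal; last 2 first.
- exact: measurable_expRM.
- by move=> x; rewrite lee_fin expR_ge0.
transitivity (\int[mu]_x ((expR (a ^+ 2 / 2))%:E * (normal_pdf a 1 x)%:E)).
  congr (integral _ _ _); apply/funext => x; rewrite -!EFinM; congr EFin.
  rewrite std_normal_pdfE normal_pdfE ?oner_neq0// /normal_fun.
  rewrite mulrCA [RHS]mulrCA -!expRD; congr (_ * expR _)%R.
  by rewrite expr1n; field.
rewrite ge0_integralZl //; first by rewrite integral_normal_pdf mule1.
- by apply/measurable_EFinP; exact: measurable_normal_pdf.
- by move=> x _; rewrite lee_fin normal_pdf_ge0.
Qed.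

(** Its value is 3, but only its finiteness matters. *)
Definition gauss_m4 : R := fine (\int[gauss]_x (x ^+ 4)%:E).

(** x^4 is dominated by exponentials: |x| / 4 <= exp (|x| / 4). *)
Lemma gauss_moment4 : \int[gauss]_x ((x : R) ^+ 4)%:E = gauss_m4%:E.
Proof.
have m1 := measurable_expRM.
rewrite /gauss_m4 fineK // ge0_fin_numE; last first.
  by apply: integral_ge0 => x _; rewrite lee_fin exprn_even_ge0.
apply: (@le_lt_trans _ _
   (\int[gauss]_x (256%:E * ((expR (1 * x))%:E + (expR (- 1 * x))%:E)))).
  apply: ge0_le_integral => //.
  - by move=> x _; rewrite lee_fin exprn_even_ge0.
  - by apply/measurable_EFinP; exact: measurable_funX.
  - apply: emeasurable_funM => //.
    by apply: emeasurable_funD.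
  - move=> x _; rewrite -EFinD -EFinM lee_fin mul1r mulN1r.
    have -> : (x ^+ 4 = 256 * (`|x| / 4) ^+ 4)%R.
      by rewrite expr_div_n -normrX ger0_norm ?exprn_even_ge0 //; field.
    rewrite ler_pM2l //.
    apply: (@le_trans _ _ (expR (`|x| / 4) ^+ 4)%R).
      rewrite lerXn2r ?nnegrE ?expR_ge0 ?divr_ge0 //.
      by rewrite (le_trans _ (expR_ge1Dx _)) // lerDr.
    rewrite -expRM_natl -mulr_natl mulrCA divff // mulr1.
    by case: (ger0P x) => _; rewrite ?lerDl ?lerDr expR_ge0.
rewrite ge0_integralZl //; last 2 first.
- by apply: emeasurable_funD.
- by move=> x _; rewrite adde_ge0 ?lee_fin ?expR_ge0.
rewrite ge0_integralD //; try by move=> x _; rewrite lee_fin expR_ge0.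
by rewrite !gauss_expR -EFinD -EFinM ltry.
Qed.

Lemma gauss_m4_ge0 : (0 <= gauss_m4)%R.
Proof.
by rewrite -lee_fin -gauss_moment4; apply: integral_ge0 => x _;
  rewrite lee_fin exprn_even_ge0.
Qed.

Let psi (x : R) : R := (- (x * phi x))%R.

Let continuous_phi : continuous phi.
Proof. by apply: continuous_normal_pdf; rewrite oner_neq0. Qed.

Let continuous_psi : continuous psi.
Proof.
move=> x; apply: differentiable_continuous; apply/derivable1_diffP.
exact: (@ex_derive _ _ _ _ _ _ _ (derive_std_normal_pdf x)).
Qed.

Let derive1_psi (x : R) : (psi^`())%classic x = ((x ^+ 2 - 1) * phi x)%R.
Proof.
rewrite derive1E /psi.
exact: (@derive_val _ _ _ _ _ _ _ (derive_std_normal_pdf x)).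
Qed.

Let derivable_psi (x : R) : derivable psi x 1.
Proof. exact: (@ex_derive _ _ _ _ _ _ _ (derive_std_normal_pdf x)). Qed.

Let continuous_x2phi (a b : R) : continuous (fun x : R => ((a * x ^+ 2 + b) * phi x)%R).
Proof.
move=> x; apply: cvgM; last exact: continuous_phi.
apply: cvgD; last exact: cvg_cst.
by apply: cvgM; [exact: cvg_cst|exact: sqr_continuous].
Qed.

Let psi_cvg0 : psi x @[x --> +oo%R] --> (0 : R)%R.
Proof.
apply/cvgr0Pnorm_lt => e e0; near=> x.
have x0 : (0 < x)%R by near: x; exact: nbhs_pinfty_gt.
have k0 : (0 < normal_peak (1 : R))%R by rewrite normal_peak_gt0 ?oner_neq0.
rewrite normrN ger0_norm ?mulr_ge0 ?normal_pdf_ge0 1?ltW//.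
have xe : (2 * normal_peak 1 / e < x)%R.
  by near: x; apply: nbhs_pinfty_gt; exact: num_real.
rewrite std_normal_pdfE.
have h1 : (expR (- (x ^+ 2 / 2)) <= 2 / x ^+ 2)%R.
  rewrite expRN -[leRHS]invrK lef_pV2 ?posrE ?expR_gt0 ?invr_gt0 ?divr_gt0 ?exprn_gt0//.
  rewrite invf_div (le_trans _ (expR_ge1Dx _)) // lerDr //.
apply: (@le_lt_trans _ _ (2 * normal_peak 1 / x)%R).
  have -> : (2 * normal_peak 1 / x = x * (normal_peak 1 * (2 / x ^+ 2)))%R.
    by field; rewrite gt_eqF.
  by rewrite !ler_pM2l.
by rewrite ltr_pdivrMr // [ltRHS]mulrC -ltr_pdivrMr.
Unshelve. all: by end_near. Qed.

Let measurable_x2phi (a b : R) (D : set RT) :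
  measurable_fun D (fun x : RT => ((a * (x : R) ^+ 2 + b) * phi x)%:E).
Proof.
apply: measurable_funTS; apply/measurable_EFinP.
exact: continuous_measurable_fun (@continuous_x2phi a b).
Qed.

Let ftc1y : \int[mu]_(x in `[1%R, +oo[) ((1 * x ^+ 2 + (-1)) * phi x)%:E = (phi 1)%:E.
Proof.
rewrite (@ge0_continuous_FTC2y _ _ psi 1%R 0%R).
- by rewrite /psi mul1r EFinN oppeK add0e.
- move=> x x1; rewrite mulr_ge0 ?normal_pdf_ge0 // mul1r subr_ge0.
  by rewrite exprn_ege1.
- exact/continuous_subspaceT/continuous_x2phi.
- exact: psi_cvg0.
- by move=> x _; exact: derivable_psi.
- by apply: cvg_at_right_filter; exact: continuous_psi.
- by move=> x _; rewrite derive1_psi mul1r.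
Qed.

Let ftc01 : \int[mu]_(x in `[0%R, 1%R]) ((-1 * x ^+ 2 + 1) * phi x)%:E = (phi 1)%:E.
Proof.
have D (x : R) : is_derive x 1%R (- psi)%R (- ((x ^+ 2 - 1) * phi x))%R.
  exact: is_deriveN (derive_std_normal_pdf x).
have dN (x : R) : derivable (- psi)%R x 1 by exact: (@ex_derive _ _ _ _ _ _ _ (D x)).
have cN : continuous (- psi)%R by move=> x; apply: cvgN; exact: continuous_psi.
rewrite (@continuous_FTC2 _ _ (- psi)%R 0%R 1%R).
- by rewrite !fctE /psi mul0r !opprK mul1r sube0.
- exact: ltr01.
- exact/continuous_subspaceT/continuous_x2phi.
- split; first by move=> x _.
    by apply: cvg_at_right_filter; exact: cN.
  by apply: cvg_at_left_filter; exact: cN.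
- move=> x _; rewrite derive1E (@derive_val _ _ _ _ _ _ _ (D x)); ring.
Qed.

(** Integration by parts: x^2 phi - phi is the derivative of - x phi.  It is
    negative on [0, 1] and positive on [1, +oo[, and its two integrals cancel. *)
Lemma gauss_moment2 : \int[gauss]_x ((x : R) ^+ 2)%:E = 1.
Proof.
have cx2 : continuous (fun x : R => (x ^+ 2 * phi x)%R).
  by move=> x; apply: cvgM; [exact: sqr_continuous|exact: continuous_phi].
have phiN (x : R) : phi (- x) = phi x by rewrite !std_normal_pdfE sqrrN.
transitivity (\int[mu]_x (x ^+ 2 * phi x)%:E).
  rewrite ge0_integral_normal //.
  - by apply/measurable_EFinP; exact: measurable_funX.
  - by move=> x; rewrite lee_fin sqr_ge0.
rewrite -(integral_normal_pdf (0 : R) 1).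
have x20 (x : R) : (0 <= x ^+ 2 * phi x)%R.
  by rewrite mulr_ge0 ?sqr_ge0 ?normal_pdf_ge0.
rewrite (ge0_symfun_integralT x20 cx2) => [|x]; last by rewrite /= sqrrN phiN.
rewrite (ge0_symfun_integralT (f := phi)) => [|x||x]; last 3 first.
- exact: normal_pdf_ge0.
- exact: continuous_phi.
- by rewrite /= phiN.
congr (_ * _); rewrite -set_itvcy.
have -> : `[0%R, +oo[%classic = `[0%R, 1%R] `|` `]1%R, +oo[ :> set RT.
  by apply/esym; rewrite -itv_bndbnd_setU // bnd_simp.
have mx2 (D : set RT) : measurable_fun D (fun x : RT => (x ^+ 2 * phi x)%:E).
  apply: measurable_funTS; apply/measurable_EFinP.
  exact: continuous_measurable_fun.
have mphi (D : set RT) : measurable_fun D (fun x : RT => (phi x)%:E).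
  by apply: measurable_funTS; apply/measurable_EFinP; exact: measurable_normal_pdf.
have disj : [disjoint `[0%R, 1%R]%classic : set RT & `]1%R, +oo[%classic].
  apply/disj_setPS => x [] /=; rewrite !in_itv /= andbT => /andP[_ x1] x2.
  by move: (le_lt_trans x1 x2); rewrite ltxx.
rewrite !ge0_integral_setU //; try by move=> x _; rewrite lee_fin ?x20 ?normal_pdf_ge0.
rewrite !integral_itv_obnd_cbnd; last 2 first.
- exact: mphi.
- exact: mx2.
have -> : \int[mu]_(x in `[0%R, 1%R]) (phi x)%:E =
    (phi 1)%:E + \int[mu]_(x in `[0%R, 1%R]) (x ^+ 2 * phi x)%:E.
  rewrite -ftc01 -ge0_integralD //.
  - by apply: eq_integral => x _; rewrite -EFinD; congr EFin; ring.
  - move=> x; rewrite /= in_itv /= => /andP[x0 x1].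
    rewrite lee_fin mulr_ge0 ?normal_pdf_ge0 // mulN1r addrC subr_ge0.
    by rewrite exprn_ile1.
  - by move=> x _; rewrite lee_fin.
have -> : \int[mu]_(x in `[1%R, +oo[) (x ^+ 2 * phi x)%:E =
    (phi 1)%:E + \int[mu]_(x in `[1%R, +oo[) (phi x)%:E.
  rewrite -ftc1y -ge0_integralD //.
  - by apply: eq_integral => x _; rewrite -EFinD; congr EFin; ring.
  - move=> x; rewrite /= in_itv /= andbT => x1.
    by rewrite lee_fin mulr_ge0 ?normal_pdf_ge0 // mul1r subr_ge0 exprn_ege1.
  - by move=> x _; rewrite lee_fin normal_pdf_ge0.
by rewrite addeCA addeA.
Qed.

End gauss_moments.

Section gauss_quartic.
Context {R : realType}.
Local Notation RT := (measurableTypeR R).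
Local Open Scope ereal_scope.

Let measurable_even (a c e : R) :
  measurable_fun setT (fun t : RT => (a * (t : R) ^+ 4 + c * t ^+ 2 + e)%:E).
Proof.
apply/measurable_EFinP; apply: measurable_funD => //.
by apply: measurable_funD; apply: measurable_funM => //; exact: measurable_funX.
Qed.

Let gauss_even_ge0 (a c e : R) : (0 <= a)%R -> (0 <= c)%R -> (0 <= e)%R ->
  \int[gauss]_t (a * (t : R) ^+ 4 + c * t ^+ 2 + e)%:E = (gauss_m4 * a + c + e)%:E.
Proof.
move=> a0 c0 e0.
have m4 : measurable_fun setT (fun t : RT => ((t : R) ^+ 4)%:E).
  by apply/measurable_EFinP; exact: measurable_funX.
have m2 : measurable_fun setT (fun t : RT => ((t : R) ^+ 2)%:E).
  by apply/measurable_EFinP; exact: measurable_funX.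
have p4 (t : R) : 0 <= (t ^+ 4)%:E by rewrite lee_fin exprn_even_ge0.
have p2 (t : R) : 0 <= (t ^+ 2)%:E by rewrite lee_fin sqr_ge0.
transitivity (\int[gauss]_t (a%:E * (t ^+ 4)%:E + (c%:E * (t ^+ 2)%:E + e%:E))).
  by apply: eq_integral => t _; rewrite -!EFinM -!EFinD addrA.
rewrite ge0_integralD //; last 4 first.
- by move=> t _; rewrite mule_ge0.
- by apply: emeasurable_funM.
- by move=> t _; rewrite adde_ge0 ?mule_ge0.
- by apply: emeasurable_funD => //; apply: emeasurable_funM.
rewrite ge0_integralD //; last 2 first.
- by move=> t _; rewrite mule_ge0.
- by apply: emeasurable_funM.
rewrite !ge0_integralZl // gauss_moment4 gauss_moment2 integral_cst //=.
by rewrite probability_setT !mule1 -EFinM -!EFinD mulrC addrA.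
Qed.

(** Averaging over t and -t removes the odd powers, so that only the moments of
    orders 2 and 4 are involved. *)
Lemma gauss_quartic (a b c d e : R) : (0 <= a)%R ->
  (forall t : R, 0 <= a * t ^+ 4 + b * t ^+ 3 + c * t ^+ 2 + d * t + e)%R ->
  \int[gauss]_t (a * (t : R) ^+ 4 + b * t ^+ 3 + c * t ^+ 2 + d * t + e)%:E =
  (gauss_m4 * a + c + e)%:E.
Proof.
move=> a0 p0.
have e0 : (0 <= e)%R.
  have := p0 0%R; rewrite !expr0n /= !mulr0 !add0r; exact.
pose p (t : R) := (a * t ^+ 4 + b * t ^+ 3 + c * t ^+ 2 + d * t + e)%R.
pose q (t : R) := (a * t ^+ 4 + c * t ^+ 2 + e)%R.
have pq t : (p t + p (- t) = 2 * q t)%R by rewrite /p /q; ring.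
have q0 t : (0 <= q t)%R.
  by rewrite -(pmulr_rge0 _ (ltr0Sn R 1)) -pq; apply: addr_ge0; exact: p0.
have mp : measurable_fun setT (fun t : RT => (p t)%:E).
  apply/measurable_EFinP; rewrite /p.
  by do !(apply: measurable_funD => //); apply: measurable_funM => //;
    exact: measurable_funX.
have mpN : measurable_fun setT (fun t : RT => (p (- t)%R)%:E).
  by apply: (measurableT_comp mp).
have Iq : \int[gauss]_t (q t)%:E = (gauss_m4 * a + c + e)%:E.
  pose cp : R := (Num.max c 0)%R; pose cm : R := (Num.max (- c) 0)%R.
  have cp0 : (0 <= cp)%R by rewrite le_max lexx orbT.
  have cm0 : (0 <= cm)%R by rewrite le_max lexx orbT.
  have cE : c = (cp - cm)%R.
    rewrite /cp /cm; have [c0|/ltW c0] := leP 0%R c.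
      by rewrite max_r ?oppr_le0 // subr0.
    by rewrite max_l ?oppr_ge0 // sub0r opprK.
  have : \int[gauss]_t (q t)%:E + \int[gauss]_t (0 * (t : R) ^+ 4 + cm * t ^+ 2 + 0)%:E =
      \int[gauss]_t (a * (t : R) ^+ 4 + cp * t ^+ 2 + e)%:E.
    rewrite -ge0_integralD //.
    - by apply: eq_integral => t _; rewrite -EFinD /q cE; congr EFin; ring.
    - by move=> t _; rewrite lee_fin.
    - exact: measurable_even.
    - by move=> t _; rewrite lee_fin mul0r add0r addr0 mulr_ge0 ?sqr_ge0.
  rewrite (gauss_even_ge0 (lexx 0%R) cm0 (lexx 0%R)) (gauss_even_ge0 a0 cp0 e0).
  rewrite mulr0 add0r addr0 => H.
  have -> : (gauss_m4 * a + c + e = (gauss_m4 * a + cp + e) - cm)%R by rewrite cE; ring.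
  by rewrite EFinB -H addeK.
have I2 : \int[gauss]_t (p t)%:E + \int[gauss]_t (p t)%:E =
    2%:E * \int[gauss]_t (q t)%:E.
  have p0' t : 0 <= (p t)%:E by rewrite lee_fin; exact: p0.
  rewrite -[X in _ + X](gauss_opp mp p0').
  rewrite -ge0_integralD //.
  rewrite -ge0_integralZl //; last 2 first.
  - exact: measurable_even.
  - by move=> t _; rewrite lee_fin.
  by apply: eq_integral => t _; rewrite -EFinD -EFinM pq.
have : 0 <= \int[gauss]_t (p t)%:E.
  by apply: integral_ge0 => t _; rewrite lee_fin; exact: p0.
move: I2; rewrite Iq; case: (\int[gauss]_t (p t)%:E) => [r| |] //=.
by rewrite -EFinD -EFinM => -[] H _; congr EFin; lra.
Qed.

Lemma gauss_abs_le : \int[gauss]_t (`|t : R|)%:E <= 1.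
Proof.
have -> : 1 = \int[gauss]_t (0 * (t : R) ^+ 4 + 2^-1 * t ^+ 2 + 2^-1)%:E :> \bar R.
  by rewrite gauss_even_ge0 ?invr_ge0 //; congr EFin; field.
apply: ge0_le_integral => //.
- by apply/measurable_EFinP; exact: (measurableT_comp (@normr_measurable R setT)).
- move=> t _; rewrite lee_fin mul0r add0r.
  have := sqr_ge0 (`|t| - 1)%R; rewrite sqrrB expr1n mulr1 real_normK ?num_real//.
  lra.
Qed.

End gauss_quartic.

(** * Acceptance probability of a normal log ratio *)

Section gauss_accept.
Context {R : realType}.
Local Notation mu := (@lebesgue_measure R).
Local Notation RT := (measurableTypeR R).
Local Notation phi := (normal_pdf (0 : R) 1).

Definition accept_exp (x : R) : R := Num.min 1 (expR x).

Lemma accept_exp_ge0 x : 0 <= accept_exp x.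
Proof. by rewrite le_min ler01 expR_ge0. Qed.

Lemma accept_exp_le1 x : accept_exp x <= 1.
Proof. by rewrite ge_min lexx. Qed.

(** The slope of min(1, e^x) is at most 1, since e^x <= 1 wherever it is not
    constant. *)
Lemma accept_exp_lip x y : accept_exp x <= accept_exp y + `|x - y|.
Proof.
rewrite /accept_exp; have h0 := normr_ge0 (x - y).
have [y0|/ltW y0] := leP 0 y.
  have y1 : 1 <= expR y by rewrite -expR0 ler_expR.
  by rewrite (min_l y1) ge_min lerDl h0.
have y1 : expR y <= 1 by rewrite -expR0 ler_expR.
rewrite (min_r y1).
have [xy|/ltW xy] := leP x y.
  by rewrite ge_min; apply/orP; right; apply: ler_wpDr => //; rewrite ler_expR.
rewrite ger0_norm ?subr_ge0 //.
have [x0|/ltW x0] := leP 0 x.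
  by rewrite ge_min (_ : 1 <= _) //; have := expR_ge1Dx y; lra.
have x1 : expR x <= 1 by rewrite -expR0 ler_expR.
rewrite (min_r x1).
have -> : expR y = expR x * expR (y - x) by rewrite -expRD addrC subrK.
have h1 := expR_ge1Dx (y - x); have h3 := expR_gt0 x.
nra.
Qed.

Lemma measurable_accept_exp : measurable_fun setT (accept_exp : RT -> R).
Proof. by apply: measurable_minr => //; exact: measurable_expR. Qed.

Local Open Scope ereal_scope.

(** Tilting N(0, 1) by exp(s z - s^2/2) gives N(s, 1), and the two densities
    cross at z = s/2; each of the two tails beyond this point has mass
    Phi(- s/2). *)
Lemma gauss_accept (s : R) : (0 <= s)%R ->
  \int[gauss]_z (accept_exp (- (s ^+ 2 / 2) + s * z))%:E =
  (2 * std_normal_cdf (- (s / 2)))%:E.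
Proof.
move=> s0.
have mphi (m : R) (D : set RT) : measurable_fun D (fun z : RT => (normal_pdf m 1 z)%:E).
  by apply: measurable_funTS; apply/measurable_EFinP; exact: measurable_normal_pdf.
have tilt (z : R) : (expR (- (s ^+ 2 / 2) + s * z) * phi z = normal_pdf s 1 z)%R.
  rewrite std_normal_pdfE normal_pdfE ?oner_neq0// /normal_fun.
  rewrite mulrCA -!expRD; congr (_ * expR _)%R.
  by rewrite expr1n; field.
have mg : measurable_fun setT (fun z : RT => (accept_exp (- (s ^+ 2 / 2) + s * z))%:E).
  apply/measurable_EFinP; apply: (measurableT_comp measurable_accept_exp).
  by apply: measurable_funD => //; exact: measurable_funM.
rewrite ge0_integral_normal //; last by move=> z; rewrite lee_fin accept_exp_ge0.
have mf : measurable_fun setT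
    (fun z : RT => (accept_exp (- (s ^+ 2 / 2) + s * z))%:E * (phi z)%:E).
  by apply: emeasurable_funM.
pose A : set RT := [set` `]-oo, (s / 2)%R]].
have mA : measurable A by exact: measurable_itv.
rewrite -(setUv A) ge0_integral_setU //; last 4 first.
- exact: measurableC.
- by rewrite setUv.
- by move=> z _; rewrite mule_ge0 // lee_fin ?accept_exp_ge0 ?normal_pdf_ge0.
- exact/disj_setPCl.
have Phi : gauss `]-oo, (- (s / 2))%R] = (std_normal_cdf (- (s / 2)))%:E.
  by rewrite /std_normal_cdf fineK // fin_num_measure.
have mind (a : R) : measurable_fun setT
    (fun z : RT => (\1_(`]-oo, a]%classic : set RT) z)%:E : \bar R).
  by apply/measurable_EFinP; exact: measurable_indic.
have I1 : \int[mu]_(z in A) ((accept_exp (- (s ^+ 2 / 2) + s * z))%:E * (phi z)%:E) =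
    (std_normal_cdf (- (s / 2)))%:E.
  transitivity (\int[mu]_z ((\1_(`]-oo, (s / 2)%R]%classic : set RT) z)%:E
      * (normal_pdf s 1 z)%:E)).
    rewrite [LHS]integral_mkcond; congr (integral _ _ _); apply/funext => z.
    rewrite patchE indicE; case: ifPn => [zA|_]; last by rewrite mul0e.
    rewrite mul1e -tilt EFinM; congr (_%:E * _); rewrite /accept_exp min_r //.
    move: zA; rewrite inE /A /= in_itv /= => zs; rewrite -[leRHS]expR0 ler_expR; nra.
  rewrite (ge0_integral_affine s (oner_neq0 _)).
  - rewrite normr1 mul1e -Phi /normal_prob [RHS]integral_mkcond.
    congr (integral _ _ _); apply/funext => z.
    rewrite patchE indicE mul1r !mem_setE !in_itv /=.
    have -> : (z + s <= s / 2)%R = (z <= - (s / 2))%R by apply/idP/idP => ?; lra.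
    have -> : normal_pdf s 1 (z + s)%R = phi z.
      by rewrite !normal_pdfE ?oner_neq0// /normal_fun addrK subr0.
    by case: ifPn; rewrite ?mul1e ?mul0e.
  - exact: (emeasurable_funM (mind _) (mphi _ _)).
  - by move=> z; rewrite mule_ge0 // lee_fin ?normal_pdf_ge0.
have I2 : \int[mu]_(z in ~` A) ((accept_exp (- (s ^+ 2 / 2) + s * z))%:E * (phi z)%:E) =
    (std_normal_cdf (- (s / 2)))%:E.
  have sN : (- 1 != 0 :> R)%R by rewrite oppr_eq0 oner_neq0.
  transitivity (\int[mu]_z ((\1_(~` (`]-oo, (s / 2)%R]%classic : set RT)) z)%:E * (phi z)%:E)).
    rewrite [LHS]integral_mkcond; congr (integral _ _ _); apply/funext => z.
    rewrite patchE indicE; case: ifPn => [zA|_]; last by rewrite mul0e.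
    rewrite mul1e; rewrite /accept_exp min_l ?mul1e //.
    move: zA; rewrite inE /A /= in_itv /= => /negP; rewrite -ltNge => zs.
    rewrite -[leLHS]expR0 ler_expR; nra.
  rewrite (ge0_integral_affine 0%R sN).
  - rewrite normrN normr1 mul1e -Phi /normal_prob.
    rewrite -integral_itv_bndo_bndc; last exact: mphi.
    rewrite [RHS]integral_mkcond.
    congr (integral _ _ _); apply/funext => z.
    rewrite patchE indicE addr0 mulN1r in_setC !mem_setE !in_itv /=.
    have -> : (- z <= s / 2)%R = ~~ (z < - (s / 2))%R.
      by rewrite -leNgt; apply/idP/idP => ?; lra.
    rewrite negbK !std_normal_pdfE sqrrN.
    by case: ifPn; rewrite ?mul1e ?mul0e.
  - apply: (emeasurable_funM _ (mphi 0%R setT)); apply/measurable_EFinP.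
    by apply: measurable_indic; apply: measurableC.
  - by move=> z; rewrite mule_ge0 // lee_fin ?normal_pdf_ge0.
by rewrite I1 I2 -EFinD; congr EFin; ring.
Qed.

End gauss_accept.

(** * Linear and quadratic functionals of a standard Gaussian vector *)

Section measurable_matrix_functions.
Context {R : realType} {d : measure_display} {S : measurableType d}.

Lemma measurable_mulmx m n p (f : S -> 'M[R]_(m, n)) (g : S -> 'M[R]_(n, p)) :
  measurable_fun setT f -> measurable_fun setT g ->
  measurable_fun setT (fun s => f s *m g s).
Proof.
move=> mf mg; apply: measurable_fun_mx => i j.
rewrite (_ : (fun s => _) = fun s => \sum_k f s i k * g s k j); last first.
  by apply/funext => s; rewrite mxE.
apply: measurable_sum => k; apply: measurable_funM.
  exact: (measurableT_comp (measurable_mx_entry i k)).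
exact: (measurableT_comp (measurable_mx_entry k j)).
Qed.

Lemma measurable_addmx m n (f g : S -> 'M[R]_(m, n)) :
  measurable_fun setT f -> measurable_fun setT g ->
  measurable_fun setT (fun s => f s + g s).
Proof.
move=> mf mg; apply: measurable_fun_mx => i j.
rewrite (_ : (fun s => _) = fun s => f s i j + g s i j); last first.
  by apply/funext => s; rewrite mxE.
apply: measurable_funD.
  exact: (measurableT_comp (measurable_mx_entry i j)).
exact: (measurableT_comp (measurable_mx_entry i j)).
Qed.

Lemma measurable_trmx m n (f : S -> 'M[R]_(m, n)) :
  measurable_fun setT f -> measurable_fun setT (fun s => (f s)^T).
Proof.
move=> mf; apply: measurable_fun_mx => i j.
rewrite (_ : (fun s => _) = fun s => f s j i); last first.
  by apply/funext => s; rewrite mxE.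
exact: (measurableT_comp (measurable_mx_entry j i)).
Qed.

Lemma measurable_dotv n (f g : S -> 'cV[R]_n) :
  measurable_fun setT f -> measurable_fun setT g ->
  measurable_fun setT (fun s => dotv (f s) (g s)).
Proof.
move=> mf mg; apply: (measurableT_comp (measurable_mx_entry 0 0)).
by apply: measurable_mulmx => //; exact: measurable_trmx.
Qed.

End measurable_matrix_functions.

Section std_normal_vector.
Context {R : realType}.
Local Notation RT := (measurableTypeR R).
Local Open Scope ereal_scope.

Lemma ge0_integral_std_normalS n (f : 'cV[R]_n.+1 -> \bar R) :
  measurable_fun setT f -> (forall z, 0 <= f z) ->
  \int[std_normal_prob n.+1]_z f z =
  \int[gauss]_t \int[std_normal_prob n]_z f (cons_cV (t, z)).
Proof.
move=> mf f0.
transitivity (\int[normal_prob 0 1 \x std_normal_prob n]_w f (cons_cV w)).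
  exact: (ge0_integral_distribution (@cons_cV R n) mf f0).
rewrite (fubini_tonelli1 (fun w => f (cons_cV w))) //.
exact: (measurableT_comp mf (@measurable_cons_cV R n)).
Qed.

Lemma dotv_cons n (p : 'cV[R]_(1 + n)) t z :
  dotv p (cons_cV (t, z)) = (p 0%R 0%R * t + dotv (dsubmx p) z)%R.
Proof.
rewrite /dotv /cons_cV -{1}(vsubmxK p) tr_col_mx mul_row_col !mxE /=.
congr (_ + _)%R; rewrite big_ord1 !mxE eqxx mulr1n; congr (p _ _ * _)%R.
by apply: val_inj.
Qed.

(** The law of a pair of linear functionals of a standard Gaussian vector only
    depends on their Gram matrix, here through its Cholesky factor.  By
    induction on the dimension: a planar rotation aligns the first functional
    with one axis, and the two remaining independent terms of the second
    functional merge into one. *)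
Lemma std_normal_dotv2 n (p a : 'cV[R]_n) : exists al be ga : R,
  [/\ (0 <= al)%R /\ (0 <= ga)%R,
      (al ^+ 2 = dotv p p)%R, (al * be = dotv p a)%R,
      (be ^+ 2 + ga ^+ 2 = dotv a a)%R &
  forall G : RT * RT -> \bar R, measurable_fun setT G -> (forall z, 0 <= G z) ->
  \int[std_normal_prob n]_z G (dotv p z, dotv a z) =
  \int[gauss]_x \int[gauss]_y G ((al * x)%R, (be * x + ga * y)%R)].
Proof.
elim: n p a => [|n IH] p a.
  exists 0%R, 0%R, 0%R.
  have d0 (u v : 'cV[R]_0) : dotv u v = 0%R by rewrite dotvE big_ord0.
  split; rewrite ?d0 ?expr0n ?mulr0 ?addr0 // => G mG G0.
  rewrite /= integral_dirac //; last first.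
    apply: (measurableT_comp mG); apply: measurable_fun_pair;
    by apply: measurable_dotv.
  rewrite diracT mul1e !d0.
  under [RHS]eq_integral => x _.
    under eq_integral => y _ do rewrite !mul0r addr0.
    rewrite integral_cst //= probability_setT mule1.
    over.
  by rewrite integral_cst //= probability_setT mule1.
rewrite -[n.+1]/(1 + n)%N in p a *.
pose p0 := p 0%R 0%R; pose a0 := a 0%R 0%R.
have [al' [be' [ga' [[al'0 ga'0] alE abE bgE HG]]]] := IH (dsubmx p) (dsubmx a).
have dE (u v : 'cV[R]_(1 + n)) :
    dotv u v = (u 0 0 * v 0 0 + dotv (dsubmx u) (dsubmx v))%R.
  have vE : v = cons_cV (v 0%R 0%R, dsubmx v).
    rewrite -{1}[v]vsubmxK /cons_cV; congr col_mx.
    by apply/colP => i; rewrite ord1 !mxE eqxx mulr1n; congr (v _ _); apply: val_inj.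
  by rewrite {1}vE dotv_cons.
pose al := Num.sqrt (p0 ^+ 2 + al' ^+ 2).
have al2 : (al ^+ 2 = p0 ^+ 2 + al' ^+ 2)%R by rewrite sqr_sqrtr ?addr_ge0 ?sqr_ge0.
have [c [s [cs alc als]]] : exists c s : R,
    [/\ (c ^+ 2 + s ^+ 2 = 1)%R, (al * c = p0)%R & (al * s = al')%R].
  have [al0|al0] := eqVneq al 0%R.
    exists 1%R, 0%R; split; first by rewrite expr1n expr0n addr0.
      have : (p0 ^+ 2 + al' ^+ 2 == 0)%R by rewrite -al2 al0 expr0n.
      by rewrite paddr_eq0 ?sqr_ge0 // !sqrf_eq0 al0 mul0r => /andP[/eqP ->].
    have : (p0 ^+ 2 + al' ^+ 2 == 0)%R by rewrite -al2 al0 expr0n.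
    by rewrite paddr_eq0 ?sqr_ge0 // !sqrf_eq0 al0 mul0r => /andP[_ /eqP ->].
  exists (p0 / al)%R, (al' / al)%R; split; try by rewrite mulrC divfK.
  by rewrite !expr_div_n -mulrDl -al2 divff // sqrf_eq0.
pose be := (a0 * c + be' * s)%R; pose ga0 := (be' * c - a0 * s)%R.
pose ga := Num.sqrt (ga0 ^+ 2 + ga' ^+ 2).
have ga2 : (ga ^+ 2 = ga0 ^+ 2 + ga' ^+ 2)%R by rewrite sqr_sqrtr ?addr_ge0 ?sqr_ge0.
exists al, be, ga; split.
- by rewrite /al /ga !sqrtr_ge0.
- by rewrite al2 dE alE expr2.
- by rewrite dE -abE -/p0 -/a0 -alc -als /be; ring.
- rewrite ga2 dE -bgE -/a0 /be /ga0.
  have -> : (a0 * a0 = a0 * a0 * (c ^+ 2 + s ^+ 2))%R by rewrite cs mulr1.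
  have -> : (be' ^+ 2 = be' ^+ 2 * (c ^+ 2 + s ^+ 2))%R by rewrite cs mulr1.
  by ring.
move=> G mG G0.
have mGdot : measurable_fun setT (fun z : 'cV[R]_n.+1 => G (dotv p z, dotv a z)).
  apply: (measurableT_comp mG); apply: measurable_fun_pair;
  by apply: measurable_dotv.
rewrite (ge0_integral_std_normalS mGdot (fun z => G0 _)).
pose H (w : RT * RT) := \int[gauss]_y
  G ((p0 * w.1 + al' * w.2)%R, (a0 * w.1 + (be' * w.2 + ga' * y))%R).
have H0 w : 0 <= H w by apply: integral_ge0 => y _; exact: G0.
have mH : measurable_fun setT H.
  pose G3 (w : (RT * RT) * RT) :=
    G ((p0 * w.1.1 + al' * w.1.2)%R, (a0 * w.1.1 + (be' * w.1.2 + ga' * w.2))%R).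
  have m11 : measurable_fun setT (fun w : (RT * RT) * RT => w.1.1).
    by apply: measurableT_comp.
  have m12 : measurable_fun setT (fun w : (RT * RT) * RT => w.1.2).
    by apply: measurableT_comp.
  have mG3 : measurable_fun setT G3.
    apply: (measurableT_comp mG); apply: measurable_fun_pair.
      by apply: measurable_funD; apply: measurable_funM.
    apply: measurable_funD; first by apply: measurable_funM.
    by apply: measurable_funD; apply: measurable_funM.
  exact: (measurable_fun_fubini_tonelli_F (m2 := gauss) G3 mG3 (fun w => G0 _)).
transitivity (\int[gauss]_t \int[gauss]_x H (t, x)).
  apply: eq_integral => t _; rewrite /H /=.
  pose Gt (w : RT * RT) := G ((p0 * t + w.1)%R, (a0 * t + w.2)%R).
  have mGt : measurable_fun setT Gt.
    apply: (measurableT_comp mG); apply: measurable_fun_pair;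
    by apply: measurable_funD.
  rewrite -(HG Gt mGt (fun w => G0 _)).
  by apply: eq_integral => z _; rewrite !dotv_cons.
have cs' : (c ^+ 2 + (- s) ^+ 2 = 1)%R by rewrite sqrrN.
rewrite -(gauss_rotation mH H0 cs').
apply: eq_integral => x _.
pose K (v : RT) := G ((al * x)%R, (be * x + v)%R).
have mK : measurable_fun setT K.
  apply: (measurableT_comp mG); apply: measurable_fun_pair => //.
  by apply: measurable_funD.
rewrite -[RHS](gauss_comb ga0 ga' mK (fun v => G0 _)).
apply: eq_integral => y _; apply: eq_integral => w _; rewrite /K /=.
congr (G (_, _)).
  by rewrite -alc -als; transitivity (al * x * (c ^+ 2 + s ^+ 2))%R;
    [ring|rewrite cs mulr1].
by rewrite /be /ga0; ring.
Qed.

Lemma std_normal_dotv_sqr n (p : 'cV[R]_n) :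
  \int[std_normal_prob n]_z (dotv p z ^+ 2)%:E = (dotv p p)%:E.
Proof.
have [al [be [ga [_ alE _ _ HG]]]] := std_normal_dotv2 p p.
have mG : measurable_fun setT (fun w : RT * RT => ((w.1 : R) ^+ 2)%:E).
  by apply/measurable_EFinP; apply: measurable_funX.
rewrite (HG _ mG) /=; last by move=> w; rewrite lee_fin sqr_ge0.
transitivity (\int[gauss]_x ((al ^+ 2)%:E * (x ^+ 2)%:E)).
  apply: eq_integral => x _; rewrite integral_cst //= probability_setT mule1.
  by rewrite exprMn EFinM.
rewrite ge0_integralZl //.
- by rewrite gauss_moment2 mule1 alE.
- by apply/measurable_EFinP; exact: measurable_funX.
- by move=> x _; rewrite lee_fin sqr_ge0.
- by rewrite lee_fin sqr_ge0.
Qed.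

End std_normal_vector.

Section quadratic_forms.
Context {R : realType}.
Local Notation RT := (measurableTypeR R).

(** The best constant in the variance bound below is 2; this cruder value does
    not require the value of the fourth moment. *)
Definition quad_var : R := gauss_m4 + 2.

Lemma quad_var_ge0 : 0 <= quad_var.
Proof. by rewrite addr_ge0 // gauss_m4_ge0. Qed.

Local Open Scope ereal_scope.

Lemma quad_cons n (P : 'M[R]_(1 + n)) (t : R) (z : 'cV[R]_n) : P^T = P ->
  dotv (cons_cV (t, z)) (P *m cons_cV (t, z)) =
  (P 0 0 * t ^+ 2 + 2 * t * dotv (dlsubmx P) z + dotv z (drsubmx P *m z))%R.
Proof.
move=> PT; rewrite -[LHS]/(@dotv R (1 + n) (col_mx t%:M z) (P *m col_mx t%:M z)).
rewrite /dotv -{1}[P]submxK tr_col_mx mul_block_col mul_row_col tr_scalar_mx !mulmxDr !mxE.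
rewrite !big_ord1 !mxE /= !big_ord1 !mxE !eqxx !mulr1n.
have -> : lshift n 0%R = 0%R :> 'I_(1 + n) by apply: val_inj.
have E1 : (\sum_j ursubmx P 0 j * z j 0)%R = (\sum_j (dlsubmx P)^T 0 j * z j 0)%R.
  by rewrite trmx_dlsub PT.
have E2 : (\sum_j z^T 0 j * (dlsubmx P *m t%:M) j 0 = t * \sum_j (dlsubmx P)^T 0 j * z j 0)%R.
  rewrite big_distrr /=; apply: eq_bigr => j _.
  by rewrite !mxE big_ord1 !mxE eqxx mulr1n /=; ring.
rewrite E1 E2; ring.
Qed.

Lemma mxtrace_cons n (P : 'M[R]_(1 + n)) :
  (\tr P = P 0 0 + \tr (drsubmx P))%R.
Proof.
rewrite -{1}[P]submxK mxtrace_block; congr (_ + _)%R.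
by rewrite /mxtrace big_ord1 !mxE; congr (P _ _); apply: val_inj.
Qed.

Lemma mxtrace_sqr_cons n (P : 'M[R]_(1 + n)) : P^T = P ->
  (\tr (P *m P) = P 0 0 ^+ 2 + 2 * dotv (dlsubmx P) (dlsubmx P)
     + \tr (drsubmx P *m drsubmx P))%R.
Proof.
move=> PT; rewrite -{1 2}[P]submxK mulmx_block mxtrace_block !mxtraceD.
have E : ursubmx P = (dlsubmx P)^T by rewrite trmx_dlsub PT.
rewrite (mxtrace_mulC (dlsubmx P)) E addrA; congr (_ + _)%R.
have -> : (\tr ((dlsubmx P)^T *m dlsubmx P) = dotv (dlsubmx P) (dlsubmx P))%R.
  by rewrite /mxtrace big_ord1 /dotv; congr (fun_of_matrix _ _ _); apply: val_inj.
have -> : (\tr (ulsubmx P *m ulsubmx P) = P 0 0 ^+ 2)%R.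
  rewrite /mxtrace big_ord1 mxE big_ord1 !mxE expr2.
  by have -> : lshift n 0%R = 0%R :> 'I_(1 + n) by apply: val_inj.
by ring.
Qed.

(** Concentration of a Gaussian quadratic form around its mean, with a constant
    that does not depend on the dimension.  Induction on the dimension: given
    the other coordinates, the form is a polynomial of degree 2 in the first
    one, whose odd moments vanish. *)
Lemma std_normal_quad n (P : 'M[R]_n) : P^T = P ->
  \int[std_normal_prob n]_z ((dotv z (P *m z) - \tr P) ^+ 2)%:E <=
  (quad_var * \tr (P *m P))%:E.
Proof.
elim: n P => [|n IH] P PT.
  have m0 : measurable_fun setT (fun z : 'cV[R]_0 => ((dotv z (P *m z) - \tr P) ^+ 2)%:E).
    apply/measurable_EFinP; apply: measurable_funX; apply: measurable_funB => //.
    by apply: measurable_dotv => //; apply: measurable_mulmx.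
  rewrite /= integral_dirac // diracT mul1e dot0v sub0r sqrrN.
  by rewrite /mxtrace !big_ord0 expr0n mulr0.
rewrite -[n.+1]/(1 + n)%N in P PT *.
have mP k (Q : 'M[R]_k) (c : R) :
    measurable_fun setT (fun z : 'cV[R]_k => ((dotv z (Q *m z) - c) ^+ 2)%:E).
  apply/measurable_EFinP; apply: measurable_funX; apply: measurable_funB => //.
  by apply: measurable_dotv => //; apply: measurable_mulmx.
have sq0 (x : R) : 0 <= (x ^+ 2)%:E by rewrite lee_fin sqr_ge0.
rewrite (ge0_integral_std_normalS (mP _ P (\tr P))) //.
pose f (w : RT * 'cV[R]_n) :=
  ((dotv (cons_cV w) (P *m cons_cV w) - \tr P) ^+ 2)%:E : \bar R.
have mf : measurable_fun setT f.
  exact: (measurableT_comp (mP _ P (\tr P)) (@measurable_cons_cV R n)).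
rewrite (fubini_tonelli f mf (fun w => sq0 _)) /f.
have P'T : (drsubmx P)^T = drsubmx P by rewrite trmx_drsub PT.
set p := P 0%R 0%R; set r := dlsubmx P; set P' := drsubmx P in P'T *.
have inner (z : 'cV[R]_n) :
    \int[gauss]_t ((dotv (cons_cV (t, z)) (P *m cons_cV (t, z)) - \tr P) ^+ 2)%:E =
    (gauss_m4 * p ^+ 2 - p ^+ 2 + 4 * dotv r z ^+ 2
       + (dotv z (P' *m z) - \tr P') ^+ 2)%:E.
  pose rho := dotv r z; pose S := (dotv z (P' *m z) - \tr P')%R.
  transitivity (\int[gauss]_t (p ^+ 2 * t ^+ 4 + 4 * p * rho * t ^+ 3
     + (- 2 * p ^+ 2 + 4 * rho ^+ 2 + 2 * p * S) * t ^+ 2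
     + (4 * rho * S - 4 * p * rho) * t + (S - p) ^+ 2)%:E).
    apply: eq_integral => t _; congr EFin; rewrite quad_cons // mxtrace_cons.
    by rewrite -/p -/r -/P' /rho /S; ring.
  rewrite gauss_quartic ?sqr_ge0 //.
    by congr EFin; rewrite -/rho -/S; ring.
  move=> t; rewrite (_ : _ + _ = (p * (t ^+ 2 - 1) + 2 * t * rho + S) ^+ 2)%R.
    exact: sqr_ge0.
  ring.
under eq_integral => z _ do rewrite inner.
have mr : measurable_fun setT (fun z : 'cV[R]_n => (dotv r z ^+ 2)%:E).
  by apply/measurable_EFinP; apply: measurable_funX; apply: measurable_dotv.
have m4r : measurable_fun setT (fun z : 'cV[R]_n => 4%:E * (dotv r z ^+ 2)%:E).
  exact: emeasurable_funM.
have mS : measurable_fun setT (fun z : 'cV[R]_n =>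
    4%:E * (dotv r z ^+ 2)%:E + ((dotv z (P' *m z) - \tr P') ^+ 2)%:E).
  by apply: emeasurable_funD => //; exact: mP.
apply: (@le_trans _ _ (\int[std_normal_prob n]_z ((gauss_m4 * p ^+ 2)%:E +
   (4%:E * (dotv r z ^+ 2)%:E + ((dotv z (P' *m z) - \tr P') ^+ 2)%:E)))).
  apply: ge0_le_integral => //.
  - move=> z _; rewrite -inner; apply: integral_ge0 => t _; exact: sq0.
  - apply/measurable_EFinP; apply: measurable_funD; last by apply/measurable_EFinP; exact: mP.
    apply: measurable_funD => //; apply: measurable_funM => //.
    exact/measurable_EFinP.
  - by apply: emeasurable_funD.
  - move=> z _; rewrite -EFinM -!EFinD lee_fin addrA lerD2r lerD2r.
    by rewrite gerBl sqr_ge0.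
rewrite ge0_integralD //; last 2 first.
- by move=> z _; rewrite lee_fin mulr_ge0 ?gauss_m4_ge0 ?sqr_ge0.
- by move=> z _; rewrite adde_ge0 // mule_ge0.
rewrite ge0_integralD //; last 2 first.
- by move=> z _; rewrite mule_ge0.
- exact: mP.
rewrite ge0_integralZl // std_normal_dotv_sqr integral_cst //= probability_setT mule1.
have := IH _ P'T; rewrite -/r mxtrace_sqr_cons // -/p -/r -/P'.
set I := integral _ _ _ => HI.
apply: (@le_trans _ _ ((gauss_m4 * p ^+ 2)%:E + ((4 * dotv r r)%:E +
   (quad_var * \tr (P' *m P'))%:E))).
  by rewrite leeD2l // EFinM leeD2l.
rewrite -!EFinD lee_fin /quad_var.
have h1 := gauss_m4_ge0 (R := R); have h2 := dotvv_ge0 r; have h3 := sqr_ge0 p.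
nra.
Qed.

End quadratic_forms.

(** * Closeness of nonnegative integrals *)

Section ewithin.
Context {R : realType}.
Local Open Scope ereal_scope.

(** The relation |I - J| <= c, in a form that makes sense for infinite values. *)
Definition ewithin (I J : \bar R) (c : R) := I <= J + c%:E /\ J <= I + c%:E.

Lemma ewithin_trans I J K c c' : ewithin I J c -> ewithin J K c' ->
  ewithin I K (c + c').
Proof.
move=> [IJ JI] [JK KJ]; split.
  by rewrite EFinD (addeC c%:E) addeA; apply: (le_trans IJ); rewrite leeD2r.
by rewrite EFinD addeA; apply: (le_trans KJ); rewrite leeD2r.
Qed.

Lemma ewithin_le I J c c' : (c <= c')%R -> ewithin I J c -> ewithin I J c'.
Proof.
move=> cc' [IJ JI]; split.
  by apply: (le_trans IJ); rewrite leeD2l // lee_fin.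
by apply: (le_trans JI); rewrite leeD2l // lee_fin.
Qed.

Lemma ewithin_fin (x y c : R) : (`|x - y| <= c)%R -> ewithin x%:E y%:E c.
Proof. by rewrite ler_distl => /andP[h1 h2]; split; rewrite -EFinD lee_fin; lra. Qed.

Lemma ewithin_fine I (y c : R) : 0 <= I -> ewithin I y%:E c ->
  exists2 x : R, I = x%:E & (`|x - y| <= c)%R.
Proof.
case: I => [x| |] //; last by move=> _ []; rewrite -EFinD leye_eq.
move=> _ [h1 h2]; exists x => //.
by move: h1 h2; rewrite -!EFinD !lee_fin => h1 h2; rewrite ler_distl; apply/andP; split; lra.
Qed.

Lemma ewithin_integral d (T : measurableType d) (mu : {measure set T -> \bar R})
    (f g : T -> \bar R) (e : T -> R) (c : R) :
  measurable_fun setT f -> measurable_fun setT g ->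
  measurable_fun setT e ->
  (forall x, 0 <= f x) -> (forall x, 0 <= g x) -> (forall x, 0 <= e x)%R ->
  (forall x, ewithin (f x) (g x) (e x)) ->
  \int[mu]_x (e x)%:E <= c%:E ->
  ewithin (\int[mu]_x f x) (\int[mu]_x g x) c.
Proof.
move=> mf mg /measurable_EFinP me f0 g0 e0 fg ec.
have e0' x : 0 <= (e x)%:E by rewrite lee_fin.
split.
  apply: (@le_trans _ _ (\int[mu]_x (g x + (e x)%:E))).
    apply: ge0_le_integral => //; first exact: emeasurable_funD.
    by move=> x _; case: (fg x).
  by rewrite ge0_integralD // leeD2l.
apply: (@le_trans _ _ (\int[mu]_x (f x + (e x)%:E))).
  apply: ge0_le_integral => //; first exact: emeasurable_funD.
  by move=> x _; case: (fg x).
by rewrite ge0_integralD // leeD2l.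
Qed.

Lemma measurable_fun_fst1 d1 d2 (T1 : measurableType d1) (T2 : measurableType d2)
  (f : T1 -> R) : measurable_fun setT f ->
  measurable_fun setT (fun w : T1 * T2 => f w.1).
Proof. by move=> mf; apply: (measurableT_comp mf). Qed.

Lemma measurable_fun_snd1 d1 d2 (T1 : measurableType d1) (T2 : measurableType d2)
  (f : T2 -> R) : measurable_fun setT f ->
  measurable_fun setT (fun w : T1 * T2 => f w.2).
Proof. by move=> mf; apply: (measurableT_comp mf). Qed.

Lemma prob_integral_cst d (T : measurableType d) (P : probability T R) (c : R) :
  \int[P]_x c%:E = c%:E.
Proof. by rewrite integral_cst //= probability_setT mule1. Qed.

Lemma integral_prod_fst d1 d2 (T1 : measurableType d1) (T2 : measurableType d2)
  (P1 : probability T1 R) (P2 : probability T2 R) (f : T1 -> R) :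
  measurable_fun setT f -> (forall x, 0 <= f x)%R ->
  \int[P1 \x P2]_w (f w.1)%:E = \int[P1]_x (f x)%:E.
Proof.
move=> mf f0; rewrite (fubini_tonelli1 (fun w : T1 * T2 => (f w.1)%:E)).
- by apply: eq_integral => x _; rewrite /fubini_F /= prob_integral_cst.
- by apply/measurable_EFinP; exact: measurable_fun_fst1.
- by move=> w; rewrite lee_fin.
Qed.

Lemma integral_prod_snd d1 d2 (T1 : measurableType d1) (T2 : measurableType d2)
  (P1 : probability T1 R) (P2 : probability T2 R) (f : T2 -> R) :
  measurable_fun setT f -> (forall x, 0 <= f x)%R ->
  \int[P1 \x P2]_w (f w.2)%:E = \int[P2]_x (f x)%:E.
Proof.
move=> mf f0; rewrite (fubini_tonelli1 (fun w : T1 * T2 => (f w.2)%:E)) /=.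
- by rewrite /fubini_F /= integral_cst //= probability_setT mule1.
- by apply/measurable_EFinP; exact: measurable_fun_snd1.
- by move=> w; rewrite lee_fin.
Qed.

Lemma integral_prodM d1 d2 (T1 : measurableType d1) (T2 : measurableType d2)
  (P1 : probability T1 R) (P2 : probability T2 R) (f : T1 -> R) (g : T2 -> R) :
  measurable_fun setT f -> (forall x, 0 <= f x)%R ->
  measurable_fun setT g -> (forall x, 0 <= g x)%R ->
  \int[P1 \x P2]_w (f w.1 * g w.2)%:E = \int[P1]_x (f x)%:E * \int[P2]_x (g x)%:E.
Proof.
move=> mf f0 mg g0.
have mf' := measurable_fun_fst1 (T2 := T2) mf.
have mg' := measurable_fun_snd1 (T1 := T1) mg.
rewrite (fubini_tonelli1 (fun w : T1 * T2 => (f w.1 * g w.2)%:E)).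
- rewrite -ge0_integralZr //; last 3 first.
  + exact/measurable_EFinP.
  + by move=> x _; rewrite lee_fin.
  + by apply: integral_ge0 => x _; rewrite lee_fin.
  apply: eq_integral => x _; rewrite /fubini_F /=.
  under eq_integral do rewrite EFinM.
  rewrite ge0_integralZl //; try by [rewrite lee_fin|move=> y _; rewrite lee_fin].
  exact/measurable_EFinP.
- by apply/measurable_EFinP; exact: measurable_funM.
- by move=> w; rewrite lee_fin mulr_ge0.
Qed.

End ewithin.

(** * Acceptance probability of a quadratic log ratio *)

Section mixture.
Context {R : realType}.
Local Notation RT := (measurableTypeR R).
Local Open Scope ereal_scope.

(** Functions of the noise coordinate along an eigenvector by which the
    acceptance probability is multiplied: 1 for the mean acceptance, x^2 for
    the squared jump.  The bound 1 + gauss_m4 is large enough for both. *)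
Definition weight (w : RT -> R) := [/\ measurable_fun setT w,
  forall x, (0 <= w x)%R, \int[gauss]_x (w x)%:E = 1,
  \int[gauss]_x (w x ^+ 2)%:E <= (1 + gauss_m4)%:E &
  \int[gauss]_x (w x * `|x : R|)%:E <= (1 + gauss_m4)%:E ].

Let measurable_abs : measurable_fun setT (fun x : RT => `|x : R|%R).
Proof. exact: (measurableT_comp (@normr_measurable R setT)). Qed.

Lemma weight1 : weight (fun=> 1%R).
Proof.
split => //.
- by rewrite prob_integral_cst.
- by rewrite expr1n prob_integral_cst lee_fin lerDl gauss_m4_ge0.
- under eq_integral do rewrite mul1r.
  by apply: (le_trans gauss_abs_le); rewrite lee_fin lerDl gauss_m4_ge0.
Qed.

Lemma weight_sqr : weight (fun x => (x : R) ^+ 2)%R.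
Proof.
have m4 : measurable_fun setT (fun x : RT => ((x : R) ^+ 4)%R).
  exact: measurable_funX.
have m2 : measurable_fun setT (fun x : RT => ((x : R) ^+ 2)%R).
  exact: measurable_funX.
split => //.
- by move=> x; rewrite sqr_ge0.
- exact: gauss_moment2.
- under eq_integral do rewrite -exprM.
  by rewrite gauss_moment4 lee_fin lerDr.
- apply: (@le_trans _ _ (\int[gauss]_x (((x : R) ^+ 2)%:E + (x ^+ 4)%:E))).
    apply: ge0_le_integral => //.
    + by move=> x _; rewrite lee_fin mulr_ge0 ?sqr_ge0.
    + by apply/measurable_EFinP; apply: measurable_funM.
    + by apply: emeasurable_funD; apply/measurable_EFinP.
    + move=> x _; rewrite -EFinD lee_fin.
      have -> : (x ^+ 4 = x ^+ 2 * `|x| ^+ 2)%R.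
        by rewrite real_normK ?num_real //; ring.
      have h := sqr_ge0 x; have h1 := sqr_ge0 (`|x| - 2^-1)%R.
      rewrite -[X in (_ <= X + _)%R]mulr1 -mulrDr ler_wpM2l //; nra.
  rewrite ge0_integralD //.
  + by rewrite gauss_moment2 gauss_moment4.
  + by move=> x _; rewrite lee_fin sqr_ge0.
  + exact/measurable_EFinP.
  + by move=> x _; rewrite lee_fin exprn_even_ge0.
  + exact/measurable_EFinP.
Qed.

(** With mu = - s^2 / 2, be = 0 and ga = s the weight would be independent of the
    log ratio, and the integral would be exactly the limit value; the Lipschitz
    bound on the acceptance function controls the deviation from this case. *)
Lemma mixture_accept (w : RT -> R) (mu be ga s : R) : weight w -> (0 <= s)%R ->
  ewithin (\int[gauss]_x \int[gauss]_y
            (w x * accept_exp (mu + (be * x + ga * y)))%:E)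
         (2 * std_normal_cdf (- (s / 2)))%:E
         (`|mu + s ^+ 2 / 2| + `|be| * (1 + gauss_m4) + `|ga - s|)%R.
Proof.
move=> [mw w0 w1 w2 wx] s0.
have mf (u v : RT * RT -> R) : measurable_fun setT u -> measurable_fun setT v ->
    measurable_fun setT (fun z => (u z * accept_exp (v z))%R).
  move=> mu' mv; apply: measurable_funM => //.
  exact: (measurableT_comp measurable_accept_exp).
have mw1 := measurable_fun_fst1 (T2 := RT) mw.
pose f (z : RT * RT) := (w z.1 * accept_exp (mu + (be * z.1 + ga * z.2)))%R.
have mf1 : measurable_fun setT f.
  apply: mf => //; apply: measurable_funD => //.
  by apply: measurable_funD; apply: measurable_funM.
pose g (z : RT * RT) := (w z.1 * accept_exp (- (s ^+ 2 / 2) + s * z.2))%R.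
have mg1 : measurable_fun setT (fun y : RT => accept_exp (- (s ^+ 2 / 2) + s * y)).
  apply: (measurableT_comp measurable_accept_exp).
  by apply: measurable_funD => //; apply: measurable_funM.
have mg : measurable_fun setT g.
  by apply: measurable_funM => //; exact: (measurable_fun_snd1 mg1).
have f0 z : (0 <= f z)%R by rewrite mulr_ge0 // accept_exp_ge0.
have g0 z : (0 <= g z)%R by rewrite mulr_ge0 // accept_exp_ge0.
pose c1 := `|mu + s ^+ 2 / 2|%R; pose c2 := `|be|%R; pose c3 := `|ga - s|%R.
pose e (z : RT * RT) :=
  (c1 * w z.1 + (c2 * (w z.1 * `|z.1|) + c3 * (w z.1 * `|z.2|)))%R.
have -> : \int[gauss]_x \int[gauss]_y
    (w x * accept_exp (mu + (be * x + ga * y)))%:E = \int[gauss \x gauss]_z (f z)%:E.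
  rewrite (fubini_tonelli1 (EFin \o f)) //.
  exact/measurable_EFinP.
have <- : \int[gauss \x gauss]_z (g z)%:E = (2 * std_normal_cdf (- (s / 2)))%:E.
  rewrite (integral_prodM gauss gauss mw w0 mg1 (fun y => accept_exp_ge0 _)).
  by rewrite w1 mul1e; exact: gauss_accept.
have mwx : measurable_fun setT (fun x : RT => (w x * `|x : R|)%R).
  exact: measurable_funM.
have mwx1 := measurable_fun_fst1 (T2 := RT) mwx.
have mwy : measurable_fun setT (fun z : RT * RT => (w z.1 * `|z.2 : R|)%R).
  by apply: measurable_funM => //; exact: (measurable_fun_snd1 measurable_abs).
have wx0 x : (0 <= w x * `|x : R|)%R by rewrite mulr_ge0.
have wy0 (z : RT * RT) : (0 <= w z.1 * `|z.2 : R|)%R by rewrite mulr_ge0.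
have c10 : (0 <= c1)%R by rewrite /c1.
have c20 : (0 <= c2)%R by rewrite /c2.
have c30 : (0 <= c3)%R by rewrite /c3.
apply: (ewithin_integral (e := e)).
- exact/measurable_EFinP.
- exact/measurable_EFinP.
- apply: measurable_funD; first exact: measurable_funM.
  by apply: measurable_funD; exact: measurable_funM.
- by move=> z; rewrite lee_fin.
- by move=> z; rewrite lee_fin.
- by move=> z; rewrite !addr_ge0 // mulr_ge0.
- move=> [x y]; apply: ewithin_fin; rewrite /f /g /e /=.
  rewrite -mulrBr normrM ger0_norm //.
  have -> : (c1 * w x + (c2 * (w x * `|x|) + c3 * (w x * `|y|)) =
    w x * (c1 + c2 * `|x| + c3 * `|y|))%R by ring.
  apply: ler_wpM2l => //.
  set X := (mu + _)%R; set Y := (- _ + _)%R.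
  have XY : (`|X - Y| <= c1 + c2 * `|x| + c3 * `|y|)%R.
    have -> : (X - Y = (mu + s ^+ 2 / 2) + be * x + (ga - s) * y)%R.
      by rewrite /X /Y; ring.
    rewrite -!normrM.
    by apply: (le_trans (ler_normD _ _)); rewrite lerD2r ler_normD.
  apply: le_trans XY; rewrite ler_distl.
  have h1 := accept_exp_lip X Y; have h2 := accept_exp_lip Y X.
  by rewrite distrC in h2; apply/andP; split; lra.
- have i1 : \int[gauss \x gauss]_z (w z.1)%:E = 1 by rewrite (integral_prod_fst gauss gauss mw).
  have i2 : \int[gauss \x gauss]_z (w z.1 * `|z.1 : R|)%:E <= (1 + gauss_m4)%:E.
    by rewrite (integral_prod_fst gauss gauss mwx).
  have i3 : \int[gauss \x gauss]_z (w z.1 * `|z.2 : R|)%:E <= 1.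
    rewrite (integral_prodM gauss gauss mw w0 measurable_abs) // w1 mul1e.
    exact: gauss_abs_le.
  have ew1 : measurable_fun setT (fun z : RT * RT => (w z.1)%:E).
    exact/measurable_EFinP.
  have ewx : measurable_fun setT (fun z : RT * RT => (w z.1 * `|z.1 : R|)%:E).
    exact/measurable_EFinP.
  have ewy : measurable_fun setT (fun z : RT * RT => (w z.1 * `|z.2 : R|)%:E).
    exact/measurable_EFinP.
  under eq_integral do rewrite /e EFinD EFinM EFinD (EFinM c2) (EFinM c3).
  rewrite ge0_integralD //; last 4 first.
  + by move=> z _; apply: mule_ge0; rewrite lee_fin.
  + exact: emeasurable_funM.
  + by move=> z _; apply: adde_ge0; apply: mule_ge0; rewrite lee_fin.
  + by apply: emeasurable_funD; exact: emeasurable_funM.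
  rewrite ge0_integralD //; last 4 first.
  + by move=> z _; apply: mule_ge0; rewrite lee_fin.
  + exact: emeasurable_funM.
  + by move=> z _; apply: mule_ge0; rewrite lee_fin.
  + exact: emeasurable_funM.
  rewrite !ge0_integralZl //; try by [move=> z _; rewrite lee_fin|rewrite lee_fin].
  rewrite i1 mule1 -/c1 -/c2 -/c3 -addrA EFinD leeD2l // EFinD leeD //.
    by rewrite EFinM lee_wpmul2l // lee_fin.
  by rewrite -[leRHS]mule1 lee_wpmul2l // lee_fin.
Qed.

End mixture.

Section real_inequalities.
Context {R : realType}.

(** The parameter dl trades the two sides; it makes an error that is small in
    mean square also small in mean after multiplication by a weight. *)
Lemma young (a b dl : R) : 0 < dl -> a * b <= dl * a ^+ 2 + b ^+ 2 / dl.
Proof.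
move=> dl0; rewrite -subr_ge0.
have -> : dl * a ^+ 2 + b ^+ 2 / dl - a * b =
    ((dl * a - b / 2) ^+ 2 + 3 / 4 * b ^+ 2) / dl.
  by field; rewrite gt_eqF.
rewrite divr_ge0 ?(ltW dl0) // addr_ge0 ?sqr_ge0 // mulr_ge0 ?sqr_ge0 //.
Qed.

Lemma young1 (b dl : R) : 0 < dl -> `|b| <= dl + b ^+ 2 / dl.
Proof.
by move=> dl0; have := young 1 `|b| dl0; rewrite mul1r expr1n mulr1 real_normK ?num_real.
Qed.

(** Closeness of variances implies closeness of standard deviations, uniformly
    down to s = 0 where the square root is not Lipschitz: if u = |t - s| exceeds
    dl then u dl^3 <= u^4 <= (t^2 - s^2)^2. *)
Lemma sqrt_dist (t s dl : R) : 0 <= t -> 0 <= s -> 0 < dl ->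
  `|t - s| <= dl + (t ^+ 2 - s ^+ 2) ^+ 2 / dl ^+ 3.
Proof.
move=> t0 s0 dl0; set u := `|t - s|.
have u0 : 0 <= u by exact: normr_ge0.
have d3 : 0 < dl ^+ 3 by rewrite exprn_gt0.
have [ud|du] := leP u dl.
  by rewrite (le_trans ud) // lerDl divr_ge0 ?sqr_ge0 // ltW.
apply: (@le_trans _ _ ((t ^+ 2 - s ^+ 2) ^+ 2 / dl ^+ 3)); last by rewrite lerDr ltW.
rewrite ler_pdivlMr //.
have -> : (t ^+ 2 - s ^+ 2) ^+ 2 = u ^+ 2 * (t + s) ^+ 2.
  by rewrite /u real_normK ?num_real //; ring.
have uts : u <= t + s by rewrite /u ler_norml; apply/andP; split; lra.
apply: (@le_trans _ _ (u ^+ 2 * u ^+ 2)).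
  rewrite -exprD [leRHS]exprS ler_wpM2l // lerXn2r ?nnegrE // ltW //.
by rewrite ler_wpM2l ?sqr_ge0 // lerXn2r ?nnegrE ?addr_ge0.
Qed.

(** Here be and ga are the coordinates of a Gaussian variable of variance N along
    a unit noise coordinate and orthogonally to it. *)
Lemma cholesky_dist (be ga N s dl : R) : 0 <= ga -> 0 <= s -> 0 < dl ->
  be ^+ 2 + ga ^+ 2 = N ->
  `|ga - s| <= `|be| + (dl + (N - s ^+ 2) ^+ 2 / dl ^+ 3).
Proof.
move=> ga0 s0 dl0 NE; pose t := Num.sqrt N.
have N0 : 0 <= N by rewrite -NE addr_ge0 ?sqr_ge0.
have t2 : t ^+ 2 = N by rewrite sqr_sqrtr.
have t0 : 0 <= t by rewrite sqrtr_ge0.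
have := sqrt_dist t0 s0 dl0; rewrite t2 => tsd.
have gat : `|ga - t| <= `|be|.
  have b0 := normr_ge0 be; have b2 : `|be| ^+ 2 = be ^+ 2 by rewrite real_normK ?num_real.
  rewrite distrC ger0_norm.
    rewrite lerBlDr -(ler_pXn2r (n := 2)) ?nnegrE ?addr_ge0 // t2 -NE -b2; nra.
  rewrite subr_ge0 -(ler_pXn2r (n := 2)) ?nnegrE // t2 -NE lerDr sqr_ge0 //.
have -> : ga - s = (ga - t) + (t - s) by ring.
by apply: (le_trans (ler_normD _ _)); exact: lerD.
Qed.

End real_inequalities.

Section quadratic_accept.
Context {R : realType}.
Local Notation RT := (measurableTypeR R).
Local Notation wm := (1 + gauss_m4 : R).
Local Open Scope ereal_scope.

Variables (n : nat) (P K T : 'M[R]_n) (q : 'cV[R]_n) (w : RT -> R) (s dl : R).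
Hypotheses (PT : P^T = P) (KT : K^T = K) (qq : dotv q q = 1%R).
Hypotheses (ww : weight w) (s0 : (0 <= s)%R) (dl0 : (0 < dl)%R).

Local Notation mu := (\tr P + \tr K)%R.
Local Notation G := (T^T *m T).
Local Notation std := (std_normal_prob n).

Let m_fst : measurable_fun setT (fun v : 'cV[R]_n * 'cV[R]_n => v.1).
Proof. exact: measurable_fst. Qed.
Let m_snd : measurable_fun setT (fun v : 'cV[R]_n * 'cV[R]_n => v.2).
Proof. exact: measurable_snd. Qed.

Let mw : measurable_fun setT w. Proof. by case: ww. Qed.
Let w0 x : (0 <= w x)%R. Proof. by case: ww. Qed.

Let mwq : measurable_fun setT (fun z : 'cV[R]_n => w (dotv q z)).
Proof. by apply: (measurableT_comp mw); exact: measurable_dotv. Qed.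

Let mquad (Q : 'M[R]_n) (c : R) :
  measurable_fun setT (fun z : 'cV[R]_n => (dotv z (Q *m z) - c)%R).
Proof. by apply: measurable_funB => //; apply: measurable_dotv => //; apply: measurable_mulmx. Qed.

Let mcross : measurable_fun setT (fun v : 'cV[R]_n * 'cV[R]_n => dotv (T *m v.1) v.2).
Proof. by apply: measurable_dotv => //; apply: measurable_mulmx. Qed.

Let B (v : 'cV[R]_n * 'cV[R]_n) : R :=
  (w (dotv q v.2) * accept_exp (mu + dotv (T *m v.1) v.2))%R.

Let mB : measurable_fun setT B.
Proof.
apply: measurable_funM; first exact: (measurable_fun_snd1 mwq).
apply: (measurableT_comp measurable_accept_exp).
by apply: measurable_funD => //; exact: mcross.
Qed.

Let B0 v : (0 <= B v)%R.
Proof. by rewrite mulr_ge0 // accept_exp_ge0. Qed.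

(** The coordinate along the unit vector q is itself standard normal, so the
    weight applies to the first variable of the pair. *)
Let dotv2_unit (a : 'cV[R]_n) : exists be ga : R, [/\ (0 <= ga)%R,
  be = dotv q a, (be ^+ 2 + ga ^+ 2 = dotv a a)%R &
  forall H : RT * RT -> \bar R, measurable_fun setT H -> (forall z, 0 <= H z) ->
  \int[std]_z H (dotv q z, dotv a z) =
  \int[gauss]_x \int[gauss]_y H (x, (be * x + ga * y)%R)].
Proof.
have [al [be [ga [[al0 ga0] al2 ab bg HH]]]] := std_normal_dotv2 q a.
have al1 : al = 1%R.
  by apply/eqP; rewrite -(eqrXn2 (n := 2)) // al2 qq expr1n.
exists be, ga; split=> //; first by rewrite -ab al1 mul1r.
move=> H mH H0; rewrite HH //.
by apply: eq_integral => x _; apply: eq_integral => y _; rewrite al1 mul1r.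
Qed.

Let weight_dotv_sqr : \int[std]_z (w (dotv q z) ^+ 2)%:E <= wm%:E.
Proof.
have [be [ga [_ _ _ HH]]] := dotv2_unit 0%R.
have mw2 : measurable_fun setT (fun x : RT => w x ^+ 2)%R by exact: measurable_funX.
pose H (u : RT * RT) := (w u.1 ^+ 2)%:E : \bar R.
have mH : measurable_fun setT H.
  by apply/measurable_EFinP; exact: (measurable_fun_fst1 mw2).
rewrite (HH H mH) /H /=; last by move=> u; rewrite lee_fin sqr_ge0.
under eq_integral do rewrite prob_integral_cst.
by case: ww.
Qed.

Let conditional (z : 'cV[R]_n) : ewithin (\int[std]_xi (B (z, xi))%:E)
  (2 * std_normal_cdf (- (s / 2)))%:E
  (`|mu + s ^+ 2 / 2| + (wm + 1) * dl + dl + (wm + 1) / dl * (dotv (T^T *m q) z) ^+ 2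
     + (dotv z (G *m z) - s ^+ 2) ^+ 2 / dl ^+ 3)%R.
Proof.
have [be [ga [ga0 beE bgE HH]]] := dotv2_unit (T *m z).
pose H (u : RT * RT) := (w u.1 * accept_exp (mu + u.2))%:E : \bar R.
have mH : measurable_fun setT H.
  apply/measurable_EFinP; apply: measurable_funM; first exact: (measurable_fun_fst1 mw).
  by apply: (measurableT_comp measurable_accept_exp); apply: measurable_funD.
have H0 u : 0 <= H u by rewrite lee_fin mulr_ge0 // accept_exp_ge0.
rewrite [X in ewithin X _ _](HH H mH H0) /H /=.
apply: ewithin_le (mixture_accept mu be ga ww s0).
have be1 := young1 be dl0.
have N : dotv (T *m z) (T *m z) = dotv z (G *m z).
  by rewrite -mulmxA [RHS]dotv_mulmx trmxK.
have cd := cholesky_dist ga0 s0 dl0 bgE; rewrite N in cd.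
have beE' : be = dotv (T^T *m q) z by rewrite beE dotv_mulmx.
rewrite -beE'.
have wm0 : (0 <= wm)%R by rewrite addr_ge0 // gauss_m4_ge0.
have h : (`|be| * wm <= (dl + be ^+ 2 / dl) * wm)%R by rewrite ler_wpM2r.
have -> : ((wm + 1) / dl * be ^+ 2 = wm * (be ^+ 2 / dl) + be ^+ 2 / dl)%R by ring.
lra.
Qed.

Let conditional_integral : ewithin (\int[std \x std]_v (B v)%:E)
  (2 * std_normal_cdf (- (s / 2)))%:E
  (`|mu + s ^+ 2 / 2| + (wm + 1) * dl + dl
    + (wm + 1) / dl * dotv (T^T *m q) (T^T *m q)
    + (2 * quad_var * \tr (G *m G) + 2 * (\tr G - s ^+ 2) ^+ 2) / dl ^+ 3)%R.
Proof.
have GT : G^T = G by rewrite trmx_mul trmxK.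
have d3 : (0 < dl ^+ 3)%R by rewrite exprn_gt0.
have wm0 : (0 <= wm)%R by rewrite addr_ge0 // gauss_m4_ge0.
have k0 : (0 <= (wm + 1) / dl)%R by apply: divr_ge0; [exact: addr_ge0|exact: ltW].
have k1 : (0 <= 2 / dl ^+ 3)%R by rewrite divr_ge0 // ltW.
rewrite (fubini_tonelli1 (EFin \o B)); last 2 first.
- exact/measurable_EFinP.
- by move=> v; rewrite /= lee_fin.
pose c0 := (`|mu + s ^+ 2 / 2| + (wm + 1) * dl + dl
  + 2 / dl ^+ 3 * (\tr G - s ^+ 2) ^+ 2)%R.
have c00 : (0 <= c0)%R.
  have dlW := ltW dl0; have wm1 : (0 <= wm + 1)%R by exact: addr_ge0.
  apply: addr_ge0; last by rewrite mulr_ge0 ?sqr_ge0.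
  by apply: addr_ge0 => //; apply: addr_ge0 => //; exact: mulr_ge0.
pose e (z : 'cV[R]_n) := (c0 + ((wm + 1) / dl * (dotv (T^T *m q) z) ^+ 2
  + 2 / dl ^+ 3 * (dotv z (G *m z) - \tr G) ^+ 2))%R.
rewrite -(prob_integral_cst std (2 * std_normal_cdf (- (s / 2)))).
have Phi0 : (0 <= std_normal_cdf (- (s / 2)))%R by rewrite fine_ge0 ?measure_ge0.
have mq2 : measurable_fun setT (fun z : 'cV[R]_n => (dotv (T^T *m q) z ^+ 2)%R).
  by apply: measurable_funX; exact: measurable_dotv.
have mG2 : measurable_fun setT (fun z : 'cV[R]_n => ((dotv z (G *m z) - \tr G) ^+ 2)%R).
  by apply: measurable_funX.
apply: (ewithin_integral (e := e)).
- apply: (measurable_fun_fubini_tonelli_F (m2 := std) (EFin \o B)).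
    exact/measurable_EFinP.
  by move=> v; rewrite /= lee_fin.
- by [].
- by apply: measurable_funD => //; apply: measurable_funD; apply: measurable_funM.
- by move=> z; apply: integral_ge0 => xi _; rewrite lee_fin.
- by move=> z; rewrite lee_fin mulr_ge0.
- by move=> z; apply: addr_ge0 => //; apply: addr_ge0; rewrite mulr_ge0 ?sqr_ge0.
- move=> z; apply: ewithin_le (conditional z); rewrite /e /c0.
  have -> : (dotv z (G *m z) - s ^+ 2 = (dotv z (G *m z) - \tr G) + (\tr G - s ^+ 2))%R.
    by ring.
  set x := (dotv z (G *m z) - \tr G)%R; set y := (\tr G - s ^+ 2)%R.
  have xy : ((x + y) ^+ 2 / dl ^+ 3 <= 2 / dl ^+ 3 * x ^+ 2 + 2 / dl ^+ 3 * y ^+ 2)%R.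
    have -> : (2 / dl ^+ 3 * x ^+ 2 + 2 / dl ^+ 3 * y ^+ 2 =
       (2 * x ^+ 2 + 2 * y ^+ 2) / dl ^+ 3)%R by ring.
    rewrite ler_pM2r ?invr_gt0 //; have := sqr_ge0 (x - y)%R; nra.
  lra.
- have eq2 : measurable_fun setT (fun z : 'cV[R]_n => (dotv (T^T *m q) z ^+ 2)%:E).
    exact/measurable_EFinP.
  have eG2 : measurable_fun setT (fun z : 'cV[R]_n => ((dotv z (G *m z) - \tr G) ^+ 2)%:E).
    exact/measurable_EFinP.
  under eq_integral do rewrite /e (EFinD c0) (EFinD (_ * _)) (EFinM ((wm + 1) / dl)) (EFinM (2 / dl ^+ 3)).
  rewrite ge0_integralD //; last 2 first.
  + by move=> z _; apply: adde_ge0; apply: mule_ge0; rewrite lee_fin ?sqr_ge0.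
  + by apply: emeasurable_funD; exact: emeasurable_funM.
  rewrite ge0_integralD //; last 4 first.
  + by move=> z _; apply: mule_ge0; rewrite lee_fin ?sqr_ge0.
  + exact: emeasurable_funM.
  + by move=> z _; apply: mule_ge0; rewrite lee_fin ?sqr_ge0.
  + exact: emeasurable_funM.
  rewrite !ge0_integralZl //; try by move=> z _; rewrite lee_fin sqr_ge0.
  rewrite prob_integral_cst std_normal_dotv_sqr.
  apply: (@le_trans _ _ (c0%:E + (((wm + 1) / dl)%:E * (dotv (T^T *m q) (T^T *m q))%:E +
    (2 / dl ^+ 3)%:E * (quad_var * \tr (G *m G))%:E))).
    by rewrite leeD2l // leeD2l // lee_wpmul2l // std_normal_quad.
  rewrite -!EFinM -!EFinD lee_fin /c0 le_eqVlt; apply/orP; left; apply/eqP.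
  by field; rewrite gt_eqF.
Qed.

(** No central limit theorem is involved.  The terms in P and K concentrate at
    their means, and conditionally on the first vector z the cross term is
    exactly a centred Gaussian variable, of variance z^T G z; this variance is
    itself a quadratic form that concentrates at its mean tr G.  The coordinate
    along q is nearly independent of the cross term when T^T q is small. *)
Lemma quadratic_accept : ewithin
  (\int[std \x std]_v (w (dotv q v.2) * accept_exp
     (dotv v.1 (P *m v.1) + dotv (T *m v.1) v.2 + dotv v.2 (K *m v.2)))%:E)
  (2 * std_normal_cdf (- (s / 2)))%:E
  (dl * wm + 2 / dl * quad_var * (\tr (P *m P) + \tr (K *m K))
    + (`|mu + s ^+ 2 / 2| + (wm + 1) * dl + dl
    + (wm + 1) / dl * dotv (T^T *m q) (T^T *m q)
    + (2 * quad_var * \tr (G *m G) + 2 * (\tr G - s ^+ 2) ^+ 2) / dl ^+ 3))%R.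
Proof.
apply: ewithin_trans conditional_integral.
have k0 : (0 <= 2 / dl)%R by rewrite divr_ge0 // ltW.
pose X (v : 'cV[R]_n * 'cV[R]_n) :=
  (dotv v.1 (P *m v.1) + dotv (T *m v.1) v.2 + dotv v.2 (K *m v.2))%R.
have mX : measurable_fun setT X.
  apply: measurable_funD; first apply: measurable_funD => //.
    by apply: measurable_dotv => //; apply: measurable_mulmx.
  by apply: measurable_dotv => //; apply: measurable_mulmx.
have mP2 : measurable_fun setT (fun z : 'cV[R]_n => ((dotv z (P *m z) - \tr P) ^+ 2)%R).
  by apply: measurable_funX.
have mK2 : measurable_fun setT (fun z : 'cV[R]_n => ((dotv z (K *m z) - \tr K) ^+ 2)%R).
  by apply: measurable_funX.
have mw2 : measurable_fun setT (fun z : 'cV[R]_n => (w (dotv q z) ^+ 2)%R).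
  by apply: measurable_funX.
pose e (v : 'cV[R]_n * 'cV[R]_n) := (dl * w (dotv q v.2) ^+ 2 + (2 / dl *
   (dotv v.1 (P *m v.1) - \tr P) ^+ 2 + 2 / dl * (dotv v.2 (K *m v.2) - \tr K) ^+ 2))%R.
have m1 := measurable_fun_fst1 (T2 := 'cV[R]_n) mP2.
have m2 := measurable_fun_snd1 (T1 := 'cV[R]_n) mK2.
have m3 := measurable_fun_snd1 (T1 := 'cV[R]_n) mw2.
apply: (ewithin_integral (e := e)).
- apply/measurable_EFinP; apply: measurable_funM; first exact: (measurable_fun_snd1 mwq).
  exact: (measurableT_comp measurable_accept_exp mX).
- exact/measurable_EFinP.
- by apply: measurable_funD; [|apply: measurable_funD]; apply: measurable_funM.
- by move=> v; rewrite lee_fin mulr_ge0 // accept_exp_ge0.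
- by move=> v; rewrite lee_fin.
- have dlW := ltW dl0; move=> v.
  by apply: addr_ge0; [|apply: addr_ge0]; rewrite mulr_ge0 ?sqr_ge0.
- move=> v; apply: ewithin_fin; rewrite /B -mulrBr normrM ger0_norm // -/(X v).
  set D1 := (dotv v.1 (P *m v.1) - \tr P)%R; set D2 := (dotv v.2 (K *m v.2) - \tr K)%R.
  have XD : (X v - (mu + dotv (T *m v.1) v.2) = D1 + D2)%R.
    by rewrite /X /D1 /D2; ring.
  have lipD : (`|accept_exp (X v) - accept_exp (mu + dotv (T *m v.1) v.2)| <= `|D1 + D2|)%R.
    rewrite -XD ler_distl.
    have h1 := accept_exp_lip (X v) (mu + dotv (T *m v.1) v.2)%R.
    have h2 := accept_exp_lip (mu + dotv (T *m v.1) v.2)%R (X v).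
    by rewrite distrC in h2; apply/andP; split; lra.
  apply: (@le_trans _ _ (w (dotv q v.2) * `|D1 + D2|)%R).
    by rewrite ler_wpM2l.
  apply: (le_trans (young _ _ dl0)); rewrite /e -/D1 -/D2 lerD2l.
  rewrite real_normK ?num_real //.
  have -> : (2 / dl * D1 ^+ 2 + 2 / dl * D2 ^+ 2 = (2 * D1 ^+ 2 + 2 * D2 ^+ 2) / dl)%R.
    by ring.
  rewrite ler_pM2r ?invr_gt0 //; have := sqr_ge0 (D1 - D2)%R; nra.
- have dlW := ltW dl0.
  have em1 : measurable_fun setT (fun v : 'cV[R]_n * 'cV[R]_n =>
      ((dotv v.1 (P *m v.1) - \tr P) ^+ 2)%:E) by exact/measurable_EFinP.
  have em2 : measurable_fun setT (fun v : 'cV[R]_n * 'cV[R]_n =>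
      ((dotv v.2 (K *m v.2) - \tr K) ^+ 2)%:E) by exact/measurable_EFinP.
  have em3 : measurable_fun setT (fun v : 'cV[R]_n * 'cV[R]_n =>
      (w (dotv q v.2) ^+ 2)%:E) by exact/measurable_EFinP.
  under eq_integral do rewrite /e EFinD EFinM EFinD (EFinM (2 / dl)) (EFinM (2 / dl)).
  rewrite ge0_integralD //; last 4 first.
  + by move=> v _; apply: mule_ge0; rewrite lee_fin ?sqr_ge0.
  + exact: emeasurable_funM.
  + by move=> v _; apply: adde_ge0; apply: mule_ge0; rewrite lee_fin ?sqr_ge0.
  + by apply: emeasurable_funD; exact: emeasurable_funM.
  rewrite ge0_integralD //; last 4 first.
  + by move=> v _; apply: mule_ge0; rewrite lee_fin ?sqr_ge0.
  + exact: emeasurable_funM.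
  + by move=> v _; apply: mule_ge0; rewrite lee_fin ?sqr_ge0.
  + exact: emeasurable_funM.
  rewrite !ge0_integralZl //; try by move=> v _; rewrite lee_fin sqr_ge0.
  rewrite (integral_prod_snd std std mw2) //; last by move=> z; rewrite sqr_ge0.
  rewrite (integral_prod_fst std std mP2) //; last by move=> z; rewrite sqr_ge0.
  rewrite (integral_prod_snd std std mK2) //; last by move=> z; rewrite sqr_ge0.
  apply: (@le_trans _ _ (dl%:E * wm%:E + ((2 / dl)%:E * (quad_var * \tr (P *m P))%:E +
     (2 / dl)%:E * (quad_var * \tr (K *m K))%:E))).
    rewrite leeD //; first by rewrite lee_wpmul2l // lee_fin.
    by rewrite leeD // lee_wpmul2l ?lee_fin // std_normal_quad.
  rewrite -!EFinM -!EFinD lee_fin le_eqVlt; apply/orP; left; apply/eqP; ring.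
Qed.

End quadratic_accept.

(** * The proposal and the acceptance ratio in whitened coordinates *)

Section langevin_algebra.
Context {R : realType} {n : nat}.
Variables (A V : 'M[R]_n) (b : 'cV[R]_n) (theta h : R).
Hypotheses (Apd : posdefmx A) (Vpd : posdefmx V) (h0 : 0 < h).
Hypotheses (theta01 : 0 <= theta <= 1).
Variables (U : 'M[R]_n) (D : 'rV[R]_n).
Hypotheses (UU : U *m U^T = 1%:M) (D0 : forall i, 0 < D 0 i).
Local Notation S := (sqrtmx V).
Local Notation fc := (fcalc U D).
Hypothesis MD : S *m A *m S = fc id.

(** Numerator f and denominator e of the drift: in the whitened coordinate along
    an eigenvector of eigenvalue x, the proposal is v = (f u + sqrt h xi) / e. *)
Definition drift_e (x : R) : R := 1 + theta * h / 2 * x.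
Definition drift_f (x : R) : R := 1 - (1 - theta) * h / 2 * x.
Local Notation e := drift_e.
Local Notation f := drift_f.
Local Notation m := (invmx A *m b).

Let SS : S *m S = V. Proof. by case: (sqrtmxP Vpd). Qed.
Let Spd : posdefmx S. Proof. by case: (sqrtmxP Vpd). Qed.
Let ST : S^T = S. Proof. by case: Spd. Qed.
Let Su : S \in unitmx. Proof. exact: posdef_unit. Qed.
Let Au : A \in unitmx. Proof. exact: posdef_unit. Qed.

Lemma drift_e_ge1 x : 0 <= x -> 1 <= e x.
Proof.
case/andP: theta01 => t0 t1 x0.
by rewrite /e lerDl mulr_ge0 // divr_ge0 // mulr_ge0 // ltW.
Qed.

Let e_neq0 i : e (D 0 i) != 0.
Proof. by rewrite gt_eqF // (lt_le_trans ltr01) // drift_e_ge1 // ltW. Qed.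

Let eu : fc e \in unitmx.
Proof. by apply: fcalc_unit => // i; exact: e_neq0. Qed.

Let fcalc_affine (k : R) (g : R -> R) : (forall x, g x = 1 + k * x) ->
  fc g = 1%:M + k *: (S *m A *m S).
Proof.
move=> gE; rewrite MD fcalcZ -(fcalc_cst D UU) fcalcD.
by apply: eq_fcalc => i.
Qed.

Let W := 1%:M + (theta * h / 2) *: (V *m A).

Let WS : W *m S = S *m fc e.
Proof.
rewrite (@fcalc_affine (theta * h / 2)) // /W mulmxDl mulmxDr mul1mx mulmx1.
by rewrite -scalemxAl -scalemxAr !mulmxA SS.
Qed.

Let Wu : W \in unitmx.
Proof.
have -> : W = S *m fc e *m invmx S by rewrite -WS mulmxK.
by rewrite 2!unitmx_mul unitmx_inv Su andbT; exact: eu.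
Qed.

Let WVS : invmx W *m S = S *m fc (fun x => (e x)^-1).
Proof.
rewrite -invmx_fcalc //; apply: (can_inj (mulKmx Wu)).
by rewrite mulKVmx // mulmxA WS mulmxK.
Qed.

(** Centring at the mean of the target and scaling by V^(1/2) turns the
    preconditioner into the identity and V A into the symmetric matrix
    V^(1/2) A V^(1/2), of which all coefficients are then functions. *)
Lemma proposal_coord (u xi : 'cV[R]_n) :
  proposal A V b theta h (m + S *m u) xi =
  m + S *m (fc (fun x => (e x)^-1) *m (fc f *m u + Num.sqrt h *: xi)).
Proof.
rewrite /proposal -/W sqrtmxZ // [in RHS]mulmxA -WVS -mulmxA.
rewrite -{2}[m](mulKmx Wu) -mulmxDr; congr (_ *m _).
have Vb : V *m A *m m = V *m b by rewrite -!mulmxA mulKVmx.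
set k2 := (1 - theta) * h / 2.
have FS : (1%:M - k2 *: (V *m A)) *m S = S *m fc f.
  rewrite (@fcalc_affine (- k2)) => [|x]; last by rewrite /f mulNr.
  rewrite mulmxBl mulmxDr mul1mx mulmx1 scaleNr mulmxN.
  by rewrite -scalemxAl -scalemxAr !mulmxA SS.
have Fm : (1%:M - k2 *: (V *m A)) *m m = m - k2 *: (V *m b).
  by rewrite mulmxBl mul1mx -scalemxAl Vb.
have Wm : W *m m = m + (theta * h / 2) *: (V *m b).
  by rewrite /W mulmxDl mul1mx -scalemxAl Vb.
rewrite [in LHS]mulmxDr Fm [in LHS]mulmxA FS Wm [in RHS]mulmxDr [in RHS]mulmxA -scalemxAl -scalemxAr.
rewrite addrA; congr (_ + _); rewrite addrAC; congr (_ + _).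
rewrite -addrA; congr (_ + _); rewrite -scaleNr -scalerDl; congr (_ *: _).
by rewrite /k2; field.
Qed.

(** The log acceptance ratio of a move from u to v is this constant times
    v^T M^2 v - u^T M^2 u, with M = V^(1/2) A V^(1/2); it comes from the identity
    (e^2 - f^2) / (2 h) = x / 2 + ((2 theta - 1) h / 8) x^2. *)
Definition log_accept_gap : R := (2 * theta - 1) * h / 8.
Local Notation b0 := log_accept_gap.

Lemma target_pdf_coord : exists2 c, 0 < c & forall u,
  target_pdf A b (m + S *m u) = c * expR (- (dotv u (fc id *m u) / 2)).
Proof.
exists (Num.sqrt ((2 * pi) ^+ n * \det (invmx A)))^-1.
  rewrite invr_gt0 sqrtr_gt0 mulr_gt0 ?exprn_gt0 ?mulr_gt0 ?pi_gt0 //.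
  have [Qpd <-] := sqrtmxP (posdef_inv Apd).
  rewrite det_mulmx -expr2 lt_neqAle sqr_ge0 andbT eq_sym sqrf_eq0.
  by rewrite -unitfE -unitmxE posdef_unit.
move=> u; rewrite /target_pdf /mvnormal_pdf addrC addKr invmxK.
suff -> : ((S *m u)^T *m A *m (S *m u)) 0 0 = dotv u (fc id *m u) by [].
by rewrite -MD /dotv trmx_mul ST !mulmxA.
Qed.

Lemma proposal_pdf_coord : exists2 c, 0 < c & forall u v,
  proposal_pdf A V b theta h (m + S *m u) (m + S *m v) =
  c * expR (- (dotv (fc e *m v - fc f *m u) (fc e *m v - fc f *m u) / (2 * h))).
Proof.
have hr0 : Num.sqrt h != 0 by rewrite gt_eqF // sqrtr_gt0.
have LE : proposal_noise A V theta h = Num.sqrt h *: (S *m fc (fun x => (e x)^-1)).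
  by rewrite /proposal_noise sqrtmxZ // -scalemxAr -/W WVS.
have Lu : proposal_noise A V theta h \in unitmx.
  rewrite LE unitmxZ ?unitfE // unitmx_mul Su -invmx_fcalc //.
  by rewrite unitmx_inv eu.
set L := proposal_noise A V theta h in LE Lu *.
exists (Num.sqrt ((2 * pi) ^+ n * \det (L *m L^T)))^-1.
  rewrite invr_gt0 sqrtr_gt0 mulr_gt0 ?exprn_gt0 ?mulr_gt0 ?pi_gt0 //.
  rewrite det_mulmx det_tr -expr2 lt_neqAle sqr_ge0 andbT eq_sym sqrf_eq0.
  by rewrite -unitfE -unitmxE.
move=> u v; rewrite /proposal_pdf /mvnormal_pdf -/L.
have meanE : proposal_mean A V b theta h (m + S *m u) =
    m + S *m (fc (fun x => (e x)^-1) *m (fc f *m u)).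
  have := proposal_coord u 0; rewrite /proposal !mulmx0 scaler0 !addr0.
  by rewrite /proposal_mean.
rewrite meanE opprD addrACA subrr add0r -mulmxBr.
set y := v - _.
have iLL : invmx (L *m L^T) = (invmx L)^T *m invmx L.
  have LTu : L^T \in unitmx by rewrite unitmx_tr.
  have LLu : L *m L^T \in unitmx by rewrite unitmx_mul Lu.
  apply: (can_inj (mulKmx LLu)); rewrite mulmxV //.
  by rewrite trmx_inv mulmxA -(mulmxA L) mulmxV // mulmx1 mulmxV.
have -> : ((S *m y)^T *m invmx (L *m L^T) *m (S *m y)) 0 0 =
    dotv (invmx L *m (S *m y)) (invmx L *m (S *m y)).
  by rewrite iLL /dotv [in RHS]trmx_mul !mulmxA.
have -> : invmx L *m (S *m y) = (Num.sqrt h)^-1 *: (fc e *m v - fc f *m u).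
  apply: (can_inj (mulKmx Lu)); rewrite mulKVmx // LE -scalemxAl -scalemxAr scalerA.
  rewrite divff // scale1r -mulmxA; congr (_ *m _).
  rewrite mulmxBr /y; congr (_ - _).
  rewrite mulmxA fcalcM // (@eq_fcalc _ _ _ _ _ (fun=> 1)) ?fcalc_cst ?mul1mx //.
  by move=> i; rewrite mulVf.
rewrite dotvZl dotvZr mulrA -invfM -expr2 sqr_sqrtr ?(ltW h0) //.
by congr (_ * expR (- _)); rewrite invfM; ring.
Qed.

(** The proposal is reversible for a Gaussian law with the same mean as the
    target and precision matrix A + (2 theta - 1) (h / 4) A V A, so that the
    acceptance ratio only involves the difference of these two precisions. *)
Lemma accept_coord (u v : 'cV[R]_n) :
  accept_prob A V b theta h (m + S *m u) (m + S *m v) =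
  accept_exp (dotv v (fc (fun x => b0 * x ^+ 2) *m v) -
              dotv u (fc (fun x => b0 * x ^+ 2) *m u)).
Proof.
have [ct ct0 tE] := target_pdf_coord; have [cp cp0 pE] := proposal_pdf_coord.
have cancel (x y z t : R) : ct * expR x * (cp * expR y) /
    (ct * expR z * (cp * expR t)) = expR (x + y - (z + t)).
  by rewrite expRB !expRD; field; rewrite !gt_eqF ?expR_gt0.
rewrite /accept_prob /mh_accept /accept_exp !tE !pE cancel.
apply: (congr1 (fun x : R => Num.min 1 (expR x))).
have sq (x y : 'cV[R]_n) : dotv (fc e *m y - fc f *m x) (fc e *m y - fc f *m x) =
    dotv y (fc (fun t => e t * e t) *m y) + dotv x (fc (fun t => f t * f t) *m x)
    - 2 * dotv x (fc (fun t => e t * f t) *m y).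
  rewrite !(dotvDl, dotvDr, dotvNl, dotvNr) !dotv_fcalcM // (dotv_fcalcC _ _ _ y x).
  rewrite (@eq_fcalc _ _ U D (fun w => f w * e w) (fun w => e w * f w)) => [|i].
    by ring.
  by rewrite mulrC.
have split2 (z : 'cV[R]_n) : dotv z (fc (fun t => e t * e t) *m z) =
    dotv z (fc (fun t => f t * f t) *m z) + h * dotv z (fc id *m z) +
    2 * h * dotv z (fc (fun x => b0 * x ^+ 2) *m z).
  rewrite !dotv_fcalcZ !dotv_fcalcD.
  by apply: eq_dotv_fcalc => i; rewrite /e /f /b0; field.
by rewrite !sq !split2 (dotv_fcalcC _ _ _ v u); field; rewrite gt_eqF.
Qed.

End langevin_algebra.

(** * Expectations over the chain in equilibrium *)

Section langevin_expectations.
Context {R : realType} {n : nat}.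
Variables (A V : 'M[R]_n) (b : 'cV[R]_n) (theta h : R).
Hypotheses (Apd : posdefmx A) (Vpd : posdefmx V) (h0 : 0 < h).
Hypotheses (theta01 : 0 <= theta <= 1).
Variables (U : 'M[R]_n) (D : 'rV[R]_n).
Hypotheses (UU : U *m U^T = 1%:M) (D0 : forall i, 0 < D 0 i).
Local Notation S := (sqrtmx V).
Local Notation fc := (fcalc U D).
Hypothesis MD : S *m A *m S = fc id.

Local Notation e := (drift_e theta h).
Local Notation f := (drift_f theta h).
Local Notation b0 := (log_accept_gap theta h).
Local Notation m := (invmx A *m b).
Local Notation RT := (measurableTypeR R).
Local Notation std := (std_normal_prob n).

Let Spd : posdefmx S. Proof. by case: (sqrtmxP Vpd). Qed.
Let ST : S^T = S. Proof. by case: Spd. Qed.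
Let Su : S \in unitmx. Proof. exact: posdef_unit. Qed.

(** Coefficients of u^2, u xi and xi^2 in the log acceptance ratio, obtained by
    substituting the proposal v = (f u + sqrt h xi) / e into
    log_accept_gap * x^2 * (v^2 - u^2). *)
Definition coef_p (x : R) : R := b0 * x ^+ 2 * ((f x / e x) ^+ 2 - 1).
Definition coef_t (x : R) : R := 2 * b0 * Num.sqrt h * x ^+ 2 * f x / e x ^+ 2.
Definition coef_k (x : R) : R := b0 * h * x ^+ 2 / e x ^+ 2.

Definition log_ratio (u xi : 'cV[R]_n) : R :=
  dotv u (fc coef_p *m u) + dotv (fc coef_t *m u) xi + dotv xi (fc coef_k *m xi).

Lemma accept_proposal (u xi : 'cV[R]_n) :
  accept_prob A V b theta h (m + S *m u) (proposal A V b theta h (m + S *m u) xi) =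
  accept_exp (log_ratio u xi).
Proof.
rewrite (proposal_coord b Apd Vpd h0 theta01 UU D0 MD).
rewrite (accept_coord b Apd Vpd h0 theta01 UU D0 MD); congr accept_exp.
have sh : Num.sqrt h * Num.sqrt h = h by rewrite -expr2 sqr_sqrtr // ltW.
set einv : R -> R := fun x => (e x)^-1.
pose g (x : R) := b0 * x ^+ 2; rewrite -/g.
have -> : fc einv *m (fc f *m u + Num.sqrt h *: xi) =
    fc (fun x => einv x * f x) *m u + Num.sqrt h *: (fc einv *m xi).
  by rewrite mulmxDr mulmxA fcalcM // -scalemxAr.
set y := _ *m u; set z := _ *m xi.
rewrite mulmxDr -scalemxAr !(dotvDl, dotvDr, dotvZl, dotvZr).
rewrite (dotv_fcalcC _ _ g z y) /y /z.
have fcM2 g1 g2 (w : 'cV[R]_n) : fc g1 *m (fc g2 *m w) = fc (fun x => g1 x * g2 x) *m w.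
  by rewrite mulmxA fcalcM.
rewrite !fcM2 !dotv_fcalcM // /log_ratio.
rewrite [dotv (fc coef_t *m u) xi]dotvC (dotv_fcalcC _ _ _ xi u).
have -> : dotv u (fc coef_p *m u) =
    dotv u (fc (fun x => einv x * f x * (g x * (einv x * f x))) *m u) - dotv u (fc g *m u).
  rewrite -mulN1r dotv_fcalcZ dotv_fcalcD; apply: eq_dotv_fcalc => i.
  by rewrite /coef_p /g /einv exprMn; ring.
have -> : dotv u (fc coef_t *m xi) = 2 * (Num.sqrt h *
    dotv u (fc (fun x => einv x * f x * (g x * einv x)) *m xi)).
  rewrite !dotv_fcalcZ; apply: eq_dotv_fcalc => i.
  by rewrite /coef_t /g /einv -exprVn; ring.
have -> : dotv xi (fc coef_k *m xi) = Num.sqrt h * (Num.sqrt h *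
    dotv xi (fc (fun x => einv x * (g x * einv x)) *m xi)).
  rewrite mulrA sh dotv_fcalcZ; apply: eq_dotv_fcalc => i.
  by rewrite /coef_k /g /einv -exprVn; ring.
ring.
Qed.

Local Notation B := (invmx S *m sqrtmx (invmx A)).

Lemma state_coord (z : 'cV[R]_n) :
  affine_cV m (sqrtmx (invmx A)) z = m + S *m (B *m z).
Proof. by rewrite /affine_cV !mulmxA mulmxV // mul1mx. Qed.

(** In equilibrium the whitened state is B z with z standard Gaussian; only the
    covariance B B^T matters below. *)
Lemma state_cov : B *m B^T = fc (fun x => x^-1).
Proof.
have [Qpd QQ] := sqrtmxP (posdef_inv Apd).
have Au : A \in unitmx by exact: posdef_unit.
rewrite -invmx_fcalc => [|//|i]; last by rewrite gt_eqF.
rewrite -MD; set M := S *m A *m S.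
have Mu : M \in unitmx by rewrite /M !unitmx_mul Su Au.
apply: (can_inj (mulKmx Mu)); rewrite mulmxV //.
rewrite trmx_mul Qpd.1 trmx_inv ST /M.
rewrite -!mulmxA (mulmxA (sqrtmx (invmx A))) QQ (mulmxA S (invmx S)) mulmxV //.
by rewrite mul1mx (mulmxA A) mulmxV // mul1mx mulmxV.
Qed.

Local Open Scope ereal_scope.

Lemma equilibrium_integral (g : 'cV[R]_n * 'cV[R]_n * RT -> \bar R) :
  measurable_fun setT g -> (forall w, 0 <= g w) ->
  \int[equilibrium_prob A b]_w g w =
  \int[std \x std]_v \int[uniform_prob (@ltr01 R)]_t g (m + S *m (B *m v.1), v.2, t)%R.
Proof.
move=> mg g0; rewrite /equilibrium_prob (fubini_tonelli1 g mg g0).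
have mF := measurable_fun_fubini_tonelli_F (m2 := uniform_prob (@ltr01 R)) g mg g0.
set G := fubini_F _ g in mF *.
have G0 x : 0 <= G x by apply: integral_ge0.
rewrite (fubini_tonelli1 G mF G0).
have mF2 := measurable_fun_fubini_tonelli_F (m2 := mvnormal_prob (0 : 'cV[R]_n) 1%:M) G mF G0.
rewrite /target_prob {1}/mvnormal_prob.
rewrite (ge0_integral_distribution (affine_cV m (sqrtmx (invmx A))) mF2); last first.
  by move=> x; apply: integral_ge0 => y _.
pose G' (v : 'cV[R]_n * 'cV[R]_n) := G ((m + S *m (B *m v.1))%R, v.2).
have mG' : measurable_fun setT G'.
  apply: (measurableT_comp mF); apply: measurable_fun_pair.
    apply: measurable_addmx => //; apply: measurable_mulmx => //.
    by apply: measurable_mulmx => //; exact: measurable_fst.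
  exact: measurable_snd.
rewrite [RHS](_ : _ = \int[std \x std]_v G' v) //.
rewrite (fubini_tonelli1 G' mG' (fun v => G0 _)).
apply: eq_integral => z _; rewrite /fubini_F /=.
have mG'z : measurable_fun setT (fun y => G (affine_cV m (sqrtmx (invmx A)) z, y)).
  exact: (measurableT_comp mF).
rewrite /mvnormal_prob (ge0_integral_distribution (affine_cV 0 (sqrtmx 1%:M)) mG'z) //.
by apply: eq_integral => y _ /=; rewrite /G' state_coord /affine_cV /= sqrtmx1 mul1mx add0r.
Qed.

End langevin_expectations.

Section uniform_variate.
Context {R : realType}.
Local Notation RT := (measurableTypeR R).
Local Open Scope ereal_scope.

Lemma integral_uniform_below (c p : R) : (0 <= c)%R -> (0 <= p <= 1)%R ->
  \int[uniform_prob (@ltr01 R)]_t (if (t <= p)%R then c else 0%R)%:E = (c * p)%:E.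
Proof.
move=> c0 /andP[p0 p1].
have mf : measurable_fun setT (fun t : RT => (if (t <= p)%R then c else 0%R)%:E).
  apply/measurable_EFinP; apply: measurable_fun_ifT => //.
  exact: measurable_fun_ler.
rewrite integral_uniform //; last by move=> t; rewrite lee_fin; case: ifP.
rewrite subr0 invr1 mul1e.
transitivity (\int[lebesgue_measure]_(t in [set` `[0%R, p]] : set RT) c%:E).
  rewrite [LHS]integral_mkcond [RHS]integral_mkcond; congr (integral _ _ _).
  apply/funext => t; rewrite !patchE !mem_setE !in_itv /=.
  have [t0|//] /= := leP 0%R t.
  have [tp|pt] := leP t p; first by rewrite (le_trans tp p1).
  by case: ifP.
rewrite integral_cst //= lebesgue_measure_itv /= lte_fin sube0.
by case: ifPn => [_|]; [rewrite EFinM|rewrite -leNgt => pz;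
  have -> : p = 0%R by apply/le_anti/andP].
Qed.

End uniform_variate.

Section langevin_chain.
Context {R : realType} {n : nat}.
Variables (A V : 'M[R]_n) (b : 'cV[R]_n) (theta h : R).
Hypotheses (Apd : posdefmx A) (Vpd : posdefmx V) (h0 : 0 < h).
Hypotheses (theta01 : 0 <= theta <= 1).
Variables (U : 'M[R]_n) (D : 'rV[R]_n).
Hypotheses (UU : U *m U^T = 1%:M) (D0 : forall i, 0 < D 0 i).
Local Notation S := (sqrtmx V).
Local Notation fc := (fcalc U D).
Hypothesis MD : S *m A *m S = fc id.

Local Notation e := (drift_e theta h).
Local Notation f := (drift_f theta h).
Local Notation m := (invmx A *m b).
Local Notation B := (invmx S *m sqrtmx (invmx A)).
Local Notation RT := (measurableTypeR R).
Local Notation std := (std_normal_prob n).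
Local Notation lr := (log_ratio theta h U D).

Let Su : S \in unitmx. Proof. by apply: posdef_unit; case: (sqrtmxP Vpd). Qed.

Let coordK (x : 'cV[R]_n) : x = m + S *m (invmx S *m (x - m)).
Proof. by rewrite mulKVmx // addrC subrK. Qed.

Lemma measurable_log_ratio d (T : measurableType d) (u xi : T -> 'cV[R]_n) :
  measurable_fun setT u -> measurable_fun setT xi ->
  measurable_fun setT (fun t => lr (u t) (xi t)).
Proof.
move=> mu mxi; apply: measurable_funD; first apply: measurable_funD.
- by apply: measurable_dotv => //; apply: measurable_mulmx.
- by apply: measurable_dotv => //; apply: measurable_mulmx.
- by apply: measurable_dotv => //; apply: measurable_mulmx.
Qed.

Let mx1 : measurable_fun setT (fun w : 'cV[R]_n * 'cV[R]_n * RT => w.1.1).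
Proof. by apply: measurableT_comp. Qed.
Let mx2 : measurable_fun setT (fun w : 'cV[R]_n * 'cV[R]_n * RT => w.1.2).
Proof. by apply: measurableT_comp. Qed.

Let accept_of (w : 'cV[R]_n * 'cV[R]_n * RT) :=
  accept_prob A V b theta h w.1.1 (proposal A V b theta h w.1.1 w.1.2).

Let mcoord : measurable_fun setT (fun w : 'cV[R]_n * 'cV[R]_n * RT =>
  invmx S *m (w.1.1 - m)).
Proof. by apply: measurable_mulmx => //; apply: measurable_addmx. Qed.

Let maccept : measurable_fun setT accept_of.
Proof.
rewrite (_ : accept_of = fun w => accept_exp (lr (invmx S *m (w.1.1 - m)) w.1.2)).
  apply: (measurableT_comp measurable_accept_exp).
  by apply: measurable_log_ratio.
apply/funext => w; rewrite /accept_of {1 2}(coordK w.1.1).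
exact: (accept_proposal b Apd Vpd h0 theta01 UU D0 MD).
Qed.

Lemma expected_acceptE : (expected_accept A V b theta h =
  \int[std \x std]_v (accept_exp (lr (B *m v.1) v.2))%:E)%E.
Proof.
rewrite /expected_accept unlock.
transitivity (\int[equilibrium_prob A b]_w (accept_of w)%:E)%E.
  by apply: eq_integral => -[[x xi] t].
rewrite (equilibrium_integral A b Vpd); last 2 first.
- exact/measurable_EFinP.
- move=> [[x xi] t]; rewrite lee_fin /accept_of /= (coordK x).
  by rewrite (accept_proposal b Apd Vpd h0 theta01 UU D0 MD) accept_exp_ge0.
apply: eq_integral => -[z xi] _; rewrite /accept_of /= prob_integral_cst.
by rewrite (accept_proposal b Apd Vpd h0 theta01 UU D0 MD).
Qed.

Variables (q : 'cV[R]_n) (a : R).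
Hypotheses (qE : fc id *m q = a *: q).

Definition jump (u xi : 'cV[R]_n) : R :=
  (Num.sqrt h * dotv q xi - h * a / 2 * dotv q u) / e a.

Lemma jump_proposal u xi : e a != 0 ->
  dotv q (invmx S *m (proposal A V b theta h (m + S *m u) xi - (m + S *m u))) =
  jump u xi.
Proof.
move=> ea; rewrite (proposal_coord b Apd Vpd h0 theta01 UU D0 MD).
rewrite opprD addrACA subrr add0r -mulmxBr mulKmx //.
rewrite dotvDr dotvNr dotv_fcalcC dotvC (fcalc_eigenvector UU _ qE) dotvZl.
rewrite dotvDr dotvZr dotv_fcalcC dotvC (fcalc_eigenvector UU _ qE) dotvZl.
have -> : f a = e a - h * a / 2 by rewrite /drift_f /drift_e; field.
by rewrite /jump; field.
Qed.

Lemma measurable_jump d (T : measurableType d) (u xi : T -> 'cV[R]_n) :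
  measurable_fun setT u -> measurable_fun setT xi ->
  measurable_fun setT (fun t => jump (u t) (xi t)).
Proof.
move=> mu mxi; apply: measurable_funM => //.
by apply: measurable_funD; [|apply: measurableT_comp => //]; apply: measurable_funM => //;
  apply: measurable_dotv.
Qed.

(** A rejected move contributes nothing, and integrating out the uniform variate
    turns the indicator of acceptance into the acceptance probability. *)
Lemma expected_sqjumpE : e a != 0 -> (expected_sqjump A V b theta h q =
  \int[std \x std]_v (jump (B *m v.1) v.2 ^+ 2 * accept_exp (lr (B *m v.1) v.2))%:E)%E.
Proof.
move=> ea; rewrite /expected_sqjump unlock.
pose J (w : 'cV[R]_n * 'cV[R]_n * RT) := jump (invmx S *m (w.1.1 - m)) w.1.2.
have mJ : measurable_fun setT J by exact: measurable_jump.
pose g (w : 'cV[R]_n * 'cV[R]_n * RT) : R :=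
  if w.2 <= accept_of w then J w ^+ 2 else 0.
have mg : measurable_fun setT g.
  apply: measurable_fun_ifT => //; last exact: measurable_funX.
  by apply: measurable_fun_ler => //; exact: measurable_snd.
transitivity (\int[equilibrium_prob A b]_w (g w)%:E)%E.
  apply: eq_integral => -[[x xi] t] _; congr EFin; rewrite /g /accept_of /J /=.
  rewrite /next_state /mh_next -/(accept_prob A V b theta h x _).
  case: ifPn => _; last by rewrite subrr mulmx0 mxE normr0 expr0n.
  rewrite -mulmxA -/(dotv _ _) real_normK ?num_real //.
  by rewrite {1 2}(coordK x) jump_proposal.
rewrite (equilibrium_integral A b Vpd); last 2 first.
- exact/measurable_EFinP.
- by move=> w; rewrite lee_fin /g; case: ifP => // _; rewrite sqr_ge0.
apply: eq_integral => -[z xi] _; rewrite /g /J /accept_of /=.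
rewrite (accept_proposal b Apd Vpd h0 theta01 UU D0 MD).
have -> : m + S *m (B *m z) - m = S *m (B *m z) by rewrite addrC addKr.
rewrite mulKmx //.
by rewrite integral_uniform_below // ?sqr_ge0 // accept_exp_ge0 accept_exp_le1.
Qed.

End langevin_chain.

(** * The log ratio eigenvalue by eigenvalue *)

Section coefficient_bounds.
Context {R : realType}.
Variables (theta h D : R).
Hypotheses (theta01 : 0 <= theta <= 1) (h0 : 0 < h) (D0 : 0 < D).
Local Notation x := (h * D).
Local Notation e := (drift_e theta h D).
Local Notation f := (drift_f theta h D).
Local Notation bb := (2 * theta - 1).

Let x0 : 0 < x. Proof. exact: mulr_gt0. Qed.
Let e1 : 1 <= e. Proof. by apply: drift_e_ge1 => //; exact: ltW. Qed.
Let e0 : e != 0. Proof. by rewrite gt_eqF // (lt_le_trans ltr01). Qed.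
Let bb1 : `|bb| <= 1. Proof. by case/andP: theta01 => *; rewrite ler_norml; apply/andP; split; lra. Qed.
Let bb2 : bb ^+ 2 <= 1. Proof. by have := bb1; rewrite ler_norml => /andP[? ?]; nra. Qed.
Let eE : e = 1 + theta / 2 * x. Proof. by rewrite /drift_e; field. Qed.
Let fE : f = 1 - (1 - theta) / 2 * x. Proof. by rewrite /drift_f; field. Qed.
Let ie0 : 0 <= (e ^+ 2)^-1. Proof. by rewrite invr_ge0 sqr_ge0. Qed.
Let ie1 : (e ^+ 2)^-1 <= 1.
Proof. by rewrite invf_le1 ?exprn_gt0 ?(lt_le_trans ltr01) // exprn_ege1. Qed.

Let dsq : f ^+ 2 - e ^+ 2 = - x * (1 + bb / 4 * x).
Proof. by rewrite eE fE; field. Qed.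

Lemma coef_pE : coef_p theta h D / D = - (bb / 8 * x ^+ 2 * (1 + bb / 4 * x)) / e ^+ 2.
Proof.
have h1 : (f / e) ^+ 2 - 1 = (- x * (1 + bb / 4 * x)) / e ^+ 2.
  by rewrite -dsq expr_div_n; field.
rewrite /coef_p h1 /log_accept_gap; field.
by rewrite e0 gt_eqF.
Qed.

Lemma coef_kE : coef_k theta h D = bb / 8 * x ^+ 2 / e ^+ 2.
Proof. by rewrite /coef_k /log_accept_gap; field. Qed.

Lemma coef_tE : coef_t theta h D ^+ 2 / D = bb ^+ 2 / 16 * x ^+ 3 * (f ^+ 2 / e ^+ 4).
Proof.
have sh : Num.sqrt h ^+ 2 = h by rewrite sqr_sqrtr // ltW.
have -> : coef_t theta h D ^+ 2 = (2 * log_accept_gap theta h * D ^+ 2 * f) ^+ 2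
    * Num.sqrt h ^+ 2 / e ^+ 4.
  by rewrite /coef_t; field.
by rewrite sh /log_accept_gap; field; rewrite e0 gt_eqF.
Qed.

Variable eps : R.
Hypotheses (xeps : x <= eps) (eps1 : eps <= 1).

Let xx3 : x * x ^+ 3 <= eps * x ^+ 3.
Proof. by rewrite ler_wpM2r // exprn_ge0 // ltW. Qed.

Lemma one_sub_inv_sqr_drift : 1 - (e ^+ 2)^-1 <= x.
Proof.
have h2 : 1 - (e ^+ 2)^-1 = (e ^+ 2 - 1) / e ^+ 2 by field.
rewrite h2 ler_pdivrMr ?exprn_gt0 ?(lt_le_trans ltr01) //.
have e2 : 1 <= e ^+ 2 by rewrite exprn_ege1.
have ee : e <= 1 + x / 2.
  rewrite eE; case/andP: theta01 => t0 t1; have := x0; nra.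
have : e ^+ 2 - 1 = (e - 1) * (e + 1) by ring.
move=> ->; apply: (@le_trans _ _ (x / 2 * (e + 1))).
  have := e1 => e1'; apply: ler_wpM2r; lra.
have -> : x / 2 * (e + 1) = x * ((e + 1) / 2) by field.
rewrite ler_wpM2l ?(ltW x0) //; apply: (@le_trans _ _ e); first by have := e1 => e1'; lra.
by rewrite expr2 ler_peMl // (le_trans ler01).
Qed.

(** The means of the two quadratic terms, of order x^2 each, cancel to leading
    order.  What remains is of order x^3, like the variance of the cross term,
    and equal to minus half of it: this is why the acceptance probability
    depends on the sum of the cubes of the x, hence of lambda_i^6. *)
Lemma coef_mean_bound : `|coef_p theta h D / D + coef_k theta h D + bb ^+ 2 / 32 * x ^+ 3|
  <= eps * x ^+ 3.
Proof.
rewrite coef_pE coef_kE.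
have -> : - (bb / 8 * x ^+ 2 * (1 + bb / 4 * x)) / e ^+ 2 + bb / 8 * x ^+ 2 / e ^+ 2 +
   bb ^+ 2 / 32 * x ^+ 3 = bb ^+ 2 / 32 * x ^+ 3 * (1 - (e ^+ 2)^-1) by field.
have x3 : 0 <= x ^+ 3 by rewrite exprn_ge0 // ltW.
have b0 := sqr_ge0 bb; have ob := one_sub_inv_sqr_drift.
have o1 : 0 <= 1 - (e ^+ 2)^-1 by rewrite subr_ge0.
have b1 : 0 <= bb ^+ 2 / 32 by rewrite divr_ge0.
rewrite ger0_norm; last by rewrite mulr_ge0 // mulr_ge0.
apply: le_trans xx3; rewrite [leRHS]mulrC.
apply: (@le_trans _ _ (x ^+ 3 * (1 - (e ^+ 2)^-1))); last by rewrite ler_wpM2l.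
rewrite ler_wpM2r // ler_piMl //; have := bb2; lra.
Qed.

Let sq_bound (c y : R) : `|c| <= x ^+ 2 -> y = c -> y ^+ 2 <= eps * x ^+ 3.
Proof.
move=> cx ->; apply: le_trans xx3.
have -> : x * x ^+ 3 = (x ^+ 2) ^+ 2 by ring.
by rewrite -[c ^+ 2]real_normK ?num_real // lerXn2r ?nnegrE ?exprn_ge0 // ltW.
Qed.

Lemma coef_k_bound : coef_k theta h D ^+ 2 <= eps * x ^+ 3.
Proof.
apply: sq_bound (coef_kE).
rewrite normrM (ger0_norm ie0) normrM [`|x ^+ 2|]ger0_norm ?sqr_ge0 //.
have x2 := sqr_ge0 x; have := ie1; have := ie0.
set i := (e ^+ 2)^-1 => i0 i1.
have h1 : `|bb / 8| <= 1 by rewrite normrM [`|8^-1|]ger0_norm //; have := bb1; lra.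
apply: (@le_trans _ _ (`|bb / 8| * x ^+ 2)); first by rewrite ler_piMr // mulr_ge0.
by rewrite ler_piMl.
Qed.

Lemma coef_p_bound : (coef_p theta h D / D) ^+ 2 <= eps * x ^+ 3.
Proof.
apply: sq_bound (coef_pE).
rewrite normrM normrN (ger0_norm ie0) normrM (normrM (bb / 8)) [`|x ^+ 2|]ger0_norm ?sqr_ge0 //.
have x2 := sqr_ge0 x; have := ie1; have := ie0.
set i := (e ^+ 2)^-1 => i0 i1.
have h1 : `|bb / 8| <= 1 / 8 by rewrite normrM [`|8^-1|]ger0_norm //; have := bb1; lra.
have h2 : `|1 + bb / 4 * x| <= 2.
  have := bb1; rewrite !ler_norml => /andP[? ?]; have := x0.
  have x1 : x <= 1 by exact: le_trans xeps eps1.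
  by move=> ?; apply/andP; split; nra.
have h1' := normr_ge0 (bb / 8); have h2' := normr_ge0 (1 + bb / 4 * x).
apply: (@le_trans _ _ (1 / 8 * x ^+ 2 * 2)); last by lra.
apply: (@le_trans _ _ (`|bb / 8| * x ^+ 2 * `|1 + bb / 4 * x|)).
  by rewrite ler_piMr //; apply: mulr_ge0 => //; apply: mulr_ge0.
apply: ler_pM => //; first by apply: mulr_ge0.
by rewrite ler_wpM2r.
Qed.

Let r := f ^+ 2 / e ^+ 4.

Let f01 : 0 <= f <= 1.
Proof.
case/andP: theta01 => t0 t1; rewrite fE; have := x0.
have x1 : x <= 1 by exact: le_trans xeps eps1.
by move=> ?; apply/andP; split; nra.
Qed.

Let r0 : 0 <= r. Proof. by rewrite divr_ge0 ?sqr_ge0 // exprn_ge0 // (le_trans ler01). Qed.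

Let r1 : r <= 1.
Proof.
case/andP: f01 => f0 f1.
rewrite ler_pdivrMr ?exprn_gt0 ?(lt_le_trans ltr01) // mul1r.
by apply: (@le_trans _ _ 1); [rewrite exprn_ile1|rewrite exprn_ege1].
Qed.

Let r3 : 1 - r <= 3 * x.
Proof.
have ob := one_sub_inv_sqr_drift; have := ie0; have := ie1.
have -> : r = f ^+ 2 * ((e ^+ 2)^-1 * (e ^+ 2)^-1) by rewrite /r; field.
set i := (e ^+ 2)^-1 in ob *; move=> i1 i0.
have f2 : 1 - f ^+ 2 <= x.
  case/andP: theta01 => t0 t1; rewrite fE.
  have tx : 0 <= theta * x by rewrite mulr_ge0 // ltW.
  set y := (1 - theta) / 2 * x; have y2 : y <= x / 2 by rewrite /y; lra.
  have := sqr_ge0 y; have -> : 1 - (1 - y) ^+ 2 = 2 * y - y ^+ 2 by ring.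
  lra.
have f21 : f ^+ 2 <= 1 by case/andP: f01 => ? ?; rewrite exprn_ile1.
have f20 := sqr_ge0 f.
have -> : 1 - f ^+ 2 * (i * i) = (1 - f ^+ 2) + f ^+ 2 * (1 - i) + f ^+ 2 * i * (1 - i).
  by ring.
have h1 : f ^+ 2 * (1 - i) <= 1 - i by rewrite ler_piMl // subr_ge0.
have h2 : f ^+ 2 * i * (1 - i) <= 1 - i.
  by rewrite ler_piMl ?subr_ge0 // mulr_ile1.
lra.
Qed.

Lemma coef_t_bound : `|coef_t theta h D ^+ 2 / D - bb ^+ 2 / 16 * x ^+ 3| <= eps * x ^+ 3.
Proof.
rewrite coef_tE -/r.
have -> : bb ^+ 2 / 16 * x ^+ 3 * r - bb ^+ 2 / 16 * x ^+ 3 =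
    - (bb ^+ 2 / 16 * (x ^+ 3 * (1 - r))) by ring.
have x3 : 0 <= x ^+ 3 by rewrite exprn_ge0 // ltW.
have b0 := sqr_ge0 bb.
have xr0 : 0 <= x ^+ 3 * (1 - r) by rewrite mulr_ge0 // subr_ge0.
rewrite normrN ger0_norm; last by rewrite mulr_ge0 // divr_ge0.
apply: le_trans xx3.
apply: (@le_trans _ _ (1 / 16 * (x ^+ 3 * (3 * x)))).
  by apply: ler_pM => //; rewrite ?divr_ge0 // ?ler_wpM2l // ler_wpM2r.
have : 0 <= x * x ^+ 3 by rewrite mulr_ge0 // ltW.
lra.
Qed.

Lemma coef_t_le : coef_t theta h D ^+ 2 / D <= x ^+ 3.
Proof.
rewrite coef_tE -/r.
have x3 : 0 <= x ^+ 3 by rewrite exprn_ge0 // ltW.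
have b0 := sqr_ge0 bb.
apply: (@le_trans _ _ (bb ^+ 2 / 16 * x ^+ 3)).
  by rewrite ler_piMr // mulr_ge0 // divr_ge0.
rewrite ler_piMl //; have := bb2; lra.
Qed.

Lemma coef_t_sqr_bound : (coef_t theta h D ^+ 2 / D) ^+ 2 <= eps * x ^+ 3.
Proof.
have t0 : 0 <= coef_t theta h D ^+ 2 / D by rewrite divr_ge0 ?sqr_ge0 // ltW.
have x3 : 0 <= x ^+ 3 by rewrite exprn_ge0 // ltW.
apply: le_trans xx3.
apply: (@le_trans _ _ (x ^+ 3 * x ^+ 3)).
  by rewrite expr2; apply: ler_pM => //; exact: coef_t_le.
have x1 : x <= 1 by exact: le_trans xeps eps1.
by rewrite ler_wpM2r // exprS ler_piMr ?(ltW x0) // exprn_ile1 // ltW.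
Qed.

Lemma coef_t_eps : coef_t theta h D ^+ 2 / D <= eps.
Proof.
apply: (le_trans coef_t_le); apply: le_trans xeps.
have x1 : x <= 1 by exact: le_trans xeps eps1.
by rewrite exprS ler_piMr ?(ltW x0) // exprn_ile1 // ltW.
Qed.

End coefficient_bounds.

(** * Estimates in a fixed dimension *)

Section fixed_dimension.
Context {R : realType} {n : nat}.
Variables (A V : 'M[R]_n) (theta h : R).
Hypotheses (Apd : posdefmx A) (Vpd : posdefmx V) (h0 : 0 < h).
Hypotheses (theta01 : 0 <= theta <= 1).
Variables (U : 'M[R]_n) (D : 'rV[R]_n).
Hypotheses (UU : U *m U^T = 1%:M) (D0 : forall i, 0 < D 0 i).
Local Notation S := (sqrtmx V).
Local Notation fc := (fcalc U D).
Hypothesis MD : S *m A *m S = fc id.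

Local Notation B := (invmx S *m sqrtmx (invmx A)).
Local Notation RT := (measurableTypeR R).
Local Notation std := (std_normal_prob n).
Local Notation lr := (log_ratio theta h U D).
Local Notation bb := (2 * theta - 1).
Local Notation wm := (1 + gauss_m4 : R).
Local Notation BB := (state_cov Apd Vpd UU D0 MD).

(** In terms of z and xi, independent and standard Gaussian, the log ratio is
    z^T P z + (T z)^T xi + xi^T K xi. *)
Definition form_P := B^T *m fc (coef_p theta h) *m B.
Definition form_T := fc (coef_t theta h) *m B.
Definition form_K := fc (coef_k theta h).

Lemma log_ratio_forms (z xi : 'cV[R]_n) :
  lr (B *m z) xi =
  dotv z (form_P *m z) + dotv (form_T *m z) xi + dotv xi (form_K *m xi).
Proof.
rewrite /log_ratio /form_T /form_P /form_K; move: (B) => Bm.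
move: (fc _) (fc _) (fc _) => Cp Ct Ck.
by rewrite -!mulmxA (dotv_mulmx Bm^T z) trmxK.
Qed.

Lemma trmx_form_P : form_P^T = form_P.
Proof.
rewrite /form_P; move: (B) (tr_fcalc U D (coef_p theta h)) => Bm.
by move: (fc _) => C CT; rewrite !trmx_mul trmxK CT mulmxA.
Qed.

Lemma trmx_form_K : form_K^T = form_K.
Proof. exact: tr_fcalc. Qed.

Let congr_tr g : \tr (B^T *m fc g *m B) = \sum_i g (D 0 i) / D 0 i.
Proof. by rewrite mxtrace_mulC mulmxA BB fcalcM // mxtrace_fcalc //; apply: eq_bigr => i _; rewrite mulrC. Qed.

Let congr_tr2 g : \tr ((B^T *m fc g *m B) *m (B^T *m fc g *m B)) =
  \sum_i (g (D 0 i) / D 0 i) ^+ 2.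
Proof.
have -> : (B^T *m fc g *m B) *m (B^T *m fc g *m B) =
    B^T *m (fc g *m (B *m B^T) *m fc g) *m B by rewrite !mulmxA.
rewrite BB !fcalcM // congr_tr; apply: eq_bigr => i _.
by rewrite expr2; ring.
Qed.

Let gramE : form_T^T *m form_T = B^T *m fc (fun x => coef_t theta h x ^+ 2) *m B.
Proof.
rewrite /form_T; move: (B) => Bm.
have -> : fc (fun x => coef_t theta h x ^+ 2) = fc (coef_t theta h) *m fc (coef_t theta h).
  by rewrite fcalcM //; apply: eq_fcalc => i; rewrite expr2.
move: (tr_fcalc U D (coef_t theta h)); move: (fc _) => C CT.
by rewrite trmx_mul CT !mulmxA.
Qed.

Variables (q : 'cV[R]_n) (a : R).
Hypotheses (a0 : 0 < a) (qE : fc id *m q = a *: q) (qq : dotv q q = 1).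

Let form_Tq : dotv (form_T^T *m q) (form_T^T *m q) = coef_t theta h a ^+ 2 / a.
Proof.
have TqE : form_T^T *m q = B^T *m (fc (coef_t theta h) *m q).
  rewrite /form_T; move: (B) (tr_fcalc U D (coef_t theta h)) => Bm.
  by move: (fc _) => C CT; rewrite trmx_mul CT mulmxA.
rewrite TqE -dotv_mulmx mulmxA BB.
rewrite !(fcalc_eigenvector UU _ qE) -scalemxAr (fcalc_eigenvector UU _ qE).
by rewrite !dotvZl !dotvZr qq mulr1 expr2 mulrA.
Qed.

Variable w : RT -> R.
Hypothesis ww : weight w.
Variable s : R.
Hypothesis s0 : 0 <= s.

Definition weighted_accept := (\int[std \x std]_v
  (w (dotv q v.2) * accept_exp (lr (B *m v.1) v.2))%:E)%E.

Let weighted_accept_raw (dl : R) : 0 < dl -> ewithin weighted_accept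
  (2 * std_normal_cdf (- (s / 2)))%:E
  (dl * wm + 2 / dl * quad_var * (\tr (form_P *m form_P) + \tr (form_K *m form_K))
    + (`|\tr form_P + \tr form_K + s ^+ 2 / 2| + (wm + 1) * dl + dl
    + (wm + 1) / dl * dotv (form_T^T *m q) (form_T^T *m q)
    + (2 * quad_var * \tr (form_T^T *m form_T *m (form_T^T *m form_T))
       + 2 * (\tr (form_T^T *m form_T) - s ^+ 2) ^+ 2) / dl ^+ 3)).
Proof.
move=> dl0.
have -> : weighted_accept = (\int[std \x std]_v (w (dotv q v.2) * accept_exp
     (dotv v.1 (form_P *m v.1) + dotv (form_T *m v.1) v.2 + dotv v.2 (form_K *m v.2)))%:E)%E.
  by apply: eq_integral => v _; rewrite log_ratio_forms.
exact: (quadratic_accept form_T trmx_form_P trmx_form_K qq ww s0 dl0).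
Qed.

(** Finiteness follows from being close to a finite value, whatever the error. *)
Lemma weighted_accept_fin : exists2 x : R, weighted_accept = x%:E & 0 <= x.
Proof.
have w0 : (0 <= weighted_accept)%E.
  by apply: integral_ge0 => v _; rewrite lee_fin mulr_ge0 ?accept_exp_ge0 //; case: ww.
have [x xE _] := ewithin_fine w0 (weighted_accept_raw ltr01).
by exists x => //; rewrite -lee_fin -xE.
Qed.

(** The error of quadratic_accept once its traces are estimated: Y is the sum of
    the cubes of the scaled eigenvalues x_i = h D_i, and eps bounds each x_i. *)
Definition accept_error (Y eps dl : R) : R :=
  dl * wm + 2 / dl * quad_var * (eps * Y + eps * Y)
    + ((eps * Y + `|s ^+ 2 / 2 - bb ^+ 2 / 32 * Y|) + (wm + 1) * dl + dl
    + (wm + 1) / dl * eps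
    + (2 * quad_var * (eps * Y)
       + 2 * (eps * Y + `|bb ^+ 2 / 16 * Y - s ^+ 2|) ^+ 2) / dl ^+ 3).

Lemma weighted_accept_close (eps dl : R) : 0 < dl -> eps <= 1 ->
  (forall i, h * D 0 i <= eps) -> h * a <= eps ->
  ewithin weighted_accept (2 * std_normal_cdf (- (s / 2)))%:E
    (accept_error (\sum_i (h * D 0 i) ^+ 3) eps dl).
Proof.
move=> dl0 eps1 Deps aeps; set Y := \sum_i _.
apply: ewithin_le (weighted_accept_raw dl0).
have kv0 : 0 <= quad_var :> R := quad_var_ge0.
have wm0 : 0 <= wm by rewrite addr_ge0 // gauss_m4_ge0.
have dl3 : 0 < dl ^+ 3 by rewrite exprn_gt0.
have trPP : \tr (form_P *m form_P) <= eps * Y.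
  rewrite congr_tr2 /Y mulr_sumr; apply: ler_sum => i _.
  exact: coef_p_bound.
have trKK : \tr (form_K *m form_K) <= eps * Y.
  rewrite fcalcM // mxtrace_fcalc // /Y mulr_sumr; apply: ler_sum => i _.
  by rewrite -expr2; exact: coef_k_bound.
have mean : `|\tr form_P + \tr form_K + bb ^+ 2 / 32 * Y| <= eps * Y.
  rewrite congr_tr mxtrace_fcalc // /Y !mulr_sumr -!big_split /=.
  apply: (le_trans (ler_norm_sum _ _ _)); apply: ler_sum => i _.
  exact: coef_mean_bound.
have trG : `|\tr (form_T^T *m form_T) - bb ^+ 2 / 16 * Y| <= eps * Y.
  rewrite gramE congr_tr /Y !mulr_sumr -sumrB.
  apply: (le_trans (ler_norm_sum _ _ _)); apply: ler_sum => i _.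
  exact: coef_t_bound.
have trGG : \tr (form_T^T *m form_T *m (form_T^T *m form_T)) <= eps * Y.
  rewrite gramE congr_tr2 /Y mulr_sumr; apply: ler_sum => i _.
  exact: coef_t_sqr_bound.
have Tq : dotv (form_T^T *m q) (form_T^T *m q) <= eps.
  by rewrite form_Tq; exact: coef_t_eps.
rewrite /accept_error; apply: lerD; first apply: lerD => //.
  by rewrite ler_wpM2l ?lerD // mulr_ge0 // divr_ge0 // ltW.
apply: lerD; first apply: lerD; first apply: lerD => //.
- apply: lerD => //.
  have -> : \tr form_P + \tr form_K + s ^+ 2 / 2 =
    (\tr form_P + \tr form_K + bb ^+ 2 / 32 * Y) + (s ^+ 2 / 2 - bb ^+ 2 / 32 * Y) by ring.
  by apply: (le_trans (ler_normD _ _)); rewrite lerD2r.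
- rewrite ler_wpM2l //; apply: divr_ge0; last exact: ltW.
  exact: addr_ge0.
- rewrite ler_wpM2r ?invr_ge0 ?(ltW dl3) //; apply: lerD.
    by rewrite ler_wpM2l // mulr_ge0.
  rewrite ler_wpM2l // -[leLHS]real_normK ?num_real //.
  rewrite lerXn2r ?nnegrE ?addr_ge0 // ?(le_trans (normr_ge0 _) mean) //.
  have -> : \tr (form_T^T *m form_T) - s ^+ 2 =
    (\tr (form_T^T *m form_T) - bb ^+ 2 / 16 * Y) + (bb ^+ 2 / 16 * Y - s ^+ 2) by ring.
  by apply: (le_trans (ler_normD _ _)); rewrite lerD2r.
Qed.

End fixed_dimension.

Section fixed_dimension_jump.
Context {R : realType} {n : nat}.
Variables (A V : 'M[R]_n) (b : 'cV[R]_n) (theta h : R).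
Hypotheses (Apd : posdefmx A) (Vpd : posdefmx V) (h0 : 0 < h).
Hypotheses (theta01 : 0 <= theta <= 1).
Variables (U : 'M[R]_n) (D : 'rV[R]_n).
Hypotheses (UU : U *m U^T = 1%:M) (D0 : forall i, 0 < D 0 i).
Local Notation S := (sqrtmx V).
Local Notation fc := (fcalc U D).
Hypothesis MD : S *m A *m S = fc id.
Variables (q : 'cV[R]_n) (a : R).
Hypotheses (a0 : 0 < a) (qE : fc id *m q = a *: q) (qq : dotv q q = 1).

Local Notation e := (drift_e theta h).
Local Notation B := (invmx S *m sqrtmx (invmx A)).
Local Notation RT := (measurableTypeR R).
Local Notation std := (std_normal_prob n).
Local Notation lr := (log_ratio theta h U D).
Local Notation BB := (state_cov Apd Vpd UU D0 MD).

Let ea1 : 1 <= e a. Proof. by apply: drift_e_ge1 => //; exact: ltW. Qed.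
Let ea0 : e a != 0. Proof. by rewrite gt_eqF // (lt_le_trans ltr01). Qed.
Let ie0 : 0 <= (e a ^+ 2)^-1. Proof. by rewrite invr_ge0 sqr_ge0. Qed.
Let ie1 : (e a ^+ 2)^-1 <= 1.
Proof. by rewrite invf_le1 ?exprn_gt0 ?(lt_le_trans ltr01) // exprn_ege1. Qed.

Local Notation I2 := (weighted_accept A V theta h U D q (fun x => (x : R) ^+ 2)).

(** The coordinate y of the state has variance 1 / a, hence the weight sqrt a in
    splitting the product x y into squares. *)
Let jump_sqr_dist (x y : R) :
  `|((Num.sqrt h * x - h * a / 2 * y) / e a) ^+ 2 - h / e a ^+ 2 * x ^+ 2| <=
  (h ^+ 2 * a ^+ 2 / 4 + Num.sqrt h * h * a * Num.sqrt a / 2) * y ^+ 2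
   + Num.sqrt h * h * Num.sqrt a / 2 * x ^+ 2.
Proof.
have sh2 : Num.sqrt h ^+ 2 = h by rewrite sqr_sqrtr // ltW.
have sa2 : Num.sqrt a ^+ 2 = a by rewrite sqr_sqrtr // ltW.
have sa0 : 0 < Num.sqrt a by rewrite sqrtr_gt0.
have sh0 : 0 < Num.sqrt h by rewrite sqrtr_gt0.
move: sh2 sa2 sa0 sh0; set k := Num.sqrt h; set c := Num.sqrt a => kh ca c0 k0.
have -> : ((k * x - h * a / 2 * y) / e a) ^+ 2 - h / e a ^+ 2 * x ^+ 2 =
    ((h ^+ 2 * a ^+ 2 / 4 * y ^+ 2) - k * h * c * (x * (c * y))) * (e a ^+ 2)^-1.
  rewrite expr_div_n.
  have -> : (k * x - h * a / 2 * y) ^+ 2 =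
     k ^+ 2 * x ^+ 2 - k * h * a * x * y + h ^+ 2 * a ^+ 2 / 4 * y ^+ 2 by field.
  have -> : k * h * c * (x * (c * y)) = k * h * c ^+ 2 * x * y by ring.
  by rewrite kh ca; field.
have E0 : 0 <= (e a ^+ 2)^-1 by exact: ie0.
rewrite normrM (ger0_norm E0).
apply: (@le_trans _ _ `|h ^+ 2 * a ^+ 2 / 4 * y ^+ 2 - k * h * c * (x * (c * y))|).
  by rewrite ler_piMr.
apply: (le_trans (ler_normB _ _)).
rewrite ger0_norm; last by rewrite mulr_ge0 ?sqr_ge0 // divr_ge0 // mulr_ge0 ?sqr_ge0.
rewrite mulrDl -addrA lerD2l normrM.
have khc : 0 <= k * h * c by rewrite !mulr_ge0 // ltW.
rewrite (ger0_norm khc).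
have -> : k * h * a * c / 2 * y ^+ 2 + k * h * c / 2 * x ^+ 2 =
    k * h * c * ((x ^+ 2 + (c * y) ^+ 2) / 2) by rewrite exprMn ca; field.
rewrite ler_wpM2l // ler_norml.
have h1 := sqr_ge0 (x + c * y); have h2 := sqr_ge0 (x - c * y).
apply/andP; split; nra.
Qed.

Let BTq : dotv (B^T *m q) (B^T *m q) = a^-1.
Proof.
by rewrite -dotv_mulmx mulmxA BB (fcalc_eigenvector UU _ qE) dotvZr qq mulr1.
Qed.

(** The drift part of the jump is of order h, against sqrt h for its noise
    part, so that only the noise part matters. *)
Lemma sqjump_close : ewithin (expected_sqjump A V b theta h q)
  ((h / e a ^+ 2)%:E * I2)%E (h * (h * a / 4 + Num.sqrt h * Num.sqrt a)).
Proof.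
have mz : measurable_fun setT (fun v : 'cV[R]_n * 'cV[R]_n => v.1) by exact: measurable_fst.
have mx : measurable_fun setT (fun v : 'cV[R]_n * 'cV[R]_n => v.2) by exact: measurable_snd.
have mBz : measurable_fun setT (fun v : 'cV[R]_n * 'cV[R]_n => B *m v.1).
  by apply: measurable_mulmx.
have macc : measurable_fun setT (fun v : 'cV[R]_n * 'cV[R]_n => accept_exp (lr (B *m v.1) v.2)).
  by apply: (measurableT_comp measurable_accept_exp); apply: measurable_log_ratio.
have mq1 : measurable_fun setT (fun z : 'cV[R]_n => dotv (B^T *m q) z ^+ 2).
  by apply: measurable_funX; exact: measurable_dotv.
have mq2 : measurable_fun setT (fun z : 'cV[R]_n => dotv q z ^+ 2).
  by apply: measurable_funX; exact: measurable_dotv.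
rewrite (expected_sqjumpE b Apd Vpd h0 theta01 UU D0 MD qE ea0) /weighted_accept.
have k0 : 0 <= h / e a ^+ 2 by rewrite divr_ge0 ?sqr_ge0 // ltW.
have mI : measurable_fun setT (fun v : 'cV[R]_n * 'cV[R]_n =>
    dotv q v.2 ^+ 2 * accept_exp (lr (B *m v.1) v.2)).
  by apply: measurable_funM => //; exact: (measurable_fun_snd1 mq2).
have I0 (v : 'cV[R]_n * 'cV[R]_n) : 0 <= dotv q v.2 ^+ 2 * accept_exp (lr (B *m v.1) v.2).
  by rewrite mulr_ge0 ?sqr_ge0 // accept_exp_ge0.
rewrite -ge0_integralZl //; last 2 first.
- exact/measurable_EFinP.
- by move=> v _; rewrite lee_fin.
pose c1 := h ^+ 2 * a ^+ 2 / 4 + Num.sqrt h * h * a * Num.sqrt a / 2.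
pose c2 := Num.sqrt h * h * Num.sqrt a / 2.
have c10 : 0 <= c1.
  by rewrite addr_ge0 // divr_ge0 // ?mulr_ge0 ?sqr_ge0 ?sqrtr_ge0 // ltW.
have c20 : 0 <= c2 by rewrite divr_ge0 // !mulr_ge0 ?sqrtr_ge0 // ltW.
have m1 := measurable_fun_fst1 (T2 := 'cV[R]_n) mq1.
have m2 := measurable_fun_snd1 (T1 := 'cV[R]_n) mq2.
apply: (ewithin_integral (e := fun v : 'cV[R]_n * 'cV[R]_n =>
   c1 * dotv (B^T *m q) v.1 ^+ 2 + c2 * dotv q v.2 ^+ 2)).
- apply/measurable_EFinP; apply: measurable_funM => //.
  by apply: measurable_funX; apply: measurable_jump.
- by apply/measurable_EFinP; apply: measurable_funM.
- by apply: measurable_funD; apply: measurable_funM.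
- by move=> v; rewrite lee_fin mulr_ge0 ?sqr_ge0 // accept_exp_ge0.
- by move=> v; rewrite lee_fin mulr_ge0.
- by move=> v; rewrite addr_ge0 // mulr_ge0 // sqr_ge0.
- move=> v; apply: ewithin_fin; rewrite [h / _ * _]mulrA -mulrBl normrM.
  rewrite [`|accept_exp _|]ger0_norm ?accept_exp_ge0 //.
  apply: (le_trans (ler_piMr (normr_ge0 _) (accept_exp_le1 _))).
  have -> : dotv (B^T *m q) v.1 = dotv q (B *m v.1) by rewrite dotv_mulmx.
  exact: jump_sqr_dist.
- under eq_integral do rewrite EFinD (EFinM c1) (EFinM c2).
  have em1 : measurable_fun setT (fun v : 'cV[R]_n * 'cV[R]_n =>
      (dotv (B^T *m q) v.1 ^+ 2)%:E) by exact/measurable_EFinP.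
  have em2 : measurable_fun setT (fun v : 'cV[R]_n * 'cV[R]_n =>
      (dotv q v.2 ^+ 2)%:E) by exact/measurable_EFinP.
  rewrite ge0_integralD //; last 4 first.
  + by move=> v _; apply: mule_ge0; rewrite lee_fin ?sqr_ge0.
  + exact: emeasurable_funM.
  + by move=> v _; apply: mule_ge0; rewrite lee_fin ?sqr_ge0.
  + exact: emeasurable_funM.
  rewrite !ge0_integralZl //; try by move=> v _; rewrite lee_fin sqr_ge0.
  rewrite (integral_prod_fst std std mq1) //; last by move=> z; rewrite sqr_ge0.
  rewrite (integral_prod_snd std std mq2) //; last by move=> z; rewrite sqr_ge0.
  rewrite !std_normal_dotv_sqr BTq qq -!EFinM -EFinD lee_fin.
  by rewrite le_eqVlt; apply/orP; left; apply/eqP; rewrite /c1 /c2; field; rewrite gt_eqF.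
Qed.

Lemma sqjump_estimate (s : R) : 0 <= s -> exists2 J : R,
  expected_sqjump A V b theta h q = J%:E &
  forall eps dl, 0 < dl -> eps <= 1 -> (forall i, h * D 0 i <= eps) -> h * a <= eps ->
  `|J - h * (2 * std_normal_cdf (- (s / 2)))| <=
  h * (eps / 4 + Num.sqrt eps
       + accept_error theta s (\sum_i (h * D 0 i) ^+ 3) eps dl
       + 2 * std_normal_cdf (- (s / 2)) * eps).
Proof.
move=> s0.
have [x xE x0] := weighted_accept_fin A V theta h U D qq weight_sqr s0.
have jc := sqjump_close; rewrite xE -EFinM in jc.
have J0 : (0 <= expected_sqjump A V b theta h q)%E.
  rewrite (expected_sqjumpE b Apd Vpd h0 theta01 UU D0 MD qE ea0).
  by apply: integral_ge0 => v _; rewrite lee_fin mulr_ge0 ?sqr_ge0 // accept_exp_ge0.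
have [J JE Jx] := ewithin_fine J0 jc.
exists J => // eps dl dl0 eps1 Deps aeps.
have wc := weighted_accept_close Apd Vpd h0 theta01 UU D0 MD a0 qE qq weight_sqr s0
  dl0 eps1 Deps aeps.
rewrite xE in wc.
have [_ [<-] xPsi] := ewithin_fine (x0 : (0 <= x%:E)%E) wc.
have ia := ie0; have ia1 := ie1.
have psi0 : 0 <= std_normal_cdf (- (s / 2)) by rewrite fine_ge0 ?measure_ge0.
set Psi := 2 * std_normal_cdf (- (s / 2)) in xPsi *.
have Psi0 : 0 <= Psi by rewrite mulr_ge0.
set err := accept_error _ _ _ _ _ in xPsi *.
have err0 : 0 <= err by exact: le_trans xPsi.
have sa : Num.sqrt h * Num.sqrt a <= Num.sqrt eps.
  by rewrite -sqrtrM ?(ltW h0) // ler_wsqrtr.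
have h1 : `|J - h / e a ^+ 2 * x| <= h * (eps / 4 + Num.sqrt eps).
  apply: (le_trans Jx); rewrite ler_wpM2l ?(ltW h0) // lerD //.
  by rewrite ler_wpM2r.
have h2 : `|h / e a ^+ 2 * x - h / e a ^+ 2 * Psi| <= h * err.
  rewrite -mulrBr normrM ger0_norm; last by rewrite mulr_ge0 // ltW.
  rewrite -mulrA ler_wpM2l ?(ltW h0) //.
  by apply: (le_trans _ xPsi); rewrite ler_piMl.
have h3 : `|h / e a ^+ 2 * Psi - h * Psi| <= h * (Psi * eps).
  have -> : h / e a ^+ 2 * Psi - h * Psi = - (h * (Psi * (1 - (e a ^+ 2)^-1))) by ring.
  have o0 : 0 <= 1 - (e a ^+ 2)^-1 by rewrite subr_ge0.
  rewrite normrN ger0_norm; last first.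
    by apply: mulr_ge0; [exact: ltW|exact: mulr_ge0].
  rewrite ler_wpM2l ?(ltW h0) // ler_wpM2l //; apply: le_trans aeps.
  exact: one_sub_inv_sqr_drift.
have -> : J - h * Psi = (J - h / e a ^+ 2 * x) +
    ((h / e a ^+ 2 * x - h / e a ^+ 2 * Psi) + (h / e a ^+ 2 * Psi - h * Psi)) by ring.
apply: (le_trans (ler_normD _ _)); apply: (le_trans (lerD h1 (le_trans (ler_normD _ _) (lerD h2 h3)))).
by rewrite le_eqVlt; apply/orP; left; apply/eqP; ring.
Qed.

End fixed_dimension_jump.

Section spectral_data.
Context {R : realType}.

(** V A is similar to V^(1/2) A V^(1/2), so its characteristic polynomial lists
    the eigenvalues of the latter, up to a permutation that no symmetric function
    of the eigenvalues sees. *)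
Lemma preconditioned_spectrum d (A V : 'M[R]_d) (lam : nat -> R) :
  posdefmx A -> posdefmx V ->
  char_poly (V *m A) = \prod_(1 <= i < d.+1) ('X - (lam i ^+ 2)%:P) ->
  exists (U : 'M[R]_d) (D : 'rV[R]_d), [/\ U *m U^T = 1%:M,
    forall i, 0 < D 0 i, sqrtmx V *m A *m sqrtmx V = fcalc U D id,
    forall g : R -> R, \sum_i g (D 0 i) = \sum_(1 <= i < d.+1) g (lam i ^+ 2) &
    forall i, exists2 j, (1 <= j <= d)%N & D 0 i = lam j ^+ 2].
Proof.
move=> Apd Vpd cp; have [Spd SS] := sqrtmxP Vpd; have Su := posdef_unit Spd.
have Mpd : posdefmx (sqrtmx V *m A *m sqrtmx V).
  by have := posdef_congr Su Apd; rewrite Spd.1.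
have [U [D [UU MD D0]]] := posdef_spectral Mpd.
exists U, D.
have cpD : char_poly (V *m A) = \prod_(i < d) ('X - (D 0 i)%:P).
  have SM : sqrtmx V *m (sqrtmx V *m A *m sqrtmx V) = (V *m A) *m sqrtmx V.
    by rewrite !mulmxA SS.
  rewrite -(char_poly_similar Su SM) MD.
  have Uu : U \in unitmx by have [] := mulmx1_unit UU.
  have UM : U *m fcalc U D id = diag_mx D *m U.
    by rewrite /fcalc map_mx_id // !mulmxA UU mul1mx.
  rewrite (char_poly_similar Uu UM) char_poly_trig ?diag_mx_is_trig //.
  by apply: eq_bigr => i _; rewrite !mxE eqxx mulr1n.
have pe : perm_eq [seq D 0 i | i <- index_enum 'I_d] [seq lam i ^+ 2 | i <- index_iota 1 d.+1].
  by apply: prod_XsubC_perm; rewrite !big_map -cpD cp.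
split=> //.
- move=> g; rewrite -(big_map (fun i => D 0 i) xpredT g) (perm_big _ pe) big_map //.
- move=> i; have : D 0 i \in [seq lam i ^+ 2 | i <- index_iota 1 d.+1].
    by rewrite -(perm_mem pe); apply: map_f; rewrite mem_index_enum.
  by move=> /mapP[j]; rewrite mem_index_iota ltnS => jd ->; exists j.
Qed.

Lemma unit_eigenvector d (U : 'M[R]_d) (D : 'rV[R]_d) (i : 'I_d) :
  U *m U^T = 1%:M -> exists q : 'cV[R]_d,
  fcalc U D id *m q = D 0 i *: q /\ dotv q q = 1.
Proof.
move=> UU; exists (U^T *m delta_mx i 0); split.
  rewrite /fcalc map_mx_id // -!mulmxA (mulmxA U) UU mul1mx scalemxAr; congr (_ *m _).
  apply/colP => j; rewrite mul_diag_mx !mxE.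
  by have [->|] := eqVneq j i; rewrite ?mulr0.
rewrite dotv_mulmx trmxK mulmxA UU mul1mx dotvE (bigD1 i) //= big1 => [|j ji].
  by rewrite !mxE !eqxx mulr1 addr0.
by rewrite !mxE (negPf ji) mulr0.
Qed.

End spectral_data.

(** * The limit of large dimension *)

Section small_error.
Context {R : realType}.
Local Notation wm := (1 + gauss_m4 : R).

Definition error_slope : R := 3 * wm + 6 * quad_var + 13.

(** The largest negative power of dl in the error is the third, so bounds by the
    fourth power leave an error of order dl. *)
Lemma accept_error_small (theta s Y eps dl : R) : 0 < dl -> dl <= 1 ->
  0 <= eps <= dl ^+ 4 -> 0 <= eps * Y <= dl ^+ 4 ->
  `|s ^+ 2 / 2 - (2 * theta - 1) ^+ 2 / 32 * Y| <= dl ^+ 4 ->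
  `|(2 * theta - 1) ^+ 2 / 16 * Y - s ^+ 2| <= dl ^+ 4 ->
  accept_error theta s Y eps dl <= error_slope * dl.
Proof.
move=> dl0 dl1 /andP[e0 e1] /andP[p0 p1]; rewrite /accept_error /error_slope.
set r1 := `|s ^+ 2 / 2 - _|; set r2 := `|_ - s ^+ 2| => r11 r21.
move: (eps * Y) p0 p1 => p p0 p1.
have r10 : 0 <= r1 by exact: normr_ge0.
have r20 : 0 <= r2 by exact: normr_ge0.
have w1 : 1 <= wm by rewrite lerDl gauss_m4_ge0.
have q0 : 0 <= quad_var :> R := quad_var_ge0.
move: (1 + gauss_m4 : R) w1 => w w1.
move: (quad_var : R) q0 => k k0.
have dl4 (y : R) : y <= dl ^+ 4 -> y / dl <= dl.
  move=> yd; rewrite ler_pdivrMr // (le_trans yd) // -expr2.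
  by rewrite ler_wiXn2l // ltW.
have dl43 (y : R) : y <= dl ^+ 4 -> y / dl ^+ 3 <= dl.
  by move=> yd; rewrite ler_pdivrMr ?exprn_gt0 // -exprS.
have dl41 (y : R) : y <= dl ^+ 4 -> y <= dl.
  by move=> yd; rewrite (le_trans yd) // -[leRHS]expr1 ler_wiXn2l // ltW.
have h1 : p / dl <= dl by exact: dl4.
have h2 : eps / dl <= dl by exact: dl4.
have h3 : p / dl ^+ 3 <= dl by exact: dl43.
have h4 : (p + r2) ^+ 2 / dl ^+ 3 <= 4 * dl.
  rewrite ler_pdivrMr ?exprn_gt0 // -mulrA -exprS.
  have pr : p + r2 <= 2 * dl ^+ 4 by lra.
  apply: (@le_trans _ _ ((2 * dl ^+ 4) ^+ 2)).
    by rewrite lerXn2r ?nnegrE ?addr_ge0 // mulr_ge0 // exprn_ge0 // ltW.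
  have -> : (2 * dl ^+ 4) ^+ 2 = 4 * (dl ^+ 4 * dl ^+ 4) by ring.
  by rewrite ler_wpM2l // ler_piMl ?exprn_ge0 ?exprn_ile1 // ltW.
have h5 : p <= dl by exact: dl41.
have h6 : r1 <= dl by exact: dl41.
have -> : dl * w + 2 / dl * k * (p + p) + (p + r1 + (w + 1) * dl + dl + (w + 1) / dl * eps
   + (2 * k * p + 2 * (p + r2) ^+ 2) / dl ^+ 3) =
   dl * w + 4 * k * (p / dl) + (p + r1 + (w + 1) * dl + dl + (w + 1) * (eps / dl)
   + (2 * k * (p / dl ^+ 3) + 2 * ((p + r2) ^+ 2 / dl ^+ 3))) by ring.
have g1 : k * (p / dl) <= k * dl by rewrite ler_wpM2l.
have g2 : (w + 1) * (eps / dl) <= (w + 1) * dl by rewrite ler_wpM2l //; lra.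
have g3 : k * (p / dl ^+ 3) <= k * dl by rewrite ler_wpM2l.
lra.
Qed.

End small_error.

Section scaling.
Context {R : realType}.
Variables (theta c C kappa l r tau : R) (lam : nat -> nat -> R) (h : nat -> R).
Hypotheses (C0 : 0 < C) (kappa0 : 0 <= kappa).
Hypothesis lam0 : forall d i, (1 <= i <= d)%N -> 0 < lam d i.
Hypothesis lam_bound : forall d i, (1 <= i <= d)%N ->
  c * i%:R `^ kappa <= lam d i <= C * i%:R `^ kappa.
Hypotheses (l0 : 0 < l) (rE : r = 1 / 3 + 2 * kappa).
Hypothesis hE : forall d, h d = l ^+ 2 * d%:R `^ (- r).
Hypothesis tau_lim : (fun d : nat =>
  (\sum_(1 <= i < d.+1) lam d i ^+ 6) / d%:R `^ (6 * kappa + 1)) @ \oo --> tau.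

(** h lambda_i^2 is largest at i = d, where it is at most
    l^2 C^2 d^(2 kappa - r) with 2 kappa - r = - 1 / 3. *)
Definition scale_eps (d : nat) : R := l ^+ 2 * C ^+ 2 * d%:R `^ (- (1 / 3)).
Definition scale_Y (d : nat) : R := \sum_(1 <= i < d.+1) (h d * lam d i ^+ 2) ^+ 3.
Definition scale_s : R := l ^+ 3 * `|theta - 1 / 2| * Num.sqrt tau / 2.

Lemma step_gt0 d : (0 < d)%N -> 0 < h d.
Proof.
move=> d0; rewrite hE; apply: mulr_gt0; first exact: exprn_gt0.
by apply: powR_gt0; rewrite ltr0n.
Qed.

Lemma scaled_eigenvalue_le d i : (1 <= i <= d)%N -> h d * lam d i ^+ 2 <= scale_eps d.
Proof.
move=> id; have /andP[i1 idd] := id.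
have d0 : (0 < d)%N by exact: leq_trans idd.
have dn0 : d%:R != 0 :> R by rewrite pnatr_eq0 -lt0n.
have /andP[_ lu] := lam_bound id.
have id' : i%:R `^ kappa <= d%:R `^ kappa :> R.
  by apply: ge0_ler_powR; rewrite ?nnegrE // ler_nat.
have l2 : lam d i ^+ 2 <= (C * d%:R `^ kappa) ^+ 2.
  rewrite lerXn2r ?nnegrE ?(ltW (lam0 id)) ?mulr_ge0 ?powR_ge0 ?(ltW C0) //.
  by apply: (le_trans lu); rewrite ler_wpM2l // ltW.
apply: (@le_trans _ _ (h d * (C * d%:R `^ kappa) ^+ 2)).
  by rewrite ler_wpM2l // ltW // step_gt0.
rewrite hE /scale_eps exprMn.
have -> : l ^+ 2 * C ^+ 2 * d%:R `^ (- (1 / 3)) = l ^+ 2 * C ^+ 2 * (d%:R `^ (- r) * (d%:R `^ kappa) ^+ 2).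
  rewrite (expr2 (_ `^ kappa)) -!powRD ?dn0 ?implybT //; congr (_ * _ `^ _).
  by rewrite rE; ring.
by rewrite le_eqVlt; apply/orP; left; apply/eqP; ring.
Qed.

Lemma scale_eps_ge0 d : 0 <= scale_eps d.
Proof. by apply: mulr_ge0; [apply: mulr_ge0; exact: sqr_ge0|exact: powR_ge0]. Qed.

Lemma scale_Y_ge0 d : 0 <= scale_Y d.
Proof.
rewrite /scale_Y sumr_ge0 // => i _; rewrite exprn_ge0 // mulr_ge0 ?sqr_ge0 //.
by rewrite hE; apply: mulr_ge0; [exact: sqr_ge0|exact: powR_ge0].
Qed.

Lemma scale_eps_cvg : scale_eps @ \oo --> 0.
Proof.
suff H : (fun d : nat => d%:R `^ (- (1 / 3)) : R) @ \oo --> (0 : R).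
  by rewrite -(mulr0 (l ^+ 2 * C ^+ 2)); apply: cvgM; [exact: cvg_cst|exact: H].
apply/cvgr0Pnorm_lt => e e0; near=> d.
have d0 : e^-1 ^+ 3 < d%:R by near: d; exact: nbhs_infty_gtr.
have e3 : 0 < e^-1 ^+ 3 by rewrite exprn_gt0 // invr_gt0.
have dp : 0 < d%:R :> R by exact: lt_trans d0.
rewrite ger0_norm ?powR_ge0 // powRN -[ltRHS]invrK ltf_pV2 ?posrE ?invr_gt0 ?powR_gt0 //.
have -> : e^-1 = (e^-1 ^+ 3) `^ (1 / 3).
  have ei : 0 <= e^-1 by rewrite invr_ge0 ltW.
  by rewrite -powR_mulrn // -powRrM mulrCA divff // mulr1 powRr1.
by apply: gt0_ltr_powR; rewrite ?nnegrE ?divr_gt0 // ltW.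
Unshelve. all: by end_near. Qed.

Lemma scale_Y_cvg : scale_Y @ \oo --> l ^+ 6 * tau.
Proof.
have H : (fun d : nat => l ^+ 6 * ((\sum_(1 <= i < d.+1) lam d i ^+ 6) / d%:R `^ (6 * kappa + 1)))
    @ \oo --> l ^+ 6 * tau.
  by apply: cvgM; [exact: cvg_cst|exact: tau_lim].
apply: cvg_trans H; apply: near_eq_cvg; near=> d.
have dn0 : d%:R != 0 :> R by rewrite pnatr_eq0 -lt0n; near: d; exact: nbhs_infty_gt.
rewrite /scale_Y -powRN mulrCA mulr_suml; apply: eq_bigr => i _.
have -> : d%:R `^ (- (6 * kappa + 1)) = (d%:R `^ (- r)) ^+ 3 :> R.
  rewrite !exprS expr0 mulr1 -!powRD ?dn0 ?implybT //; congr (_ `^ _).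
  by rewrite rE; field.
by rewrite hE; ring.
Unshelve. all: by end_near. Qed.

Lemma tau_ge0 : 0 <= tau.
Proof.
have Y0 : 0 <= l ^+ 6 * tau.
  have := scale_Y_cvg => H.
  rewrite -(cvg_lim (@Rhausdorff R) H).
  by apply: limr_ge; [apply/cvg_ex; eexists; exact: H|near=> d; exact: scale_Y_ge0].
by rewrite -(pmulr_rge0 _ (exprn_gt0 6 l0)).
Unshelve. all: by end_near. Qed.

Lemma scale_s_ge0 : 0 <= scale_s.
Proof.
apply: divr_ge0 => //; apply: mulr_ge0; last exact: sqrtr_ge0.
by apply: mulr_ge0 => //; rewrite exprn_ge0 // ltW.
Qed.

(** The limit of the variance of the cross term. *)
Lemma scale_s2 : scale_s ^+ 2 = (2 * theta - 1) ^+ 2 / 16 * (l ^+ 6 * tau).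
Proof.
rewrite /scale_s !exprMn real_normK ?num_real // sqr_sqrtr ?tau_ge0 //.
by field.
Qed.

Lemma error_terms_small (rho : R) : 0 < rho -> \forall d \near \oo,
  [/\ scale_eps d <= rho, scale_eps d * scale_Y d <= rho,
    `|scale_s ^+ 2 / 2 - (2 * theta - 1) ^+ 2 / 32 * scale_Y d| <= rho &
    `|(2 * theta - 1) ^+ 2 / 16 * scale_Y d - scale_s ^+ 2| <= rho].
Proof.
move=> rho0.
have H1 := @cvgr0_norm_le _ _ _ _ _ _ scale_eps_cvg _ rho0.
have c2 : (fun d => scale_eps d * scale_Y d) @ \oo --> 0.
  by rewrite -(mul0r (l ^+ 6 * tau)); apply: cvgM; [exact: scale_eps_cvg|exact: scale_Y_cvg].
have H2 := @cvgr0_norm_le _ _ _ _ _ _ c2 _ rho0.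
have c3 : (fun d => scale_s ^+ 2 / 2 - (2 * theta - 1) ^+ 2 / 32 * scale_Y d) @ \oo --> 0.
  have -> : 0 = scale_s ^+ 2 / 2 - (2 * theta - 1) ^+ 2 / 32 * (l ^+ 6 * tau) :> R.
    by rewrite scale_s2; field.
  apply: cvgB; first exact: cvg_cst.
  by apply: cvgM; [exact: cvg_cst|exact: scale_Y_cvg].
have H3 := @cvgr0_norm_le _ _ _ _ _ _ c3 _ rho0.
have c4 : (fun d => (2 * theta - 1) ^+ 2 / 16 * scale_Y d - scale_s ^+ 2) @ \oo --> 0.
  have -> : 0 = (2 * theta - 1) ^+ 2 / 16 * (l ^+ 6 * tau) - scale_s ^+ 2 :> R.
    by rewrite scale_s2 subrr.
  apply: cvgB; last exact: cvg_cst.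
  by apply: cvgM; [exact: cvg_cst|exact: scale_Y_cvg].
have H4 := @cvgr0_norm_le _ _ _ _ _ _ c4 _ rho0.
near=> d; split.
- by apply: (le_trans (ler_norm _)); near: d; exact: H1.
- by apply: (le_trans (ler_norm _)); near: d; exact: H2.
- by near: d; exact: H3.
- by near: d; exact: H4.
Unshelve. all: by end_near. Qed.

Lemma scale_error_small (eta : R) : 0 < eta -> exists2 dl : R, 0 < dl &
  \forall d \near \oo, scale_eps d <= 1 /\
    scale_eps d / 4 + Num.sqrt (scale_eps d)
    + accept_error theta scale_s (scale_Y d) (scale_eps d) dl
    + 2 * std_normal_cdf (- (scale_s / 2)) * scale_eps d <= eta /\
    accept_error theta scale_s (scale_Y d) (scale_eps d) dl <= eta.
Proof.
move=> eta0.
have psi0 : 0 <= std_normal_cdf (- (scale_s / 2)) by rewrite fine_ge0 ?measure_ge0.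
set Psi := 2 * std_normal_cdf _.
have Psi0 : 0 <= Psi by rewrite mulr_ge0.
have w0 : 0 <= gauss_m4 :> R := gauss_m4_ge0.
have q0 : 0 <= quad_var :> R := quad_var_ge0.
pose K : R := error_slope + 2 + Psi.
have K0 : 0 < K by rewrite /K /error_slope; lra.
pose dl := Num.min 1 (eta / K).
have dl0 : 0 < dl by rewrite lt_min ltr01 divr_gt0.
have dl1 : dl <= 1 by rewrite ge_min lexx.
have dlK : K * dl <= eta by rewrite mulrC -ler_pdivlMr // ge_min lexx orbT.
exists dl => //; have := error_terms_small (exprn_gt0 4 dl0).
apply: filterS => d [e1 e2 e3 e4].
have e0 := scale_eps_ge0 d; have Y0 := scale_Y_ge0 d.
have err : accept_error theta scale_s (scale_Y d) (scale_eps d) dl <= error_slope * dl.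
  by apply: accept_error_small => //; apply/andP; split=> //; rewrite mulr_ge0.
have d4 : dl ^+ 4 <= dl by rewrite -[leRHS]expr1 ler_wiXn2l // ltW.
have ed : scale_eps d <= dl by exact: le_trans d4.
have se : Num.sqrt (scale_eps d) <= dl.
  have -> : dl = Num.sqrt (dl ^+ 2) by rewrite sqrtr_sqr gtr0_norm.
  by rewrite ler_wsqrtr // (le_trans e1) // ler_wiXn2l // ltW.
have pe : Psi * scale_eps d <= Psi * dl by rewrite ler_wpM2l.
split; first exact: le_trans dl1.
have KE : K * dl = error_slope * dl + 2 * dl + Psi * dl by rewrite /K !mulrDl.
have pd : 0 <= Psi * dl by rewrite mulr_ge0 // ltW.
by split; lra.
Qed.

End scaling.

(** The weight is constant here, so that any eigenvector can be used. *)
Lemma expected_accept_spectrum (R : realType) d (A V : 'M[R]_d) (b : 'cV[R]_d)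
    (theta h : R) (lam : nat -> R) (s : R) :
  (0 < d)%N -> posdefmx A -> posdefmx V -> 0 < h -> 0 <= theta <= 1 ->
  char_poly (V *m A) = \prod_(1 <= i < d.+1) ('X - (lam i ^+ 2)%:P) -> 0 <= s ->
  exists2 x : R, expected_accept A V b theta h = x%:E &
  forall eps dl, 0 < dl -> eps <= 1 ->
  (forall i, (1 <= i <= d)%N -> h * lam i ^+ 2 <= eps) ->
  `|x - 2 * std_normal_cdf (- (s / 2))| <=
  accept_error theta s (\sum_(1 <= i < d.+1) (h * lam i ^+ 2) ^+ 3) eps dl.
Proof.
move=> d0 Apd Vpd h0 theta01 cp s0.
have [U [D [UU D0 MD sumD memD]]] := preconditioned_spectrum Apd Vpd cp.
have [q [qE qq]] := unit_eigenvector D (Ordinal d0) UU.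
have [x xE x0] := weighted_accept_fin A V theta h U D qq weight1 s0.
have EE : expected_accept A V b theta h = x%:E.
  rewrite (expected_acceptE b Apd Vpd h0 theta01 UU D0 MD) -xE /weighted_accept.
  by apply: eq_integral => v _; rewrite mul1r.
exists x => // eps dl dl0 eps1 leps.
have Deps i : h * D 0 i <= eps by have [j jd ->] := memD i; exact: leps.
have := weighted_accept_close Apd Vpd h0 theta01 UU D0 MD (D0 (Ordinal d0)) qE qq
  weight1 s0 dl0 eps1 Deps (Deps _).
rewrite xE (sumD (fun x => (h * x) ^+ 3)) => wc.
by have [_ [<-]] := ewithin_fine (x0 : (0 <= x%:E)%E) wc.
Qed.

Lemma expected_sqjump_spectrum (R : realType) d (A V : 'M[R]_d) (b : 'cV[R]_d)
    (theta h : R) (lam : nat -> R) (s : R) (i : nat) (q : 'cV[R]_d) :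
  (1 <= i <= d)%N -> posdefmx A -> posdefmx V -> 0 < h -> 0 <= theta <= 1 ->
  char_poly (V *m A) = \prod_(1 <= i < d.+1) ('X - (lam i ^+ 2)%:P) ->
  0 < lam i -> sqrtmx V *m A *m sqrtmx V *m q = lam i ^+ 2 *: q ->
  (q^T *m q) 0 0 = 1 -> 0 <= s ->
  exists2 J : R, expected_sqjump A V b theta h q = J%:E &
  forall eps dl, 0 < dl -> eps <= 1 ->
  (forall i, (1 <= i <= d)%N -> h * lam i ^+ 2 <= eps) ->
  `|J - h * (2 * std_normal_cdf (- (s / 2)))| <=
  h * (eps / 4 + Num.sqrt eps
       + accept_error theta s (\sum_(1 <= i < d.+1) (h * lam i ^+ 2) ^+ 3) eps dl
       + 2 * std_normal_cdf (- (s / 2)) * eps).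
Proof.
move=> id Apd Vpd h0 theta01 cp lam0 qE qq s0.
have [U [D [UU D0 MD sumD memD]]] := preconditioned_spectrum Apd Vpd cp.
rewrite MD in qE.
have [J JE Jb] := sqjump_estimate b Apd Vpd h0 theta01 UU D0 MD (exprn_gt0 2 lam0) qE qq s0.
exists J => // eps dl dl0 eps1 leps.
rewrite -(sumD (fun x => (h * x) ^+ 3)); apply: Jb => //; last exact: leps.
by move=> j; have [k kd ->] := memD j; exact: leps.
Qed.

Theorem theorem5p5 (R : realType)
  (A V : forall d : nat, 'M[R]_d) (b : forall d : nat, 'cV[R]_d)
  (theta c C kappa l r tau : R) (lam : nat -> nat -> R) (h : nat -> R) :
  (forall d, posdefmx (A d)) ->
  (forall d, posdefmx (V d)) ->
  0 <= theta <= 1 ->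
  0 < c -> 0 < C -> 0 <= kappa ->
  (forall d, char_poly (V d *m A d) =
     \prod_(1 <= i < d.+1) ('X - (lam d i ^+ 2)%:P)) ->
  (forall d i, (1 <= i <= d)%N -> 0 < lam d i) ->
  (forall d i, (1 <= i <= d)%N ->
     c * i%:R `^ kappa <= lam d i <= C * i%:R `^ kappa) ->
  0 < l ->
  r = 1 / 3 + 2 * kappa ->
  (forall d, h d = l ^+ 2 * d%:R `^ (- r)) ->
  (fun d : nat => (\sum_(1 <= i < d.+1) lam d i ^+ 6) / d%:R `^ (6 * kappa + 1))
     @ \oo --> tau ->
  let s := - (l ^+ 3 * `|theta - 1 / 2| * Num.sqrt tau / 4) in
  (fun d : nat => expected_accept (A d) (V d) (b d) theta (h d)) @ \oo
     --> (2 * std_normal_cdf s)%:E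
  /\
  forall (i : nat) (q : forall d : nat, 'cV[R]_d),
    (1 <= i)%N ->
    (forall d, (i <= d)%N ->
       sqrtmx (V d) *m A d *m sqrtmx (V d) *m q d = lam d i ^+ 2 *: q d /\
       ((q d)^T *m q d) 0 0 = 1) ->
    exists2 e : nat -> R,
      e =o_\oo (fun d : nat => d%:R `^ (- r)) &
      forall d, (i <= d)%N ->
        expected_sqjump (A d) (V d) (b d) theta (h d) (q d) =
          (2 * l ^+ 2 * d%:R `^ (- r) * std_normal_cdf s + e d)%:E.
Proof.
move=> Apd Vpd theta01 c0 C0 kappa0 cp lam0 lam_bound l0 rE hE tau_lim s.
pose sg := scale_s theta l tau.
have sg0 : 0 <= sg by exact: scale_s_ge0.
have sE : s = - (sg / 2) by rewrite /s /sg /scale_s; field.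
have small := scale_error_small theta C l0 rE hE tau_lim.
have hp d : (0 < d)%N -> 0 < h d by exact: step_gt0 l0 hE d.
have leps d i : (1 <= i <= d)%N -> h d * lam d i ^+ 2 <= scale_eps C l d.
  exact: scaled_eigenvalue_le C0 kappa0 lam0 lam_bound l0 rE hE d i.
rewrite sE; split.
  apply/fine_cvgP; split.
    near=> d; have d0 : (0 < d)%N by near: d; exact: nbhs_infty_gt.
    by have [x -> _] := expected_accept_spectrum (b d) d0 (Apd d) (Vpd d) (hp d d0) theta01 (cp d) sg0.
  apply/cvgrPdist_le => eta eta0; have [dl dl0 sm] := small _ eta0.
  near=> d; have d0 : (0 < d)%N by near: d; exact: nbhs_infty_gt.
  have [x /= -> xb] := expected_accept_spectrum (b d) d0 (Apd d) (Vpd d) (hp d d0) theta01 (cp d) sg0.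
  have [//|e1 [_ e2]] := near sm d.
  rewrite distrC; apply: le_trans e2; apply: xb => //; exact: leps.
move=> i q i1 qE.
have est d (id : (i <= d)%N) :=
  let iid : (1 <= i <= d)%N := introT andP (conj i1 id) in
  expected_sqjump_spectrum (b d) iid (Apd d) (Vpd d)
    (hp d (leq_trans i1 id)) theta01 (cp d) (lam0 d i iid) (qE d id).1 (qE d id).2 sg0.
exists (fun d => fine (expected_sqjump (A d) (V d) (b d) theta (h d) (q d))
   - 2 * l ^+ 2 * d%:R `^ (- r) * std_normal_cdf (- (sg / 2))).
  apply/eqoP => eps eps0.
  have [dl dl0 sm] := small _ (divr_gt0 eps0 (exprn_gt0 2 l0)).
  near=> d; have id : (i <= d)%N by near: d; exact: nbhs_infty_ge.
  have [J /= -> Jb] := est d id.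
  have [//|e1 [e2 _]] := near sm d.
  have -> : 2 * l ^+ 2 * d%:R `^ (- r) * std_normal_cdf (- (sg / 2)) =
      h d * (2 * std_normal_cdf (- (sg / 2))) by rewrite hE; ring.
  apply: (le_trans (Jb _ _ dl0 e1 (leps d))).
  rewrite (ger0_norm (powR_ge0 _ _)).
  have -> : eps * d%:R `^ (- r) = h d * (eps / l ^+ 2).
    by rewrite hE; field; rewrite gt_eqF.
  by rewrite ler_wpM2l // ltW // hp // (leq_trans i1 id).
move=> d id; have [J -> _] := est d id.
by congr EFin; rewrite addrC subrK.
Unshelve. all: by end_near. Qed.
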